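(* Let $1<\alpha<2$ and $\Omega=\{(x,y,t):0\le x,y\le1,\ 0\le t\le T\}$. Any continuous solution to the problem consisting of the equation on $\Omega$ $${}_cD^\alpha_{0t}u(x,y,t)=u_{xx}+\frac1x u_x+u_{yy}+f(x,y,t)$$ with boundary conditions $$\lim_{x\to0}x\,u_x=0,\quad u(1,y,t)=0,\quad u(x,0,t)=0,\quad u(x,1,t)=0$$ and initial conditions $$u(x,y,0)=\varphi(x,y),\quad u_t(x,y,0)=\psi(x,y)$$ must be unique.
   Context: $f$ is a given function of $(x,y,t)$ and $\varphi,\psi$ are given functions of $(x,y)$. For $1<\alpha<2$ the Caputo derivative is ${}_cD^\alpha_{0t}g(t)=\frac{1}{\Gamma(2-\alpha)}\int_0^t\frac{g''(z)}{(t-z)^{\alpha-1}}\,dz$, applied to $u(x,y,t)$ in the variable $t$. *)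

(* Defs.v *)
From HB Require Import structures.
From mathcomp Require Import all_boot all_order all_algebra.
From mathcomp Require Import all_classical all_reals all_analysis.
Import Order.TTheory GRing.Theory Num.Theory.
Import numFieldNormedType.Exports.

Set Implicit Arguments.
Unset Strict Implicit.
Unset Printing Implicit Defensive.

Local Open Scope ring_scope.
Local Open Scope classical_set_scope.

Definition Gamma (R : realType) (a : R) : R :=
  \int[lebesgue_measure]_(s in `]0, +oo[) (s `^ (a - 1) * expR (- s)).

Definition caputo_integrand (R : realType) (alpha : R) (g : R -> R) (t z : R) :=
  (g^`(2))%classic z / (t - z) `^ (alpha - 1).

(* Lebesgue integral over the open interval: the values of g'' at the
   endpoints, where only one-sided derivatives make sense, are not used. *)
Definition caputo (R : realType) (alpha : R) (g : R -> R) (t : R) : R :=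
  (Gamma (2 - alpha))^-1 *
  \int[lebesgue_measure]_(z in `]0, t[) caputo_integrand alpha g t z.

(* The defining integral must converge; otherwise [Rintegral] would return a
   junk value. *)
Definition has_caputo (R : realType) (alpha : R) (g : R -> R) (t : R) : Prop :=
  (forall z : R, 0 < z <= t -> derivable g z 1 /\ derivable g^`() z 1) /\
  lebesgue_measure.-integrable `]0, t[
    (fun z => (caputo_integrand alpha g t z)%:E).

Section Problem.
Context (R : realType).
Implicit Types (u f : R -> R -> R -> R) (phi psi : R -> R -> R) (T : R).

Definition Omega T : set (R * R * R) := `[0, 1] `*` `[0, 1] `*` `[0, T].

Definition Omega_int T : set (R * R * R) := `]0, 1[ `*` `]0, 1[ `*` `]0, T[.

(* The interior together with the part t = 0 of the boundary. *)
Definition Omega_init T : set (R * R * R) := `]0, 1[ `*` `]0, 1[ `*` `[0, T[.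

Definition continuous_on (A : set (R * R * R)) u : Prop :=
  {within A, continuous (fun p : R * R * R => u p.1.1 p.1.2 p.2)}.

Definition pdx u : R -> R -> R -> R := fun x y t => (fun s => u s y t)^`() x.

Definition pdy u : R -> R -> R -> R := fun x y t => (fun s => u x s t)^`() y.

Definition has_pdx u x y t : Prop := derivable (fun s => u s y t) x 1.

Definition has_pdy u x y t : Prop := derivable (fun s => u x s t) y 1.

Definition quot0 u x y : R -> R := fun h => h^-1 * (u x y h - u x y 0).

(* u_t, as a right derivative when t = 0: solutions only matter on Omega, so
   their values at t < 0 must not be used. *)
Definition pdt u : R -> R -> R -> R := fun x y t =>
  if t == 0 then lim (quot0 u x y h @[h --> 0^'+]) else (u x y)^`() t.

(* A solution is continuous on Omega, and each derivative occurring in the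
   problem exists where the problem refers to it: the equation is posed in the
   interior (1/x and two-sided derivatives make no sense on the boundary), and
   the initial velocity at t = 0.  The partial derivatives u_x, u_xx, u_yy and
   u_t are moreover continuous there; u_tt is only required to exist and to
   make the Caputo integral converge. *)
Record is_solution (alpha T : R) f phi psi u : Prop := IsSolution {
  sol_continuous : continuous_on (Omega T) u ;
  sol_has_ux : forall x y t, Omega_int T (x, y, t) -> has_pdx u x y t ;
  sol_has_uxx : forall x y t, Omega_int T (x, y, t) -> has_pdx (pdx u) x y t ;
  sol_has_uy : forall x y t, Omega_int T (x, y, t) -> has_pdy u x y t ;
  sol_has_uyy : forall x y t, Omega_int T (x, y, t) -> has_pdy (pdy u) x y t ;
  sol_has_caputo : forall x y t, Omega_int T (x, y, t) ->
    has_caputo alpha (u x y) t ;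
  sol_ux_continuous : continuous_on (Omega_int T) (pdx u) ;
  sol_uxx_continuous : continuous_on (Omega_int T) (pdx (pdx u)) ;
  sol_uyy_continuous : continuous_on (Omega_int T) (pdy (pdy u)) ;
  sol_ut_continuous : continuous_on (Omega_init T) (pdt u) ;
  sol_equation : forall x y t, Omega_int T (x, y, t) ->
    caputo alpha (u x y) t =
    pdx (pdx u) x y t + x^-1 * pdx u x y t + pdy (pdy u) x y t + f x y t ;
  sol_boundary_x0 : forall y t : R, 0 < y < 1 -> 0 < t < T ->
    x * pdx u x y t @[x --> 0^'+] --> (0 : R) ;
  sol_boundary_x1 : forall y t : R, 0 <= y <= 1 -> 0 <= t <= T -> u 1 y t = 0 ;
  sol_boundary_y0 : forall x t : R, 0 <= x <= 1 -> 0 <= t <= T -> u x 0 t = 0 ;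
  sol_boundary_y1 : forall x t : R, 0 <= x <= 1 -> 0 <= t <= T -> u x 1 t = 0 ;
  sol_initial : forall x y : R, 0 <= x <= 1 -> 0 <= y <= 1 ->
    u x y 0 = phi x y ;
  sol_has_initial_velocity : forall x y : R, 0 < x < 1 -> 0 < y < 1 ->
    cvg (quot0 u x y h @[h --> 0^'+]) ;
  sol_initial_velocity : forall x y : R, 0 < x < 1 -> 0 < y < 1 ->
    pdt u x y 0 = psi x y
}.

End Problem.

(* Main.v *)
(** The difference w of two solutions solves the homogeneous problem.  Integrating the
    equation in time gives c (k * w_t)(s) = \int_0^s (w_xx + w_x / x + w_yy) dt with
    k(r) = r^(1 - alpha), where c >= 0.  Nothing is known about the space derivatives near
    the boundary, so w is not used as a test function; instead the equation is integrated
    over [a, 1 - a]^2 against the product of the Green functions of the two one-dimensional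
    operators, which removes all space derivatives and leaves c (k * z')(s) = \int_0^s e
    with z and e expressed by w alone.  Since \int_0^s z (k * z') >= 0 when z(0) = 0, one
    gets \int_0^s z(t) (\int_0^t e) dt >= 0, and a --> 0 turns this into the same inequality
    for z = Kx Ky w and e = - (Ky w + Kx w), with Kx and Ky the inverses of minus the two
    operators; the boundary terms disappear by the Dirichlet conditions, and at x = 0
    because the Green function of the radial operator does not see that endpoint in the limit.

    Multiplied by x and integrated over the unit square, the right-hand side becomes minus
    half the sum of two nonnegative quadratic forms in \int_0^s Ky w and \int_0^s Kx w.  So
    both vanish; the first is definite, whence \int_0^s Ky w = 0, and as Ky is definite too,
    \int_0^s w = 0 for all s.  Differentiating in s gives w = 0. *)

Require Import Defs.
From mathcomp Require Import all_boot all_order all_algebra.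
From mathcomp Require Import all_classical all_reals all_analysis.
From mathcomp Require Import measurable_realfun ring lra.
Import Order.TTheory GRing.Theory Num.Theory.
Import numFieldNormedType.Exports.
Set Implicit Arguments.
Unset Strict Implicit.
Unset Printing Implicit Defensive.
Local Open Scope ring_scope.
Local Open Scope classical_set_scope.

(** Since [h'' + h' / x = x^-1 (x h')'], the radial operator is symmetric only for the measure
    [x dx], with [ln] in the place of the identity. Hence the factor [xi] in its Green function and
    the factor [x] before the last integration. Positivity in time is used at each fixed point of
    the square, for scalar functions of [t]; space is integrated last. The pairing of [Kx Ky w] with
    the primitive of [Ky w] is, for fixed [y], a [Kx]-form in [Ky w]. The pairing with the primitive
    of [Kx w] is, for fixed [x], a [Ky]-form in [Kx w]. A symmetric kernel turns
    [\int_0^s h_xi (\int_0^t h_x)] into half of a product of integrals over [[0, s]], which is why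
    the forms are evaluated at [\int_0^s]. Two gaps in regularity shape the proof. [w_tt] is a
    derivative that merely exists everywhere, so that integrating it calls for the fundamental
    theorem for integrable, possibly discontinuous derivatives. The space derivatives are continuous
    only for [t > 0], so the equation is integrated over [[r, t]], and [r] tends to 0 only after
    they have been removed. *)

Definition mbd (R : realType) d (X : measurableType d) (f : X -> R) :=
  measurable_fun [set: X] f /\ exists C, forall x, `|f x| <= C.

(** The domain of integration is encoded in [q], which may be an indicator, a singular kernel or a
    Green function. An integrable [q] times a bounded measurable [f] is integrable, so [weight] and
    [mbd] are the only side conditions of linearity, Fubini and dominated convergence. *)
Definition J (R : realType) (q f : R -> R) : R :=
  \int[@lebesgue_measure R]_x (q x * f x).

Definition weight (R : realType) (q : R -> R) :=
  (@lebesgue_measure R).-integrable [set: measurableTypeR R] (EFin \o q).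

(** * Weights and bounded measurable functions *)

Section Mbd.
Context (R : realType).
Local Notation RT := (measurableTypeR R).
Local Notation mu := (@lebesgue_measure R).

Implicit Types q : R -> R.

Section gen.
Context d (X : measurableType d).
Implicit Types f g : X -> R.

Lemma mbd_cst (c : R) : @mbd R _ X (fun=> c).
Proof. by split; [exact: measurable_cst | exists `|c|]. Qed.

Lemma mbdD f g : mbd f -> mbd g -> mbd (fun x => f x + g x).
Proof.
move=> [mf [C hC]] [mg [D hD]]; split; first exact: measurable_funD.
by exists (C + D) => x; rewrite (le_trans (ler_normD _ _))// lerD.
Qed.

Lemma mbdM f g : mbd f -> mbd g -> mbd (fun x => f x * g x).
Proof.
move=> [mf [C hC]] [mg [D hD]]; split; first exact: measurable_funM.
by exists (C * D) => x; rewrite normrM ler_pM.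
Qed.

Lemma mbdN f : mbd f -> mbd (fun x => - f x).
Proof.
move=> [mf [C hC]]; split; first exact: measurableT_comp.
by exists C => x; rewrite normrN.
Qed.

Lemma mbdB f g : mbd f -> mbd g -> mbd (fun x => f x - g x).
Proof. by move=> mf mg; apply: mbdD => //; exact: mbdN. Qed.

Lemma mbdZ c f : mbd f -> mbd (fun x => c * f x).
Proof. by move=> mf; apply: mbdM => //; exact: mbd_cst. Qed.

End gen.

Lemma mbd_comp d (X : measurableType d) d' (Y : measurableType d')
    (f : Y -> R) (h : X -> Y) :
  mbd f -> measurable_fun [set: X] h -> mbd (f \o h).
Proof.
by move=> [mf [C hC]] mh; split; [exact: measurableT_comp | exists C => x; exact: hC].
Qed.

Lemma weight_mbd q f : weight q -> @mbd R _ RT f -> weight (fun x => q x * f x).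
Proof.
move=> wq [mf [C hC]].
have C0 : 0 <= C by apply: le_trans (hC 0).
have /integrableP[/measurable_EFinP mq _] := wq.
have wC : mu.-integrable [set: RT] (EFin \o (fun x => C * q x)).
  rewrite (_ : _ \o _ = (fun x => C%:E * (EFin \o q) x)%E)//; exact: integrableZl.
apply: (le_integrable _ _ _ wC) => //.
  by apply/measurable_EFinP; exact: measurable_funM.
move=> x _ /=; rewrite lee_fin !normrM mulrC ler_wpM2r//.
by rewrite (le_trans (hC x))// ger0_norm.
Qed.

Lemma mbd_indic (A : set RT) : measurable A -> mbd (\1_A : RT -> R).
Proof.
move=> mA; split; first exact: measurable_indic.
by exists 1 => x; rewrite indicE; case: (_ \in _); rewrite ?normr1 ?normr0.
Qed.

Lemma weight_itv (a b : R) (b0 b1 : bool) :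
  weight (\1_[set` Interval (BSide b0 a) (BSide b1 b)] : R -> R).
Proof. exact: integrable_indic_itv. Qed.

Lemma JD q f g : weight q -> @mbd R _ RT f -> @mbd R _ RT g ->
  J q (fun x => f x + g x) = J q f + J q g.
Proof.
move=> wq mf mg; rewrite /J -RintegralD//; try exact: weight_mbd.
by apply: eq_Rintegral => x _; rewrite mulrDr.
Qed.

Lemma JB q f g : weight q -> @mbd R _ RT f -> @mbd R _ RT g ->
  J q (fun x => f x - g x) = J q f - J q g.
Proof.
move=> wq mf mg; rewrite /J -RintegralB//; try exact: weight_mbd.
by apply: eq_Rintegral => x _; rewrite mulrBr.
Qed.

Lemma JZ q c f : weight q -> @mbd R _ RT f ->
  J q (fun x => c * f x) = c * J q f.
Proof.
move=> wq mf; rewrite /J -RintegralZl//; last exact: weight_mbd.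
by apply: eq_Rintegral => x _; rewrite mulrCA.
Qed.

Lemma JN q f : weight q -> @mbd R _ RT f -> J q (fun x => - f x) = - J q f.
Proof.
move=> wq mf; rewrite -mulN1r -JZ//; congr (J q _).
by apply/funext => x; rewrite mulN1r.
Qed.

Lemma J_ext q f g : (forall x, q x != 0 -> f x = g x) -> J q f = J q g.
Proof.
move=> fg; apply: eq_Rintegral => x _.
by have [->|/fg ->//] := eqVneq (q x) 0; rewrite !mul0r.
Qed.

Lemma J_ge0 q f : (forall x, 0 <= q x) -> (forall x, q x != 0 -> 0 <= f x) ->
  0 <= J q f.
Proof.
move=> q0 f0; apply: Rintegral_ge0 => x _.
by have [->|/f0 fx] := eqVneq (q x) 0; rewrite ?mul0r// mulr_ge0.
Qed.

Lemma J_le q f g : weight q -> @mbd R _ RT f -> @mbd R _ RT g ->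
  (forall x, 0 <= q x) -> (forall x, q x != 0 -> f x <= g x) ->
  J q f <= J q g.
Proof.
move=> wq mf mg q0 fg; rewrite -subr_ge0 -JB//; apply: J_ge0 => // x /fg.
by rewrite subr_ge0.
Qed.

Lemma J_norm q f C : weight q -> @mbd R _ RT f ->
  (forall x, q x != 0 -> `|f x| <= C) -> `|J q f| <= C * @J R (fun x => `|q x|) (cst 1).
Proof.
move=> wq mf hC.
have wqa : mu.-integrable [set: RT] (EFin \o (fun x => `|q x|)).
  by have := integrable_norm wq.
rewrite /J (le_trans (le_normr_Rintegral _ _))//; first exact: weight_mbd.
rewrite -RintegralZl//; last first.
  by apply: weight_mbd => //; exact: mbd_cst.
apply: le_Rintegral => //.
- by apply: integrable_norm; exact: weight_mbd.
- rewrite (_ : _ \o _ = EFin \o (fun x => `|q x| * C)); last first.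
    by apply/funext => x /=; rewrite mulr1 mulrC.
  by apply: weight_mbd => //; exact: mbd_cst.
- move=> x _; rewrite mulr1 normrM mulrC.
  by have [->|/hC ?] := eqVneq (q x) 0; rewrite ?normr0 ?mulr0// ler_wpM2r.
Qed.

Lemma mbd_sec1 d (X : measurableType d) d' (Y : measurableType d')
   (f : X * Y -> R) x : mbd f -> mbd (fun y => f (x, y)).
Proof. by move=> mf; apply: (mbd_comp mf); exact: measurable_pair1. Qed.

Lemma mbd_sec2 d (X : measurableType d) d' (Y : measurableType d')
   (f : X * Y -> R) y : mbd f -> mbd (fun x => f (x, y)).
Proof. by move=> mf; apply: (mbd_comp mf); exact: measurable_pair2. Qed.

Lemma weight_norm q : weight q -> weight (fun x => `|q x|).
Proof. by move=> wq; have := integrable_norm wq. Qed.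

(** The sections of [f] need not be integrable. The extended integral is the difference of those of
    the positive and negative parts, each measurable in [x] by Tonelli, and [fine] is measurable. *)
Lemma measurable_Rintegral d (X : measurableType d) (f : X * RT -> R) :
  measurable_fun [set: X * RT] f ->
  measurable_fun [set: X] (fun x => \int[mu]_z f (x, z)).
Proof.
move=> mf; pose g := EFin \o f.
have mg : measurable_fun [set: X * RT] g by exact/measurable_EFinP.
apply: (@measurableT_comp _ _ _ _ _ _ (@fine R)) => //.
rewrite (_ : (fun _ => _) = (fubini_F mu g^\+%E \- fubini_F mu g^\-%E)%E).
  apply: emeasurable_funB; apply: measurable_fun_fubini_tonelli_F => //.
    exact: measurable_funepos.
  exact: measurable_funeneg.
apply/funext => x; rewrite [LHS]integralE /fubini_F.
by congr (_ - _)%E; apply: eq_integral => y _; rewrite ?funeposE ?funenegE.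
Qed.

Lemma mbd_J d (X : measurableType d) (f : X * RT -> R) q :
  mbd f -> weight q -> mbd (fun x => J q (fun z => f (x, z))).
Proof.
move=> mf wq; have [mf' [C hC]] := mf; split; last first.
  exists (C * @J R (fun x => `|q x|) (cst 1)) => x.
  by apply: J_norm => // ; exact: mbd_sec1.
have /integrableP[/measurable_EFinP mq _] := wq.
apply: (@measurable_Rintegral _ _ (fun p => q p.2 * f p)).
by apply: measurable_funM => //; exact: (measurableT_comp mq).
Qed.

(** Integrability on the product follows from the iterated integral of absolute values, which is
    [|q1|] integrated against the bounded function [x |-> \int |q2 y| |f (x, y)| dy]. *)
Lemma J_swap (q1 q2 : R -> R) (f : RT * RT -> R) :
  weight q1 -> weight q2 -> mbd f ->
  J q1 (fun x => J q2 (fun y => f (x, y))) =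
  J q2 (fun y => J q1 (fun x => f (x, y))).
Proof.
move=> w1 w2 mf.
have /integrableP[/measurable_EFinP m1 _] := w1.
have /integrableP[/measurable_EFinP m2 _] := w2.
have [mf' [C hC]] := mf.
pose g := fun p : RT * RT => (q1 p.1 * q2 p.2 * f p)%:E.
have mg : measurable_fun [set: RT * RT] g.
  apply/measurable_EFinP; apply: measurable_funM => //.
  by apply: measurable_funM; [exact: (measurableT_comp m1)|exact: (measurableT_comp m2)].
have mswap : mbd (fun p : RT * RT => f (p.2, p.1)).
  apply: (mbd_comp mf) => /=.
  by apply: measurable_fun_pair; [exact: measurable_snd|exact: measurable_fst].
have E2 x : (\int[mu]_y g (x, y))%E = (q1 x * J q2 (fun y => f (x, y)))%:E.
  rewrite EFinM /J /Rintegral fineK; last first.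
    by apply: integrable_fin_num => //; apply: weight_mbd => //; exact: mbd_sec1.
  rewrite -integralZl//; last by apply: weight_mbd => //; exact: mbd_sec1.
  by apply: eq_integral => y _; rewrite /g /= -EFinM mulrA.
have E1 y : (\int[mu]_x g (x, y))%E = (q2 y * J q1 (fun x => f (x, y)))%:E.
  rewrite EFinM /J /Rintegral fineK; last first.
    by apply: integrable_fin_num => //; apply: weight_mbd => //; exact: mbd_sec2.
  rewrite -integralZl//; last by apply: weight_mbd => //; exact: mbd_sec2.
  by apply: eq_integral => y' _; rewrite /g /= -EFinM; congr EFin; ring.
have ig : (mu \x mu)%E.-integrable [set: RT * RT] g.
  apply/integrable12ltyP => //.
  have wI : mu.-integrable [set: RT] (EFin \o (fun x => `|q1 x| * @J R (fun y => `|q2 y|) (fun y => `|f (x, y)|))).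
    apply: weight_mbd; first exact: weight_norm.
    apply: (@mbd_J _ _ (fun p => `|f p|)); last exact: weight_norm.
    by split; [exact: measurableT_comp | exists C => p; rewrite normr_id].
  apply: le_lt_trans (integrableP _ _ _ wI).2.
  apply: ge0_le_integral => //.
  - by move=> x _; exact: integral_ge0.
  - apply: (measurable_fun_fubini_tonelli_F (abse \o g)) => //=.
    exact: measurableT_comp.
  - by apply: measurableT_comp => //; have /integrableP[] := wI.
  move=> x _; rewrite /= [X in (_ <= X%:E)%E]ger0_norm; last first.
    by rewrite mulr_ge0// J_ge0.
  rewrite EFinM /J /Rintegral fineK; last first.
    apply: integrable_fin_num => //; apply: weight_mbd; first exact: weight_norm.
    apply: (@mbd_sec1 _ _ _ _ (fun p => `|f p|)).
    by split; [exact: measurableT_comp | exists C => p; rewrite normr_id].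
  rewrite -integralZl//; last first.
    apply: weight_mbd; first exact: weight_norm.
    apply: (@mbd_sec1 _ _ _ _ (fun p => `|f p|)).
    by split; [exact: measurableT_comp | exists C => p; rewrite normr_id].
  by rewrite le_eqVlt; apply/orP; left; apply/eqP; apply: eq_integral => y _; rewrite -EFinM /= !normrM mulrA.
have := Fubini ig.
under eq_integral do rewrite E2.
under [RHS]eq_integral do rewrite E1.
by rewrite /J /Rintegral => ->.
Qed.

Lemma J_dct (q : R -> R) (f : nat -> R -> R) (g : R -> R) C :
  weight q -> (forall n, measurable_fun [set: RT] (f n)) ->
  (forall n x, q x != 0 -> `|f n x| <= C) ->
  (forall x, q x != 0 -> f n x @[n --> \oo] --> g x) ->
  J q (f n) @[n --> \oo] --> J q g.
Proof.
move=> wq mf hC fg.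
have /integrableP[/measurable_EFinP mq _] := wq.
have mh n : measurable_fun [set: RT] (fun x => (q x * f n x)%:E).
  by apply/measurable_EFinP; exact: measurable_funM.
have hg x : (fun n => (q x * f n x)%:E) @ \oo --> (q x * g x)%:E.
  apply: cvg_EFin; first by apply: nearW.
  have [->|qx] := eqVneq (q x) 0.
    by rewrite mul0r; under eq_fun do rewrite mul0r; exact: cvg_cst.
  by apply: cvgMr => //; exact: fg.
have [] := @dominated_convergence _ RT R mu setT measurableT
  (fun n x => (q x * f n x)%:E) (fun x => (q x * g x)%:E)
  (fun x => (C * `|q x|)%:E) mh.
- by apply: (@emeasurable_fun_cvg _ RT R setT (fun n x => (q x * f n x)%:E) _ mh) => x _; exact: hg.
- by apply: aeW => x _; exact: hg.
- by apply: (@integrableZl _ _ _ mu setT measurableT C _ (weight_norm wq)).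
- apply: aeW => x n _ /=; rewrite lee_fin normrM mulrC.
  by have [->|qx] := eqVneq (q x) 0; rewrite ?normr0 ?mulr0// ler_wpM2r// hC.
move=> ig _ cv.
rewrite (_ : (\int[mu]_x (q x * g x)%:E)%E = (J q g)%:E) in cv.
  exact: (fine_cvg cv).
by rewrite /J /Rintegral fineK//; exact: integrable_fin_num.
Qed.

End Mbd.

(** * The integral of a derivative that exists everywhere *)

Section Rudin.
Context (R : realType).
Local Notation RT := (measurableTypeR R).
Local Notation mu := (@lebesgue_measure R).

(** Supremum argument on the points [x] where the increment from [a] to [x] is controlled. [G] may
    jump: being nondecreasing, it only helps at the supremum, so continuity of [f] suffices there,
    and [loc] then pushes past it. *)
Lemma dini_increment_le (f G : R -> R) (a b : R) : a <= b ->
  (forall x y, a <= x -> x <= y -> y <= b -> G x <= G y) ->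
  (forall x, a <= x <= b -> {for x, continuous f}) ->
  (forall x, a <= x < b -> exists2 e, 0 < e &
     forall y, x < y < x + e -> y <= b -> f y - f x <= G y - G x) ->
  f b - f a <= G b - G a.
Proof.
move=> ab Gnd fc loc.
pose S := [set x | a <= x <= b /\ f x - f a <= G x - G a].
have Sa : S a by split; rewrite ?lexx ?ab// !subrr.
have Sub : ubound S b by move=> x [/andP[]].
have supS : has_sup S by split; [exists a | exists b].
set c := sup S.
have ac : a <= c by apply: ub_le_sup => //; exists b.
have cb : c <= b by apply: ge_sup => //; exists a.
have Sc : S c.
  split; first by rewrite ac cb.
  rewrite leNgt; apply/negP => Hlt.
  pose e := (f c - f a) - (G c - G a).
  have e0 : 0 < e by rewrite /e subr_gt0.
  have /cvgrPdist_lt/(_ _ e0) := fc c (introT andP (conj ac cb)).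
  move=> /nbhs_ballP[d /= d0 dP].
  have [x Sx cx] := sup_adherent d0 supS.
  have xc : x <= c by apply: ub_le_sup => //; exists b.
  have : `|f c - f x| < e.
    apply: dP; rewrite /ball /= ger0_norm ?subr_ge0//.
    by rewrite -/c in cx; rewrite ltrBlDr -ltrBlDl.
  case: Sx => /andP[ax xb] Hx.
  move=> /ltr_normlP[_]; rewrite /e => H1.
  have := Gnd x c ax xc cb.
  by lra.
suff <- : c = b by case: Sc.
apply/eqP; rewrite eq_le cb /= leNgt; apply/negP => cltb.
have [e e0 eP] := loc c (introT andP (conj ac cltb)).
pose y := Num.min (c + e / 2) b.
have cy : c < y by rewrite /y lt_min cltb andbT ltrDl divr_gt0.
have yb : y <= b by rewrite /y ge_min lexx orbT.
have Sy : S y.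
  split; first by rewrite yb (le_trans ac)// ltW.
  have ye : y < c + e.
    by rewrite /y gt_min ltrD2l ltr_pdivrMr// ltr_pMr// ltr1n.
  have := eP y; rewrite cy ye => /(_ isT yb).
  by case: Sc => _; lra.
have : y <= c by apply: ub_le_sup => //; exists b.
by rewrite leNgt cy.
Qed.

Lemma derivable_increment_lt (f : R -> R) (x c : R) : derivable f x 1 ->
  derive1 f x < c -> exists2 e, 0 < e &
     forall y, x < y < x + e -> f y - f x <= c * (y - x).
Proof.
move=> df fc.
have : h^-1 *: (f (h *: 1 + x) - f x) @[h --> 0^'] --> derive1 f x.
  by rewrite derive1E; exact: df.
move=> /cvgrPdist_lt/(_ (c - derive1 f x)); rewrite subr_gt0 => /(_ fc).
move=> /nbhs_ballP[d /= d0 dP]; exists d => // y /andP[xy yd].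
have yx : 0 < y - x by rewrite subr_gt0.
have := dP (y - x).
rewrite /ball /= sub0r normrN gtr0_norm// ltrBlDl => /(_ yd).
rewrite gt_eqF// => /(_ isT).
rewrite scaler1 subrK => /ltr_normlP[H1 H2].
have : (y - x)^-1 *: (f y - f x) < c by move: H1; rewrite opprB; lra.
by rewrite /GRing.scale /= mulrC ltr_pdivrMr// => /ltW.
Qed.

(** A Vitali-Caratheodory argument, with a measure [nu] of density [\sum_k (k + 1) d 1_(U k)] in the
    place of a lower semicontinuous majorant of [H]. The error [d * (b - a + 1)] splits into
    [d * (b - a)], from rounding [H] up to a multiple of [d], and [d], from the excess of the [U k]
    over the level sets. *)
Lemma increment_le_integral_nneg (f H : R -> R) (a b : R) : a < b ->
  (forall x, a <= x <= b -> 0 <= H x) ->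
  mu.-integrable `[a, b] (EFin \o H) ->
  (forall x, a <= x <= b -> derivable f x 1 /\ derive1 f x <= H x) ->
  ((f b - f a)%:E <= \int[mu]_(x in `[a, b]) (H x)%:E)%E.
Proof.
move=> ab H0 iH df.
have mI : measurable (`[a, b] : set RT) by exact: measurable_itv.
have /integrableP[/measurable_EFinP mH _] := iH.
have muab : mu `[a, b] = (b - a)%:E.
  by rewrite lebesgue_measure_itv/= lte_fin ab EFinN -EFinB.
suff key : forall d, 0 < d ->
    ((f b - f a)%:E <= \int[mu]_(x in `[a, b]) (H x)%:E + (d * (b - a + 1))%:E)%E.
  apply/lee_addgt0Pr => e e0.
  have ba1 : 0 < b - a + 1 by rewrite addr_gt0// subr_gt0.
  have := key (e / (b - a + 1)) (divr_gt0 e0 ba1).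
  by rewrite divfK// gt_eqF.
move=> d d0.
(* The level sets of [H] are covered by open sets [U k] of almost the same measure; as
   they are open, [nu `[a, x]] grows at rate at least [H x >= derive1 f x] at [x]. *)
pose E k : set RT := `[a, b] `&` H @^-1` `[k%:R * d, k.+1%:R * d[.
have mE k : measurable (E k).
  by apply: mH => //; exact: measurable_itv.
have Efin k : (mu (E k) < +oo)%E.
  apply: (le_lt_trans (y := mu `[a, b])); last by rewrite muab ltry.
  by apply: le_measure; rewrite ?inE//; exact: subIsetl.
(* After multiplication by the density [k.+1 * d], these tolerances become [d / 2 ^ k.+1] and sum to
   [d]. *)
have eps0 k : 0 < (2 ^ k.+1)%:R^-1 / k.+1%:R :> R.
  by rewrite divr_gt0// invr_gt0 ltr0n expn_gt0.
have /choice[U UP] : forall k, exists U : set RT, [/\ open U, E k `<=` U &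
    (mu (U `\` E k) < ((2 ^ k.+1)%:R^-1 / k.+1%:R)%:E)%E].
  by move=> k; exact: lebesgue_regularity_outer (mE k) (Efin k) (eps0 k).
have mU k : measurable (U k) by apply: open_measurable; case: (UP k).
have c0 k : 0 <= k.+1%:R * d by rewrite mulr_ge0// ltW.
pose m k := mscale (NngNum (c0 k)) (mrestr mu (mU k)).
pose nu := mseries m 0.
have nuE A : nu A = (\sum_(0 <= k <oo) (k.+1%:R * d)%:E * mu (A `&` U k))%E by [].
have nuab : (nu `[a, b] <= \int[mu]_(x in `[a, b]) (H x)%:E + (d * (b - a + 1))%:E)%E.
  have step k : ((k.+1%:R * d)%:E * mu (`[a, b] `&` U k) <=
      (k.+1%:R * d)%:E * mu (E k) + (d / (2 ^ k.+1)%:R)%:E)%E.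
    rewrite (_ : (d / (2 ^ k.+1)%:R)%:E = (k.+1%:R * d)%:E *
        ((2 ^ k.+1)%:R^-1 / k.+1%:R)%:E)%E; last first.
      rewrite -EFinM; congr EFin.
      have : (2 ^ k.+1)%:R != 0 :> R by rewrite pnatr_eq0 expn_eq0.
      have : k.+1%:R != 0 :> R by rewrite pnatr_eq0.
      move: (k.+1%:R) ((2 ^ k.+1)%:R) => A B A0 B0.
      by field; rewrite A0 B0.
    rewrite -ge0_muleDr ?lee_fin ?(ltW (eps0 k))//.
    apply: lee_pmul => //; first by rewrite lee_fin.
    apply: (le_trans (y := mu (E k `|` (U k `\` E k)))).
      apply: le_measure; rewrite ?inE.
      - by apply: measurableI.
      - by apply: measurableU => //; exact: measurableD.
      - by move=> x [_ Ux]; have [Ex|nEx] := pselect (E k x); [left|right].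
    apply: le_trans (measureU2 _ _ _) _ => //; first exact: measurableD.
    by apply: leeD2l; apply: ltW; case: (UP k).
  rewrite nuE.
  apply: (le_trans (y := (\sum_(0 <= k <oo) ((k.+1%:R * d)%:E * mu (E k) +
       (d / (2 ^ k.+1)%:R)%:E))%E)).
    by apply: lee_nneseries => [k *|k *]; [apply: mule_ge0; rewrite ?lee_fin|exact: step].
  apply: le_trans (epsilon_trick _ _ _) _ => //; [|exact: ltW|].
    by move=> k; apply: mule_ge0; rewrite ?lee_fin.
  rewrite mulrDr mulr1 EFinD addeA leeD2r//.
  apply: (le_trans (y := (\sum_(0 <= k <oo) \int[mu]_(x in E k) (H x + d)%:E)%E)).
    apply: lee_nneseries => [k *|k *]; first by apply: mule_ge0; rewrite ?lee_fin.
    rewrite -integral_cst//; apply: ge0_le_integral => //.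
    - by move=> x _; rewrite /cst /= lee_fin.
    - apply/measurable_EFinP; apply: measurable_funD => //.
      by apply: measurable_funS mH => //; exact: subIsetl.
    move=> x [_] /=; rewrite in_itv /= => /andP[kH _].
    by rewrite lee_fin -natr1 mulrDl mul1r lerD2r.
  rewrite -ge0_integral_bigcup//=; last 3 first.
  - apply/measurable_EFinP; apply: measurable_funD => //.
    by apply: measurable_funS mH => //; apply: bigcup_sub => k _; exact: subIsetl.
  - by move=> x [k _ []] /=; rewrite in_itv /= => /H0 Hx _; rewrite lee_fin addr_ge0// ltW.
  - apply: ltn_trivIset => i j ij; rewrite -subset0 => x [[_ +] [_ +]] /=.
    rewrite /preimage /= !in_itv /= => /andP[_ h1] /andP[h2 _].
    have : i%:R * d < j.+1%:R * d by apply: le_lt_trans h1.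
    by rewrite ltr_pM2r// ltr_nat ltnS leqNgt ij.
  apply: (le_trans (y := (\int[mu]_(x in `[a, b]) (H x + d)%:E)%E)).
    apply: ge0_subset_integral => //.
    - by apply: bigcup_measurable => k _; exact: mE.
    - apply/measurable_EFinP; exact: measurable_funD.
    - by move=> x /=; rewrite in_itv/= => /H0 Hx; rewrite lee_fin addr_ge0// ltW.
    - by apply: bigcup_sub => k _; exact: subIsetl.
  under eq_integral do rewrite EFinD.
  rewrite ge0_integralD//; [|exact/measurable_EFinP|by move=> x _; rewrite lee_fin ltW].
  rewrite le_eqVlt; apply/orP; left; apply/eqP; congr (_ + _)%E.
  rewrite integral_cst// EFinM; congr (_ * _)%E; exact: muab.
have nufin A : measurable A -> A `<=` `[a, b] -> nu A \is a fin_num.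
  move=> mA Aab; rewrite ge0_fin_numE//.
  apply: (le_lt_trans (y := nu `[a, b])).
    by apply: (le_measure nu); rewrite ?inE.
  apply: (le_lt_trans nuab); rewrite -ge0_fin_numE; last first.
    apply: adde_ge0; last by rewrite lee_fin mulr_ge0 ?ltW// addr_gt0// subr_gt0.
    by apply: integral_ge0 => x /=; rewrite in_itv/= => /H0; rewrite lee_fin.
  by rewrite fin_numD /= andbT; exact: integrable_fin_num.
pose G x := fine (nu `[a, x]).
have sub x : x <= b -> `[a, x] `<=` `[a, b].
  by move=> xb y /=; rewrite !in_itv/= => /andP[-> /le_trans]; exact.
have subo x y : a <= x -> y <= b -> `]x, y] `<=` `[a, b].
  move=> ax yb z /=; rewrite !in_itv/= => /andP[xz zy].
  by rewrite (le_trans ax (ltW xz)) (le_trans zy yb).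
have Gadd x y : a <= x -> x <= y -> y <= b ->
    (G y)%:E = ((G x)%:E + nu `]x, y])%E.
  move=> ax xy yb; rewrite /G !fineK ?nufin//; try exact: sub.
    rewrite -measureU//; [by rewrite -itv_bndbnd_setU|].
    apply/seteqP; split => // z /=; rewrite !in_itv/= => -[/andP[_ zx] /andP[xz _]].
    by move: xz; rewrite ltNge zx.
  by apply: sub; exact: le_trans yb.
apply: le_trans nuab.
suff : f b - f a <= G b - G a.
  rewrite -lee_fin => /le_trans; apply; rewrite /G EFinB.
  rewrite fineK ?nufin//.
  by rewrite leeBlDr// leeDl// lee_fin fine_ge0.
apply: dini_increment_le; first exact: ltW.
- move=> x y ax xy yb; rewrite -lee_fin (Gadd x y)// leeDl//.
- move=> x /df[dfx _]; apply: differentiable_continuous; exact/derivable1_diffP.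
move=> x /andP[ax xb].
have xab : a <= x <= b by rewrite ax ltW.
have [dfx fHx] := df x xab.
have Hd0 : 0 <= H x / d by rewrite divr_ge0 ?H0// ltW.
pose k := Num.trunc (H x / d).
have /andP[k1 k2] : k%:R * d <= H x < k.+1%:R * d.
  have /andP[] := truncn_itv Hd0.
  by rewrite ler_pdivlMr// ltr_pdivrMr// => -> ->.
have [e1 e10 e1P] := derivable_increment_lt dfx (le_lt_trans fHx k2).
have Ukx : U k x.
  by have [_ + _] := UP k; apply; split; rewrite /= in_itv/= ?xab// k1 k2.
have [oU _ _] := UP k.
have /nbhs_ballP[e2 /= e20 e2P] : nbhs x (U k) by exact: open_nbhs_nbhs.
exists (Num.min e1 e2); first by rewrite lt_min e10.
move=> y /andP[xy ye] yb.
have xe1 : y < x + e1 by rewrite (lt_le_trans ye)// lerD2l ge_min lexx.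
have xe2 : y < x + e2 by rewrite (lt_le_trans ye)// lerD2l ge_min lexx orbT.
have e1y : f y - f x <= k.+1%:R * d * (y - x) by apply: e1P; rewrite xy.
apply: (le_trans e1y).
rewrite lerBrDl -lee_fin (Gadd x y)// ?(ltW xy)// EFinD leeD2l//.
(* As [y < x + e2], the interval []x, y]] lies in [U k], so the [k]-th term of [nu] alone
   contributes [k.+1 * d * (y - x)]; the other terms are nonnegative. *)
apply: (le_trans (y := (m k `]x, y])%E)).
  rewrite /m /mscale /= /mrestr.
  rewrite setIidl; last first.
    move=> z /=; rewrite in_itv /= => /andP[xz zy]; apply: e2P.
    rewrite /ball /= distrC gtr0_norm ?subr_gt0// ltrBlDl.
    exact: le_lt_trans zy xe2.
  by rewrite lebesgue_measure_itv/= lte_fin xy -EFinD -EFinM.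
rewrite nuE.
rewrite (@nneseriesD1 _ _ k xpredT)//; last by move=> i _; apply: mule_ge0; rewrite ?lee_fin.
by rewrite leeDl//; apply: nneseries_ge0 => i _ _; apply: mule_ge0; rewrite ?lee_fin.
Qed.

(** The truncation [hn n = max h (- n)] majorises the derivative; adding [n * x] to [f] and [n] to
    [hn n] reduces to the nonnegative case. Dominated convergence with bound [|h|] then removes the
    truncation. *)
Lemma increment_le_integral (f : R -> R) (a b : R) : a < b ->
  (forall x, a <= x <= b -> derivable f x 1) ->
  mu.-integrable `[a, b] (EFin \o derive1 f) ->
  f b - f a <= \int[mu]_(x in `[a, b]) derive1 f x.
Proof.
move=> ab df ih.
have mI : measurable (`[a, b] : set RT) by exact: measurable_itv.
have /integrableP[/measurable_EFinP mh _] := ih.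
set h : R -> R := derive1 f in ih mh *.
have muab : mu `[a, b] = (b - a)%:E.
  by rewrite lebesgue_measure_itv/= lte_fin ab EFinN -EFinB.
have icst (c : R) : mu.-integrable `[a, b] (EFin \o cst c).
  by apply: continuous_compact_integrable;
    [exact: segment_compact | move=> x; exact: cvg_cst].
pose hn (n : nat) x := Num.max (h x) (- n%:R).
have ihn n : mu.-integrable `[a, b] (EFin \o hn n).
  have ipm : mu.-integrable `[a, b] (EFin \o (fun x => `|h x| + n%:R)).
    have := integrableD mI (integrable_norm ih) (icst n%:R).
    by apply: (eq_integrable mI) => x _.
  apply: (le_integrable _ _ _ ipm) => //.
    by apply/measurable_EFinP; apply: measurable_maxr.
  move=> x _ /=; rewrite lee_fin [leRHS]ger0_norm ?addr_ge0// /hn.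
  have n0 : 0 <= n%:R :> R by [].
  case: (leP (h x) (- n%:R)) => _; first by rewrite normrN ger0_norm// lerDr.
  by rewrite lerDl.
have step n : ((f b - f a)%:E <= \int[mu]_(x in `[a, b]) (hn n x)%:E)%E.
  have iH : mu.-integrable `[a, b] (EFin \o (fun x => hn n x + n%:R)).
    rewrite (_ : _ \o _ = (EFin \o hn n) \+ (EFin \o cst n%:R))%E//.
    exact: integrableD.
  have dfn x : a <= x <= b -> is_derive x 1 (fun x => f x + n%:R * x) (h x + n%:R).
    move=> /df dfx; have := derivableP dfx; rewrite -derive1E -/h => dfx'.
    by apply: is_derive_eq; rewrite /GRing.scale /=; ring.
  have le : ((f b + n%:R * b - (f a + n%:R * a))%:E <=
      \int[mu]_(x in `[a, b]) (hn n x + n%:R)%:E)%E.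
    apply: (@increment_le_integral_nneg (fun x => f x + n%:R * x)
      (fun x => hn n x + n%:R) a b ab _ iH) => x.
  - by move=> _; rewrite /hn -lerBlDr sub0r le_max lexx orbT.
  - move=> xab; have dx := dfn x xab; split; first exact: ex_derive.
    by rewrite derive1E derive_val lerD2r /hn le_max lexx.
  have e1 : (\int[mu]_(x in `[a, b]) (hn n x + n%:R)%:E =
     \int[mu]_(x in `[a, b]) (hn n x)%:E + (n%:R * (b - a))%:E)%E.
    under eq_integral do rewrite EFinD.
    rewrite integralD//; [|exact: ihn|exact: icst].
    congr (_ + _)%E; rewrite integral_cst// EFinM; congr (_ * _)%E; exact: muab.
  rewrite e1 in le.
  have fi : (\int[mu]_(x in `[a, b]) (hn n x)%:E)%E \is a fin_num.
    exact: (integrable_fin_num mI (ihn n)).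
  move: le; rewrite -(fineK fi) -EFinD !lee_fin.
  by lra.
have hcv x : (hn n x)%:E @[n --> \oo] --> (h x)%:E.
  apply: cvg_EFin; first by apply: nearW.
  apply: cvg_near_cst; exists `|Num.trunc (`|h x|)|.+1%N => // n /= hn_.
  rewrite /hn; apply/max_idPl.
  rewrite lerNl (le_trans (ler_norm _))// normrN.
  apply: ltW; apply: (lt_le_trans (truncnS_gt _)).
  by rewrite ler_nat.
have [] := @dominated_convergence _ RT R mu `[a, b] mI
  (fun n x => (hn n x)%:E) (fun x => (h x)%:E) (fun x => `|h x|%:E).
- by move=> n; have /integrableP[] := ihn n.
- by have /integrableP[] := ih.
- by apply: aeW => x _; exact: hcv.
- exact: integrable_norm.
- apply: aeW => x n _ /=; rewrite lee_fin /hn.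
  case: (leP (h x) (- n%:R)) => // hx.
  rewrite normrN [leLHS]ger0_norm//.
  rewrite ler0_norm; first by rewrite lerNr.
  by rewrite (le_trans hx)// oppr_le0.
move=> _ _ cv.
rewrite -lee_fin /Rintegral fineK; last exact: integrable_fin_num.
rewrite -(cvg_lim _ cv)//; apply: lime_ge; first exact: cvgP cv.
by apply: nearW => n; exact: step.
Qed.

Let opp_increment_le (A B I : R) : - B - - A <= - I -> I <= B - A.
Proof. lra. Qed.

(** The one-sided bound is applied to [f] and to [- f]. No continuity of the derivative enters,
    which is what the second time derivative of a solution requires. *)
Theorem integral_derive1 (f : R -> R) (a b : R) : a < b ->
  (forall x, a <= x <= b -> derivable f x 1) ->
  mu.-integrable `[a, b] (EFin \o derive1 f) ->
  \int[mu]_(x in `[a, b]) derive1 f x = f b - f a.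
Proof.
move=> ab df ih; apply/eqP; rewrite eq_le increment_le_integral// andbT.
have mI : measurable (`[a, b] : set RT) by exact: measurable_itv.
have E x : a <= x <= b -> derive1 (fun x => - f x) x = - derive1 f x.
  by move=> /df dfx; rewrite !derive1E deriveN.
have iN : mu.-integrable `[a, b] (EFin \o derive1 (fun x => - f x)).
  move: (integrableN ih); apply: (eq_integrable mI) => x.
  by rewrite inE /= in_itv /= => /E ->.
have H : - f b - - f a <= \int[mu]_(x in `[a, b]) derive1 (fun x => - f x) x.
  by apply: (@increment_le_integral (fun x => - f x) a b ab _ iN) => x /df dfx; exact: derivableN.
have e : \int[mu]_(x in `[a, b]) derive1 (fun x => - f x) x =
    - \int[mu]_(x in `[a, b]) derive1 f x.
  rewrite -mulN1r -RintegralZl//; apply: eq_Rintegral => x.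
  by rewrite inE /= in_itv /= mulN1r => /E.
by apply: opp_increment_le; rewrite -e.
Qed.

End Rudin.

(** * Integrals over intervals, primitives and joint measurability *)

Definition Iab (R : realType) (a b : R) (f : R -> R) : R := J (\1_`[a, b]) f.

(** For [0 <= t <= s] this is [\int_0^t f]. Keeping the interval [[0, s]] fixed and moving the
    cut-off into the integrand makes it bounded and jointly measurable in [t] and any parameter of
    [f], by [mbd_J]. *)
Definition prim (R : realType) (s : R) (f : R -> R) (t : R) : R :=
  Iab 0 s (fun z => (z <= t)%R%:R * f z).

Section Itv.
Context (R : realType).
Local Notation RT := (measurableTypeR R).
Local Notation mu := (@lebesgue_measure R).
Implicit Types (a b s t : R) (f g F : R -> R).

Lemma weight_cc a b : weight (\1_`[a, b] : R -> R).
Proof. exact: (weight_itv a b true false). Qed.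

Lemma weight_oo a b : weight (\1_`]a, b[ : R -> R).
Proof. exact: (weight_itv a b false true). Qed.

Lemma indic_ge0 (A : set R) x : 0 <= (\1_A x : R).
Proof. by rewrite indicE. Qed.

Lemma indic_neq0 (A : set R) x : (\1_A x : R) != 0 -> A x.
Proof.
by rewrite indicE; case: (boolP (x \in A)) => [/set_mem//|_]; rewrite eqxx.
Qed.

Lemma indic_cc_neq0 a b x : (\1_`[a, b] x : R) != 0 -> a <= x <= b.
Proof. by move/indic_neq0; rewrite /= in_itv. Qed.

Lemma IabE a b f : Iab a b f = \int[mu]_(x in `[a, b]) f x.
Proof.
rewrite /Iab /J [RHS]Rintegral_mkcond; apply: eq_Rintegral => x _.
by rewrite patchE indicE; case: ifPn => _; rewrite ?mul1r ?mul0r.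
Qed.

Lemma Iab_ext a b f g : (forall x, a <= x <= b -> f x = g x) ->
  Iab a b f = Iab a b g.
Proof. by move=> fg; apply: J_ext => x /indic_cc_neq0; exact: fg. Qed.

Lemma continuous_mfun f : continuous f -> measurable_fun [set: RT] f.
Proof. exact: continuous_measurable_fun. Qed.

Lemma Iab_FTC a b F f : a < b -> {within `[a, b], continuous f} ->
  {within `[a, b], continuous F} ->
  (forall x, a < x < b -> is_derive x 1 F (f x)) -> Iab a b f = F b - F a.
Proof.
move=> ab cf cF dF; rewrite IabE /Rintegral.
rewrite (@continuous_FTC2 R f F)//.
  split.
  - by move=> x; rewrite in_itv /= => /dF [].
  - by have /continuous_within_itvP-/(_ ab)[] := cF.
  - by have /continuous_within_itvP-/(_ ab)[] := cF.
move=> x; rewrite in_itv /= => /dF dx.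
by rewrite derive1E derive_val.
Qed.

Lemma is_derive_continuous (F : R -> R) (x d : R) : is_derive x 1 F d -> {for x, continuous F}.
Proof.
by move=> [dF _]; apply: differentiable_continuous; exact/derivable1_diffP.
Qed.

Lemma Iab_FTC_cc a b F f : a < b -> {within `[a, b], continuous f} ->
  (forall x, a <= x <= b -> is_derive x 1 F (f x)) -> Iab a b f = F b - F a.
Proof.
move=> ab cf dF; apply: Iab_FTC => //.
  apply: continuous_in_subspaceT => x; rewrite inE /= in_itv /= => /dF.
  exact: is_derive_continuous.
by move=> x /andP[ax xb]; apply: dF; rewrite !ltW.
Qed.

Lemma Iab_is_derive a f t : continuous f -> a < t ->
  is_derive t 1 (Iab a ^~ f) (f t).
Proof.
move=> cf at_.
have fi : mu.-integrable `[a, (t + 1)%R] (EFin \o f).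
  apply: continuous_compact_integrable; first exact: segment_compact.
  exact: continuous_subspaceT.
have [] := @continuous_FTC1_closed R f a t (t + 1) _ fi at_ (cf t).
  by rewrite ltrDl.
move=> dF F'; have -> : Iab a ^~ f = (fun x => \int[mu]_(t in `[a, x]) f t).
  by apply/funext => x; rewrite IabE.
by split; [exact: dF | rewrite -derive1E; exact: F'].
Qed.

Lemma Iab_continuous a b f : a <= b -> continuous f ->
  {within `[a, b], continuous (Iab a ^~ f)}.
Proof.
move=> ab cf.
have -> : Iab a ^~ f = (fun x => \int[mu]_(t in `[a, x]) f t).
  by apply/funext => x; rewrite IabE.
apply: parameterized_integral_continuous => //.
apply: continuous_compact_integrable; first exact: segment_compact.
exact: continuous_subspaceT.
Qed.

Lemma Iab_pt a f : Iab a a f = 0.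
Proof. by rewrite IabE set_itv1 Rintegral_set1. Qed.

Lemma J_continuous q (f : R -> R -> R) C : weight q ->
  (forall p, measurable_fun [set: RT] (f p)) ->
  (forall p z, `|f p z| <= C) ->
  (forall z, continuous (f ^~ z)) ->
  continuous (fun p => J q (f p)).
Proof.
move=> wq mf fC fc p.
have mq : measurable_fun [set: RT] q by have /integrableP[/measurable_EFinP] := wq.
apply: (@continuity_under_integral R _ RT mu (fun p z => q z * f p z) setT measurableT
  (p - 1) (p + 1) _ _ (fun z => C * `|q z|)).
- by move=> x _; apply: weight_mbd => //; split => //; exists C.
- apply: aeW => z _ x _; apply: cvgMr; exact: fc.
- exact: (@integrableZl _ _ _ mu setT measurableT C _ (weight_norm wq)).
- by move=> x _; apply: aeW => z _; rewrite normrM mulrC ler_wpM2r.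
- by rewrite inE /= in_itv /= ltrBlDr ltrDl ltr01.
Qed.

(* [f] is the pointwise limit of its values at the points [floor (n.+1 * r) / n.+1] *)
Lemma measurable_caratheodory d (X : measurableType d) (f : X * RT -> R) :
  (forall r, measurable_fun [set: X] (fun x => f (x, r))) ->
  (forall x, continuous (fun r : R => f (x, r))) ->
  measurable_fun [set: X * RT] f.
Proof.
move=> mf cf.
pose fl (n : nat) (r : R) : R := (Num.floor (n.+1%:R * r))%:~R / n.+1%:R.
apply: (@measurable_fun_cvg _ _ R setT (fun n p => f (p.1, fl n p.2))); last first.
  move=> [x r] _ /=.
  apply: (cvg_comp (fl ^~ r) (fun s => f (x, s))); last exact: cf.
  apply/cvgrPdist_le => e e0; near=> n.
  rewrite /fl ger0_norm; last first.
    rewrite subr_ge0 ler_pdivrMr// mulrC; exact: floor_le.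
  have : r - (Num.floor (n.+1%:R * r))%:~R / n.+1%:R <= n.+1%:R^-1.
    have := floorD1_gt (n.+1%:R * r); rewrite intrD => /ltW H.
    by rewrite lerBlDl -[X in _ + X]mul1r -mulrDl ler_pdivlMr// mulrC.
  move=> /le_trans; apply; apply: ltW; near: n; exact: (near_infty_natSinv_lt (PosNum e0)).
move=> n.
pose N : R := n.+1%:R.
have N0 : 0 < N by rewrite /N.
pose B (k : int) : set RT := `[k%:~R / N, (k + 1)%:~R / N[.
(* The strips on which [fl n] is constant are indexed by integers; [unpickle] turns them into a
   sequence. *)
pose E i : set (X * RT) := if unpickle i is Some k then setT `*` B k else set0.
have BP k r : B k r -> Num.floor (N * r) = k.
  rewrite /B /= in_itv /= ler_pdivrMr// ltr_pdivlMr// [r * N]mulrC => H.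
  exact: floor_def.
have UE : \bigcup_i E i = setT.
  apply/seteqP; split; [exact: subsetT | move=> [x r] _]; exists (pickle (Num.floor (N * r))); first exact: Logic.I.
  rewrite /E pickleK; split => //=.
  rewrite /B /= in_itv /= ler_pdivrMr// ltr_pdivlMr// [r * N]mulrC.
  by rewrite floor_le floorD1_gt.
have mE i : measurable (E i).
  rewrite /E; case: unpickle => [k|]; last exact: measurable0.
  by apply: measurableX => //; exact: measurable_itv.
rewrite -UE; apply/measurable_fun_bigcup => // i.
move: (mE i); rewrite /E; case: unpickle => [k mk|_]; last exact: measurable_fun_set0.
apply: (@eq_measurable_fun _ _ _ _ _ (fun p => f (p.1, k%:~R / N))).
  by move=> [x r] /set_mem[_ /= /BP Bk]; rewrite /fl -/N Bk.
apply: measurable_funTS.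
by apply: (measurableT_comp (mf (k%:~R / N))); exact: measurable_fst.
Unshelve. all: by end_near. Qed.

Lemma mbd_le : mbd (fun p : RT * RT => (p.2 <= p.1)%R%:R : R).
Proof.
split; last first.
  by exists 1 => p; rewrite normr_nat lern1 leq_b1.
have : measurable_fun [set: RT * RT] (fun p : RT * RT => p.2 <= p.1).
  by apply: measurable_fun_ler.
move=> mle.
rewrite (_ : (fun _ => _) = (fun p => if p.2 <= p.1 then 1 else 0)); last first.
  by apply/funext => p; case: (_ <= _).
by apply: measurable_fun_ifT.
Qed.

Lemma primE s f t : 0 <= t <= s -> prim s f t = Iab 0 t f.
Proof.
move=> /andP[t0 ts]; rewrite /prim /Iab /J; apply: eq_Rintegral => x _.
rewrite !indicE !mem_setE !in_itv /=.
case: (leP 0 x) => x0 /=; last by rewrite !mul0r.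
case: (leP x t) => xt; last by rewrite /= !(mul0r, mulr0).
by rewrite (le_trans xt ts) mul1r.
Qed.

Lemma mbd_prim d (X : measurableType d) (f : X * RT -> R) s : mbd f ->
  mbd (fun p : X * RT => prim s (fun z => f (p.1, z)) p.2).
Proof.
move=> mf; apply: (@mbd_J _ _ _ (fun p : (X * RT) * RT => (p.2 <= p.1.2)%R%:R * f (p.1.1, p.2)));
  last exact: weight_cc.
apply: mbdM.
  apply: (mbd_comp mbd_le (h := fun p : X * RT * RT => (p.1.2, p.2))).
  apply: measurable_fun_pair; last exact: measurable_snd.
  by apply: (measurableT_comp measurable_snd); exact: measurable_fst.
apply: (mbd_comp mf (h := fun p : X * RT * RT => (p.1.1, p.2))).
apply: measurable_fun_pair; last exact: measurable_snd.
by apply: (measurableT_comp measurable_fst); exact: measurable_fst.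
Qed.

Lemma within_continuousM (A : set R) (f g : R -> R) : {within A, continuous f} ->
  {within A, continuous g} -> {within A, continuous (fun x => f x * g x)}.
Proof. by move=> cf cg x; apply: cvgM; [exact: cf|exact: cg]. Qed.

Lemma within_continuousD (A : set R) (f g : R -> R) : {within A, continuous f} ->
  {within A, continuous g} -> {within A, continuous (fun x => f x + g x)}.
Proof. by move=> cf cg x; apply: cvgD; [exact: cf|exact: cg]. Qed.

Lemma mbd_prim1 s f : @mbd R _ RT f -> @mbd R _ RT (prim s f).
Proof.
move=> mf.
have := @mbd_prim _ RT (fun p : RT * RT => f p.2) s.
move=> /(_ (mbd_comp mf measurable_snd)) H.
exact: (@mbd_sec1 _ _ RT _ RT (fun p => prim s (fun z => f z) p.2) 0 H).
Qed.

(** Product rule: both sides are the increment over [[0, s]] of the product of the two primitives.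
    For [f = g] it gives the sign of [\int f (\int f)], and in general it symmetrises the energy
    forms. *)
Lemma Iab_mul_prim s f g : 0 <= s -> continuous f -> continuous g ->
  @mbd R _ RT f -> @mbd R _ RT g ->
  Iab 0 s (fun t => f t * prim s g t) + Iab 0 s (fun t => g t * prim s f t) =
  Iab 0 s f * Iab 0 s g.
Proof.
rewrite le_eqVlt => /predU1P[<-|s0] cf cg mf mg.
  by rewrite !Iab_pt addr0 mul0r.
rewrite /Iab -JD; [|exact: weight_cc|by apply: mbdM => //; exact: mbd_prim1..].
rewrite -/(Iab 0 s _).
rewrite (@Iab_ext _ _ _ (fun t => f t * Iab 0 t g + Iab 0 t f * g t)); last first.
  by move=> x xs; rewrite !primE// [g x * _]mulrC.
transitivity (Iab 0 s f * Iab 0 s g - Iab 0 0 f * Iab 0 0 g); last first.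
  by rewrite !Iab_pt mulr0 subr0.
apply: (Iab_FTC (F := fun t => Iab 0 t f * Iab 0 t g)) => //.
- apply: within_continuousD; apply: within_continuousM;
  by [exact: continuous_subspaceT|apply: Iab_continuous => //; exact: ltW].
- by apply: within_continuousM; apply: Iab_continuous => //; exact: ltW.
- move=> x /andP[x0 xs].
  have df := Iab_is_derive cf x0; have dg := Iab_is_derive cg x0.
  by apply: is_derive_eq; rewrite /GRing.scale /= addrC mulrC [X in _ = _ + X]mulrC; ring.
Qed.

(** Here [f] may blow up at the endpoints. The theorem is applied on intervals exhausting []a, b[];
    monotone convergence handles the integrals, and continuity of [F] up to the endpoints the
    increments. *)
Lemma FTC_oo_ge0 a b F f : a < b ->
  (forall x, a < x < b -> {for x, continuous f}) ->
  (forall x, a < x < b -> 0 <= f x) ->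
  {within `[a, b], continuous F} ->
  (forall x, a < x < b -> is_derive x 1 F (f x)) ->
  (\int[mu]_(x in `]a, b[) (f x)%:E = (F b - F a)%:E)%E.
Proof.
move=> ab cf f0 cF dF.
have [_ cFa cFb] := (continuous_within_itvP _ ab).1 cF.
(* The shift by 3 gives [2 * d n < b - a] already for [n = 0], so that every inner interval is
   nondegenerate. *)
pose d n : R := (b - a) / n.+3%:R.
have ba0 : 0 < b - a by rewrite subr_gt0.
have d0 n : 0 < d n by rewrite divr_gt0.
have dd n : d n + d n < b - a.
  rewrite /d; move: (b - a) ba0 => c c0.
  by rewrite -mulrDl ltr_pdivrMr// -mulr2n -[c *+ 2]mulr_natr ltr_pM2l// ltr_nat.
have dlim : d n @[n --> \oo] --> (0 : R).
  apply/cvgrPdist_le => e e0; near=> n.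
  rewrite sub0r normrN gtr0_norm// ler_pdivrMr// mulrC -ler_pdivrMr//.
  apply: (@le_trans _ _ n%:R); first by near: n; exact: nbhs_infty_ger.
  by rewrite ler_nat -addn3 leq_addr.
pose A n : set RT := `[(a + d n)%R, (b - d n)%R].
have Aoo n x : A n x -> a < x < b.
  rewrite /A /= in_itv /= => /andP[h1 h2]; have := d0 n; lra.
have UA : \bigcup_n A n = `]a, b[.
  apply/seteqP; split => [x [n _ /Aoo]|x] /=; rewrite in_itv//= => /andP[ax xb].
  have e0 : 0 < Num.min (x - a) (b - x) by rewrite lt_min !subr_gt0 ax.
  move/cvgrPdist_lt: dlim => /(_ _ e0)[n _ /(_ n (leqnn n))].
  rewrite /= sub0r normrN gtr0_norm// lt_min => /andP[h1 h2].
  by exists n => //; rewrite /A /= in_itv /=; apply/andP; split; lra.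
have cAn n : {within A n, continuous f}.
  by apply: continuous_in_subspaceT => x; rewrite inE => /Aoo; exact: cf.
have fi n : mu.-integrable (A n) (EFin \o f).
  by apply: continuous_compact_integrable => //; exact: segment_compact.
have intA n : (\int[mu]_(x in A n) (f x)%:E = (F (b - d n) - F (a + d n))%:E)%E.
  rewrite -[LHS]fineK; last by apply: integrable_fin_num => //; exact: measurable_itv.
  rewrite -/(Rintegral mu (A n) f) -IabE; congr EFin.
  apply: Iab_FTC_cc; [by have := dd n; lra|exact: cAn|move=> x xA].
  by apply: dF; apply: (Aoo n); rewrite /A /= in_itv.
have ndA : nondecreasing_seq A.
  move=> m n mn; apply/subsetPset => x; rewrite /A /= !in_itv /= => /andP[h1 h2].
  have dmn : d n <= d m.
    by rewrite /d ler_pM2l// lef_pV2 ?posrE// ler_nat !ltnS.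
  by apply/andP; split; lra.
have mA n : measurable (A n) by exact: measurable_itv.
have mf n : measurable_fun (A n) (fun x => (f x)%:E).
  by have /integrableP[] := fi n.
have fA0 n x : A n x -> (0 <= (f x)%:E)%E by move=> /Aoo /f0; rewrite lee_fin.
have := @ge0_nondecreasing_set_cvg_integral _ RT R A (fun x => (f x)%:E) mu ndA mA mf fA0.
rewrite UA => cv.
have EA : (fun i => (\int[mu]_(x in A i) (f x)%:E)%E) =
    (fun n => (F (b - d n) - F (a + d n))%:E) by apply/funext.
rewrite EA in cv.
suff cv2 : (F (b - d n) - F (a + d n))%:E @[n --> \oo] --> (F b - F a)%:E.
  exact: (cvg_unique _ cv cv2).
apply: cvg_EFin; first by apply: nearW.
apply: cvgB.
- apply: (cvg_at_leftP _ _ _).1 cFb _ _; split => [n|]; first by rewrite ltrBlDr ltrDl.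
  by rewrite -[X in _ --> X]subr0; apply: cvgB => //; exact: cvg_cst.
- apply: (cvg_at_rightP _ _ _).1 cFa _ _; split => [n|]; first by rewrite ltrDl.
  by rewrite -[X in _ --> X]addr0; apply: cvgD => //; exact: cvg_cst.
Unshelve. all: by end_near. Qed.

End Itv.

(** [J (ker b s) g] is the Abel convolution [\int_0^s (s - z)^(- b) g z dz]; with [b = alpha - 1]
    and [g] the second derivative it is the Caputo derivative up to the Gamma factor. The indicator
    makes the kernel a weight on the whole line. *)
Definition ker (R : realType) (b s z : R) : R :=
  \1_(`]0, s[ : set R) z * ((s - z) `^ b)^-1.

(** * The kernel of the fractional integral *)

Section Kernel.
Context (R : realType).
Local Notation RT := (measurableTypeR R).
Local Notation mu := (@lebesgue_measure R).

Lemma is_derive_powR_subr (p s x : R) : x < s ->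
  is_derive x 1 (fun z => (s - z) `^ p) (- (p * (s - x) `^ (p - 1))).
Proof.
move=> xs; have sx : 0 < s - x by rewrite subr_gt0.
have d1 := is_derive1_powR p sx.
have d2 : is_derive x 1 (fun z => s - z) (-1).
  by apply: is_derive_eq; first [by rewrite sub0r|by rewrite add0r|ring].
have := @is_derive1_comp R (@powR R ^~ p) (fun z => s - z) x _ _ d1 d2.
by move/is_derive_eq; apply; rewrite mulrN1.
Qed.

Lemma is_derive_powR_subl (p z x : R) : z < x ->
  is_derive x 1 (fun t => (t - z) `^ p) (p * (x - z) `^ (p - 1)).
Proof.
move=> zx; have xz : 0 < x - z by rewrite subr_gt0.
have d1 := is_derive1_powR p xz.
have d2 : is_derive x 1 (fun t => t - z) 1.
  by apply: is_derive_eq; rewrite subr0.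
have := @is_derive1_comp R (@powR R ^~ p) (fun t => t - z) x _ _ d1 d2.
by move/is_derive_eq; apply; rewrite mulr1.
Qed.

(** [powR] does not vanish at negative bases, so the truncation is needed for continuity at 0. It
    yields primitives of the Abel kernel that are continuous up to the singular endpoint. *)
Lemma max_powR_continuous (p : R) : 0 < p ->
  continuous (fun r : R => (Num.max r 0) `^ p).
Proof.
move=> p0 r; have [r0|r0|r0] := ltgtP r 0.
- apply: cvg_near_cst; near=> x.
  have x0 : x < 0 by near: x; exact: lt_nbhsl.
  by rewrite (max_idPr (ltW x0)) (max_idPr (ltW r0)).
- have E : \forall x \near r, (Num.max x 0) `^ p = x `^ p.
    near=> x; have x0 : 0 < x by near: x; exact: lt_nbhsr.
    by rewrite (max_idPl (ltW x0)).
  rewrite /continuous_at (nbhs_singleton E).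
  apply: (@cvg_trans _ ((fun x => x `^ p) @ r)).
    by apply: near_eq_cvg; apply: filterS E => x ->.
  exact: (is_derive_continuous (is_derive1_powR p r0)).
- rewrite /continuous_at r0 maxxx powR0 ?gt_eqF//.
  apply/cvgrPdist_le => e e0; near=> x.
  rewrite sub0r normrN ger0_norm ?powR_ge0//.
  have -> : e = (e `^ p^-1) `^ p.
    by rewrite -powRrM mulVf ?gt_eqF// powRr1// ltW.
  apply: ge0_ler_powR; [exact: ltW|by rewrite nnegrE le_max lexx orbT|
    by rewrite nnegrE powR_ge0|].
  rewrite ge_max powR_ge0 andbT; near: x.
  have : 0 < e `^ p^-1 by rewrite powR_gt0.
  by move=> /lt_nbhsl; apply: filterS => x /ltW.
Unshelve. all: by end_near. Qed.

Variable b : R.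
Hypothesis b01 : 0 < b < 1.
Let b0 : 0 < b. Proof. by case/andP: b01. Qed.
Let b1 : 0 < 1 - b. Proof. by rewrite subr_gt0; case/andP: b01. Qed.

Let powRNE (x : R) : (x `^ b)^-1 = x `^ (- b). Proof. by rewrite powRN. Qed.

Lemma integral_powR_subl (z s : R) : z < s ->
  (\int[mu]_(t in `]z, s[) (((t - z) `^ b)^-1)%:E = ((s - z) `^ (1 - b) / (1 - b))%:E)%E.
Proof.
move=> zs; pose F (t : R) := (Num.max (t - z) 0) `^ (1 - b) / (1 - b).
transitivity ((F s - F z)%:E); last first.
  rewrite /F subrr maxxx powR0 ?gt_eqF// mul0r subr0.
  by rewrite (max_idPl _)// subr_ge0 ltW.
apply: FTC_oo_ge0 => //.
- move=> x /andP[zx _].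
  have := @is_derive_powR_subl (- b) z x zx.
  move/is_derive_continuous; rewrite /prop_for /continuous_at powRNE.
  by under eq_fun do rewrite -powRNE.
- by move=> x _; rewrite invr_ge0 powR_ge0.
- apply: continuous_subspaceT => x; rewrite /F; apply: cvgM; last exact: cvg_cst.
  apply: (cvg_comp (fun t => t - z) (fun r => (Num.max r 0) `^ (1 - b))).
    by apply: cvgB; [exact: cvg_id|exact: cvg_cst].
  exact: max_powR_continuous.
- move=> x /andP[zx _].
  have d1 := @is_derive_powR_subl (1 - b) z x zx.
  have d2 : is_derive x 1 (fun t => (1 - b)^-1 * (t - z) `^ (1 - b)) (((x - z) `^ b)^-1).
    apply: is_derive_eq; rewrite /GRing.scale /= mulrA mulVf ?gt_eqF// mul1r.
    by rewrite powRNE; congr powR; ring.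
  apply: near_eq_is_derive d2.
  near=> t; have zt : z < t by near: t; exact: lt_nbhsr.
  by rewrite /F (max_idPl _) ?subr_ge0 ?ltW// mulrC.
Unshelve. all: by end_near. Qed.

Lemma integral_powR_subr (z s : R) : z < s ->
  (\int[mu]_(t in `]z, s[) (((s - t) `^ b)^-1)%:E = ((s - z) `^ (1 - b) / (1 - b))%:E)%E.
Proof.
move=> zs; pose F (t : R) := - ((Num.max (s - t) 0) `^ (1 - b) / (1 - b)).
transitivity ((F s - F z)%:E); last first.
  rewrite /F subrr maxxx powR0 ?gt_eqF// mul0r oppr0 sub0r opprK.
  by rewrite (max_idPl _)// subr_ge0 ltW.
apply: FTC_oo_ge0 => //.
- move=> x /andP[_ xs].
  have := @is_derive_powR_subr (- b) s x xs.
  move/is_derive_continuous; rewrite /prop_for /continuous_at powRNE.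
  by under eq_fun do rewrite -powRNE.
- by move=> x _; rewrite invr_ge0 powR_ge0.
- apply: continuous_subspaceT => x; rewrite /F; apply: cvgN; apply: cvgM; last exact: cvg_cst.
  apply: (cvg_comp (fun t => s - t) (fun r => (Num.max r 0) `^ (1 - b))).
    by apply: cvgB; [exact: cvg_cst|exact: cvg_id].
  exact: max_powR_continuous.
- move=> x /andP[_ xs].
  have d1 := @is_derive_powR_subr (1 - b) s x xs.
  have d2 : is_derive x 1 (fun t => - (1 - b)^-1 * (s - t) `^ (1 - b)) (((s - x) `^ b)^-1).
    apply: is_derive_eq; rewrite /GRing.scale /= mulrNN mulrA mulVf ?gt_eqF// mul1r.
    by rewrite powRNE; congr powR; ring.
  apply: near_eq_is_derive d2.
  near=> t; have zt : t < s by near: t; exact: lt_nbhsl.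
  by rewrite /F (max_idPl _) ?subr_ge0 ?ltW// mulNr mulrC.
Unshelve. all: by end_near. Qed.

Lemma measurable_invpow : measurable_fun [set: RT] (fun x : RT => (x `^ b)^-1).
Proof.
rewrite (_ : (fun _ => _) = (fun x : R => x `^ (- b))); last first.
  by apply/funext => x; rewrite powRNE.
exact: measurable_powR.
Qed.

Lemma measurable_ker s : measurable_fun [set: RT] (ker b s).
Proof.
apply: measurable_funM; first by apply: measurable_indic; exact: measurable_itv.
apply: (measurableT_comp measurable_invpow).
by apply: measurable_funB => //; exact: measurable_cst.
Qed.

Lemma ker_ge0 s z : 0 <= ker b s z.
Proof. by rewrite mulr_ge0 ?invr_ge0 ?powR_ge0// indicE. Qed.

Lemma ker_neq0 s z : ker b s z != 0 -> 0 < z < s.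
Proof.
rewrite /ker mulf_eq0 negb_or => /andP[+ _].
by move=> /indic_neq0; rewrite /= in_itv.
Qed.

Lemma integral_ker s : 0 < s -> (\int[mu]_z (ker b s z)%:E = (s `^ (1 - b) / (1 - b))%:E)%E.
Proof.
move=> s0; rewrite -[in RHS](subr0 s) -integral_powR_subr// [RHS]integral_mkcond.
apply: eq_integral => z _; rewrite patchE /ker indicE.
by case: (z \in _); rewrite ?mul1r ?mul0r.
Qed.

Lemma ker_le0 s : s <= 0 -> ker b s = fun=> 0.
Proof.
move=> s0; apply/funext => z; apply/eqP/negP => /negP /ker_neq0 /andP[z0 zs].
by have := lt_trans z0 zs; rewrite ltNge s0.
Qed.

Lemma weight_ker s : weight (ker b s).
Proof.
have [s0|s0] := ltP 0 s; last first.
  by rewrite ker_le0//; exact: integrable0.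
apply/integrableP; split; first by apply/measurable_EFinP; exact: measurable_ker.
under eq_integral do rewrite /= ger0_norm ?ker_ge0//.
by rewrite integral_ker// ltry.
Qed.

Lemma J_ker_cst s c : 0 < s -> J (ker b s) (fun=> c) = c * (s `^ (1 - b) / (1 - b)).
Proof.
move=> s0; rewrite -[c in LHS]mulr1 (@JZ _ _ c (fun=> 1)) ?weight_ker//; last exact: mbd_cst.
congr (_ * _); rewrite /J /Rintegral.
under eq_integral do rewrite mulr1.
by rewrite integral_ker.
Qed.

End Kernel.

(** * Fubini for a singular kernel against an integrable function *)

Section WFubini.
Context (R : realType).
Local Notation RT := (measurableTypeR R).
Local Notation mu := (@lebesgue_measure R).

(** Neither factor is bounded here, unlike in [J_swap]: [g] is merely integrable and [phi] may be
    singular. Bounded integrals of [phi] over its first variable are enough for integrability on the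
    product. *)
Lemma fubini_weight (phi : RT * RT -> R) (g Phi : R -> R) (C : R) :
  measurable_fun [set: RT * RT] phi -> (forall p, 0 <= phi p) -> weight g ->
  (forall z, (\int[mu]_t (phi (t, z))%:E = (Phi z)%:E)%E) ->
  (forall z, Phi z <= C) ->
  weight (fun t => \int[mu]_z (phi (t, z) * g z)) /\
  \int[mu]_t (\int[mu]_z (phi (t, z) * g z)) = \int[mu]_z (Phi z * g z).
Proof.
move=> mphi phi0 wg hPhi PhiC.
have /integrableP[/measurable_EFinP mg _] := wg.
pose f := fun p : RT * RT => (phi p * g p.2)%:E.
have mf : measurable_fun [set: RT * RT] f.
  apply/measurable_EFinP; apply: measurable_funM => //.
  exact: (measurableT_comp mg).
have Phi0 z : 0 <= Phi z.
  by rewrite -lee_fin -hPhi; apply: integral_ge0 => t _; rewrite lee_fin.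
have mPhi : measurable_fun [set: RT] Phi.
  apply/measurable_EFinP.
  rewrite (_ : _ \o _ = fubini_G mu (EFin \o phi)); last first.
    by apply/funext => z /=; rewrite -hPhi.
  apply: measurable_fun_fubini_tonelli_G => //; first exact/measurable_EFinP.
have mphi2 z : measurable_fun [set: RT] (fun t => phi (t, z)).
  by apply: (measurableT_comp mphi); exact: measurable_pair2.
have iphi z : mu.-integrable [set: RT] (fun t => (phi (t, z))%:E).
  apply/integrableP; split; first exact/measurable_EFinP.
  under eq_integral do rewrite /= ger0_norm//.
  by rewrite hPhi ltry.
have wPg : weight (fun z => g z * Phi z).
  by apply: weight_mbd => //; split=> //; exists C => z; rewrite ger0_norm.
have ig : (mu \x mu)%E.-integrable [set: RT * RT] f.
  apply/integrable21ltyP => //.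
  apply: le_lt_trans (integrableP _ _ _ wPg).2.
  apply: ge0_le_integral => //.
  - by move=> z _; exact: integral_ge0.
  - apply: (measurable_fun_fubini_tonelli_G (abse \o f)) => //=.
    exact: measurableT_comp.
  - by apply: measurableT_comp => //; have /integrableP[] := wPg.
  move=> z _; rewrite /= normrM [in leRHS](ger0_norm (Phi0 z)) EFinM -hPhi.
  rewrite -integralZl//.
  rewrite le_eqVlt; apply/orP; left; apply/eqP; apply: eq_integral => t _.
  by rewrite -EFinM normrM ger0_norm// mulrC.
have Fub := Fubini ig.
have EG z : (\int[mu]_t f (t, z) = (Phi z * g z)%:E)%E.
  rewrite EFinM muleC -hPhi -integralZl//; apply: eq_integral => t _.
  by rewrite /f /= -EFinM mulrC.
rewrite (eq_integral _ _ (fun z _ => EG z)) in Fub.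
have iF : mu.-integrable [set: RT] (fubini_F mu f) by exact: integrable_fubini_F.
have mF : measurable_fun [set: RT] (fubini_F mu f) by have /integrableP[] := iF.
have mfF : measurable_fun [set: RT] (EFin \o (fun t => \int[mu]_z (phi (t, z) * g z))).
  by apply/measurable_EFinP; apply: (@measurableT_comp _ _ _ _ _ _ (@fine R)).
(* The inner integral can be infinite for a null set of [t], where [fine] returns 0; hence equality
   only almost everywhere. *)
have aeF : ae_eq mu setT (EFin \o (fun t => \int[mu]_z (phi (t, z) * g z))) (fubini_F mu f).
  have := integrable_ae measurableT iF.
  by apply: filterS => t ft _; rewrite /= fineK//; exact: ft.
split.
  by apply/integrableP; split => //;
     rewrite (ae_eq_integral (abse \o fubini_F mu f))//;
     [have /integrableP[] := iF | exact: measurableT_comp | exact: measurableT_comp |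
      apply: filterS aeF => t h _ /=; first [by rewrite -(h Logic.I)|by rewrite (h Logic.I)]].
by rewrite [RHS]/Rintegral -Fub /Rintegral; congr fine; exact: ae_eq_integral.
Qed.

End WFubini.

(** * Positivity of the fractional convolution *)

Section Conv.
Context (R : realType).
Local Notation RT := (measurableTypeR R).
Local Notation mu := (@lebesgue_measure R).

Lemma J_indicE (D : set RT) (f : R -> R) : J (\1_D) f = \int[mu]_(x in D) f x.
Proof.
rewrite /J [RHS]Rintegral_mkcond; apply: eq_Rintegral => x _.
by rewrite patchE indicE; case: ifPn => _; rewrite ?mul1r ?mul0r.
Qed.

Lemma mbd_integrable (D : set RT) (f : R -> R) (a b : R) : measurable D ->
  D `<=` `[a, b] -> @mbd R _ RT f -> mu.-integrable D (EFin \o f).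
Proof.
move=> mD Dab mf.
have mI : measurable (`[a, b] : set RT) by exact: measurable_itv.
apply: (integrableS mI mD Dab).
apply/integrable_mkcond => //.
have := weight_mbd (weight_cc a b) mf.
apply: eq_integrable => // x _; rewrite /= patchE indicE.
by case: (x \in _); rewrite ?mul1r ?mul0r.
Qed.

Lemma J_oo_cc (a b : R) (f : R -> R) : @mbd R _ RT f ->
  J (\1_`]a, b[) f = Iab a b f.
Proof.
move=> mf; rewrite J_indicE IabE.
rewrite Rintegral_itv_bndo_bndc; last first.
  apply: (@mbd_integrable _ _ a b (measurable_itv _) _ mf); exact: subset_itv_oo_cc.
rewrite Rintegral_itv_obnd_cbnd//.
apply: (@mbd_integrable _ _ a b (measurable_itv _) _ mf); exact: subset_itv_oc_cc.
Qed.

Lemma Iab_le_continuous (a b : R) (f g : R -> R) :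
  {within `[a, b], continuous f} -> {within `[a, b], continuous g} ->
  (forall x, a <= x <= b -> f x <= g x) -> Iab a b f <= Iab a b g.
Proof.
move=> cf cg fg; rewrite !IabE; apply: le_Rintegral => //.
- by apply: continuous_compact_integrable => //; exact: segment_compact.
- by apply: continuous_compact_integrable => //; exact: segment_compact.
Qed.

Lemma J_cst1_cc (a b : R) : a <= b -> @J R (fun x => `|\1_`[a, b] x|) (cst 1) = b - a.
Proof.
move=> ab; rewrite (_ : (fun _ => _) = \1_`[a, b]); last first.
  by apply/funext => x; rewrite ger0_norm// indicE.
rewrite J_indicE Rintegral_cst//= mul1r.
rewrite lebesgue_measure_itv/= lte_fin; case: (ltP a b) => //= ba.
by have -> : a = b; [apply/eqP; rewrite eq_le ab ba|rewrite subrr].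
Qed.

Lemma Iab_norm_le (a b C : R) (f : R -> R) : a <= b -> @mbd R _ RT f ->
  (forall x, a <= x <= b -> `|f x| <= C) -> `|Iab a b f| <= C * (b - a).
Proof.
move=> ab mf fC; rewrite -J_cst1_cc//.
by apply: J_norm => //; [exact: weight_cc|move=> x /indic_cc_neq0; exact: fC].
Qed.

Lemma Iab_sub (s t : R) (f : R -> R) : 0 <= s -> s <= t -> continuous f ->
  Iab 0 t f - Iab 0 s f = Iab s t f.
Proof.
move=> s0; rewrite le_eqVlt => /predU1P[<-|st] cf; first by rewrite subrr Iab_pt.
symmetry; apply: (Iab_FTC (F := Iab 0 ^~ f)) => //.
- exact: continuous_subspaceT.
- apply: continuous_subspaceW (Iab_continuous _ cf); last exact: (le_trans s0 (ltW st)).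
  by move=> x /=; rewrite !in_itv /= => /andP[sx ->]; rewrite (le_trans s0).
- by move=> x /andP[sx _]; apply: Iab_is_derive => //; exact: le_lt_trans sx.
Qed.

Lemma measurable_indic_lt :
  measurable_fun [set: RT * RT] (fun p : RT * RT => \1_(`]0, p.1[ : set R) p.2 : R).
Proof.
rewrite (_ : (fun _ => _) =
   (fun p : RT * RT => if (0 < p.2) && (p.2 < p.1) then 1 else 0 : R)); last first.
  apply/funext => p; rewrite indicE mem_setE in_itv /=.
  by case: (_ && _).
apply: measurable_fun_ifT => //.
apply: measurable_and.
  by apply: measurable_fun_ltr => //; exact: measurable_cst.
by apply: measurable_fun_ltr.
Qed.

Variable b : R.
Hypothesis b01 : 0 < b < 1.
Let b0 : 0 < b. Proof. by case/andP: b01. Qed.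
Let b1 : 0 < 1 - b. Proof. by rewrite subr_gt0; case/andP: b01. Qed.

Lemma measurable_ker2 : measurable_fun [set: RT * RT] (fun p : RT * RT => ker b p.1 p.2).
Proof.
apply: measurable_funM; first exact: measurable_indic_lt.
apply: (measurableT_comp (measurable_invpow b)).
by apply: measurable_funB.
Qed.

Lemma powR_onem_le (r s : R) : 0 <= r -> r <= s -> r `^ (1 - b) / (1 - b) <= s `^ (1 - b) / (1 - b).
Proof.
move=> r0 rs; rewrite ler_pM2r ?invr_gt0//.
by apply: ge0_ler_powR; [exact: ltW|rewrite nnegrE|rewrite nnegrE (le_trans r0 rs)|].
Qed.

Lemma mbd_conv (s : R) (g : R -> R) : @mbd R _ RT g ->
  @mbd R _ RT (fun t => \1_`]0, s[ t * J (ker b t) g).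
Proof.
move=> mg; have [mg' [C hC]] := mg; split.
  apply: measurable_funM; first by apply: measurable_indic; exact: measurable_itv.
  apply: (@measurable_Rintegral _ _ RT (fun p => ker b p.1 p.2 * g p.2)).
  apply: measurable_funM; first exact: measurable_ker2.
  exact: (measurableT_comp mg').
have C0 : 0 <= C by apply: le_trans (hC 0).
exists (C * (s `^ (1 - b) / (1 - b))) => t; rewrite indicE mem_setE in_itv /=.
have [/andP[t0 ts]|] := boolP (0 < t < s); last first.
  by rewrite mul0r normr0 mulr_ge0// divr_ge0 ?powR_ge0// ltW.
rewrite mul1r; apply: (le_trans (J_norm (weight_ker b01 t) mg (fun x _ => hC x))).
rewrite ler_wpM2l// (_ : (fun _ => _) = ker b t); last first.
  by apply/funext => x; rewrite ger0_norm// ker_ge0.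
by rewrite (J_ker_cst b01 1 t0) mul1r powR_onem_le ?ltW.
Qed.

(** Convolution commutes with taking primitives. Both sides equal [\int Phi z * g z dz], because
    integrating the kernel over its upper time ([phi1]) or over its lower time ([phi2]) gives the
    same [Phi]. Only integrability of [g] is available, as [g] will be the second time
    derivative. *)
Lemma conv_comm_weight (s : R) (g : R -> R) : 0 < s -> weight g ->
  weight (fun t => \1_`]0, s[ t * J (ker b t) g) /\
  J (\1_`]0, s[) (fun t => J (ker b t) g) =
  J (ker b s) (fun t => J (\1_`]0, t[) g).
Proof.
move=> s0 wg.
pose Phi (z : R) : R := \1_`]0, s[ z * ((s - z) `^ (1 - b) / (1 - b)).
pose C := s `^ (1 - b) / (1 - b).
have PhiC z : Phi z <= C.
  rewrite /Phi indicE mem_setE in_itv /=.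
  have [/andP[z0 zs]|] := boolP (0 < z < s); last first.
    by rewrite mul0r /C divr_ge0 ?powR_ge0// ltW.
  by rewrite mul1r /C powR_onem_le ?subr_ge0 ?ltW// gtrBl.
pose phi1 := fun p : RT * RT => \1_`]0, s[ p.1 * ker b p.1 p.2.
pose phi2 := fun p : RT * RT => ker b s p.1 * \1_`]0, p.1[ p.2.
have mI : measurable_fun [set: RT] (\1_`]0, s[ : RT -> R).
  by apply: measurable_indic; exact: measurable_itv.
have m1 : measurable_fun [set: RT * RT] phi1.
  apply: measurable_funM; last exact: measurable_ker2.
  exact: (measurableT_comp mI measurable_fst).
have m2 : measurable_fun [set: RT * RT] phi2.
  apply: measurable_funM; last exact: measurable_indic_lt.
  by apply: (measurableT_comp (measurable_ker b s)).
have p1 p : 0 <= phi1 p by rewrite mulr_ge0 ?ker_ge0// indicE.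
have p2 p : 0 <= phi2 p by rewrite mulr_ge0 ?ker_ge0// indicE.
have h1 z : (\int[mu]_t (phi1 (t, z))%:E = (Phi z)%:E)%E.
  rewrite /Phi indicE mem_setE in_itv /=.
  have [/andP[z0 zs]|nz] := boolP (0 < z < s).
    rewrite mul1r -integral_powR_subl// [RHS]integral_mkcond.
    apply: eq_integral => t _; rewrite patchE /phi1 /ker /= !indicE !mem_setE !in_itv /= z0 /=.
    case: (ltP z t) => zt /=; last by rewrite mul0r mulr0.
    by rewrite (lt_trans z0 zt) /=; case: (t < s); rewrite ?mul1r ?mul0r.
  rewrite mul0r integral0_eq// => t _; rewrite /phi1 /ker /= !indicE !mem_setE !in_itv /=.
  case: (boolP (0 < z)) nz => z0 /=; last by rewrite !(mul0r, mulr0).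
  rewrite -leNgt => sz; case: (ltP z t) => zt; last by rewrite !(mul0r, mulr0).
  by rewrite [t < s]ltNge (le_trans sz (ltW zt)) andbF mul0r.
have h2 z : (\int[mu]_t (phi2 (t, z))%:E = (Phi z)%:E)%E.
  rewrite /Phi indicE mem_setE in_itv /=.
  have [/andP[z0 zs]|nz] := boolP (0 < z < s).
    rewrite mul1r -integral_powR_subr// [RHS]integral_mkcond.
    apply: eq_integral => t _; rewrite patchE /phi2 /ker /= !indicE !mem_setE !in_itv /= z0 /=.
    case: (ltP z t) => zt /=; last by rewrite mulr0.
    by rewrite (lt_trans z0 zt) /=; case: (t < s); rewrite ?mul1r ?mul0r ?mulr1.
  rewrite mul0r integral0_eq// => t _; rewrite /phi2 /ker /= !indicE !mem_setE !in_itv /=.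
  case: (boolP (0 < z)) nz => z0 /=; last by rewrite !(mul0r, mulr0).
  rewrite -leNgt => sz; case: (ltP z t) => zt; last by rewrite !(mul0r, mulr0).
  by rewrite [t < s]ltNge (le_trans sz (ltW zt)) andbF !mul0r.
have [w1 e1] := fubini_weight m1 p1 wg h1 PhiC.
have [_ e2] := fubini_weight m2 p2 wg h2 PhiC.
have E1 t : \1_`]0, s[ t * J (ker b t) g = \int[mu]_z (phi1 (t, z) * g z).
  rewrite /phi1 /J /= indicE; case: (t \in _); last first.
    rewrite mul0r (@eq_Rintegral _ _ _ _ _ (fun=> 0)) ?Rintegral_cst ?mul0r//.
    by move=> z _; rewrite !mul0r.
  by rewrite mul1r; apply: eq_Rintegral => z _; rewrite mul1r.
split.
  rewrite (_ : (fun t => _) = (fun t => \int[mu]_z (phi1 (t, z) * g z)))//.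
  by apply/funext => t; exact: E1.
transitivity (\int[mu]_z (Phi z * g z)); [rewrite -e1|rewrite -e2].
- by apply: eq_Rintegral => t _; rewrite -E1.
- apply: eq_Rintegral => t _; rewrite /phi2 /J /=.
  rewrite -RintegralZl//; last first.
    have := weight_mbd wg (@mbd_indic R `]0, t[%classic (measurable_itv _)).
    apply: eq_integrable => // z _ /=; by rewrite mulrC.
  by apply: eq_Rintegral => z _; rewrite mulrA.
Qed.

Lemma conv_comm (s : R) (g : R -> R) : 0 < s -> weight g ->
  J (\1_`]0, s[) (fun t => J (ker b t) g) =
  J (ker b s) (fun t => J (\1_`]0, t[) g).
Proof. by move=> s0 wg; case: (conv_comm_weight s0 wg). Qed.

(* Alikhanov's inequality [k * (z z') <= z (k * z')] at time [t]: the integrand is the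
   increasing kernel times [- ((z t - z x)^2 / 2)'], and stopping at [t - d] costs O(d). *)
Lemma alikhanov (dz : R -> R) (C t : R) : continuous dz -> (forall x, `|dz x| <= C) ->
  0 < t ->
  0 <= J (ker b t) (fun x => (Iab 0 t dz - prim t dz x) * dz x).
Proof.
move=> cdz hC t0.
have mdz : @mbd R _ RT dz by split; [exact: continuous_mfun|exists C].
have C0 : 0 <= C by apply: le_trans (hC 0).
pose z x := Iab 0 x dz.
pose h x := (z t - prim t dz x) * dz x.
have mh : @mbd R _ RT h.
  by apply: mbdM => //; apply: mbdB; [exact: mbd_cst|exact: mbd_prim1].
have zlip x : 0 <= x <= t -> `|z t - z x| <= C * (t - x).
  move=> /andP[x0 xt]; rewrite /z Iab_sub//; exact: Iab_norm_le.
pose M := t `^ (1 - b) / (1 - b).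
have M0 : 0 <= M by rewrite divr_ge0 ?powR_ge0// ltW.
(* The first term bounds the part on []t - d, t[], where the integrand is at most [C * d * C]
   against a kernel of mass [M]; the second bounds the boundary term at [t - d]. *)
pose K := C * C * M + C * C * t `^ (1 - b).
have K0 : 0 <= K by rewrite addr_ge0// mulr_ge0 ?powR_ge0// mulr_ge0.
suff key d : 0 < d < t -> - (d * K) <= J (ker b t) h.
  rewrite leNgt; apply/negP => Jneg.
  have K10 : 0 < K + 1 by rewrite ltr_wpDl.
  pose d := Num.min (t / 2) (- J (ker b t) h / (K + 1) / 2).
  have dt : 0 < d < t.
    rewrite /d lt_min gt_min !divr_gt0 ?oppr_gt0//=.
    by rewrite ltr_pdivrMr// ltr_pMr// ltr1n.
  have := key d dt; apply/negP; rewrite -ltNge ltrNr.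
  have d2 : d <= - J (ker b t) h / (K + 1) / 2 by rewrite /d ge_min lexx orbT.
  have J0 : 0 < - J (ker b t) h by rewrite oppr_gt0.
  case/andP: dt => d0 _.
  apply: (@le_lt_trans _ _ (d * (K + 1))).
    by rewrite ler_pM2l// lerDl.
  apply: (@le_lt_trans _ _ (- J (ker b t) h / (K + 1) / 2 * (K + 1))).
    by rewrite ler_pM2r.
  rewrite mulrAC divfK ?gt_eqF//.
  by rewrite ltr_pdivrMr// ltr_pMr// ltr1n.
move=> /andP[d0 dt].
pose h1 (x : R) := (x <= t - d)%R%:R * h x.
pose h2 (x : R) := (t - d < x)%R%:R * h x.
have mle : @mbd R _ RT (fun x : R => (x <= t - d)%R%:R : R).
  exact: (@mbd_sec1 R _ RT _ RT (fun p => (p.2 <= p.1)%R%:R : R) (t - d) (@mbd_le R)).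
have mh1 : @mbd R _ RT h1 by exact: mbdM.
have mh2 : @mbd R _ RT h2.
  rewrite (_ : h2 = fun x => h x - h1 x); first exact: mbdB.
  by apply/funext => x; rewrite /h1 /h2; case: ltP; rewrite !(mul1r, mul0r, subr0, subrr).
have -> : J (ker b t) h = J (ker b t) h1 + J (ker b t) h2.
  rewrite -JD//; last exact: weight_ker.
  apply: J_ext => x _; rewrite /h1 /h2.
  by case: ltP; rewrite !(mul1r, mul0r, addr0, add0r).
have H2 : - (d * (C * C * M)) <= J (ker b t) h2.
  have : `|J (ker b t) h2| <= (C * d * C) * @J R (fun x => `|ker b t x|) (cst 1).
    apply: J_norm => //; first exact: weight_ker.
    move=> x /ker_neq0 /andP[x0 xt]; rewrite /h2.
    case: ltP => xd; last by rewrite mul0r normr0 !mulr_ge0// ltW.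
    rewrite mul1r /h normrM primE; last by rewrite (ltW x0) (ltW xt).
    apply: ler_pM => //.
    apply: (le_trans (zlip x _)); first by rewrite (ltW x0) (ltW xt).
    by rewrite ler_wpM2l// lerBlDr -lerBlDl ltW.
  rewrite (_ : (fun x => `|ker b t x|) = ker b t); last first.
    by apply/funext => x; rewrite ger0_norm// ker_ge0.
  rewrite (J_ker_cst b01 1 t0) mul1r -/M => /ler_normlP[H _].
  rewrite lerNl (le_trans H)//.
  by rewrite (_ : C * d * C * M = d * (C * C * M))//; ring.
have td0 : 0 < t - d by rewrite subr_gt0.
pose k x := ((t - x) `^ b)^-1.
have dk x : x < t -> is_derive x 1 k (b * (t - x) `^ (- b - 1)).
  move=> xt; have := @is_derive_powR_subr R (- b) t x xt.
  rewrite mulNr opprK; congr (is_derive _ _ _ _).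
  by apply/funext => y; rewrite /k powRN.
(* As [Phi' = P - k (z t - z) dz] with [P >= 0] below, the integral up to [t - d] is at least
   [Phi 0 - Phi (t - d)]. The Lipschitz bound on [z] gives [Phi (t - d) <= C^2 d^(2 - b) / 2], which
   is [O(d)] because [b < 1]. *)
pose Phi x := k x * (z t - z x) ^+ 2 / 2.
have cz : {within `[0, t - d], continuous z} by apply: Iab_continuous => //; exact: ltW.
have ck : {within `[0, t - d], continuous k}.
  apply: continuous_in_subspaceT => x; rewrite inE /= in_itv /= => /andP[_ xtd].
  apply: is_derive_continuous (dk x _); lra.
have czz : {within `[0, t - d], continuous (fun x => z t - z x)}.
  by move=> x; apply: cvgB; [exact: cvg_cst|exact: cz].
have cdzw : {within `[0, t - d], continuous dz} by exact: continuous_subspaceT.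
have ckh : {within `[0, t - d], continuous (fun x => k x * ((z t - z x) * dz x))}.
  by do 2 apply: within_continuousM => //.
have ck1 : {within `[0, t - d], continuous (fun x : R => (t - x) `^ (- b - 1))}.
  apply: continuous_in_subspaceT => x; rewrite inE /= in_itv /= => /andP[_ xtd].
  apply: is_derive_continuous (@is_derive_powR_subr R (- b - 1) t x _); lra.
have csq : {within `[0, t - d], continuous (fun x : R => (z t - z x) ^+ 2)}.
  by apply: within_continuousM.
pose P x := b / 2 * (t - x) `^ (- b - 1) * (z t - z x) ^+ 2.
have cP : {within `[0, t - d], continuous P}.
  apply: within_continuousM => //; apply: within_continuousM => //.
  by apply: continuous_subspaceT => x; exact: cvg_cst.
have H1 : - (d * (C * C * t `^ (1 - b))) <= J (ker b t) h1.
  have -> : J (ker b t) h1 = Iab 0 (t - d) (fun x => k x * ((z t - z x) * dz x)).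
    have ikh : mu.-integrable `[0, t - d] (EFin \o (fun x => k x * ((z t - z x) * dz x))).
      by apply: continuous_compact_integrable => //; exact: segment_compact.
    rewrite IabE -Rintegral_itv_obnd_cbnd; last first.
      by apply: integrableS ikh => //; exact: subset_itv_oc_cc.
    rewrite /J [RHS]Rintegral_mkcond; apply: eq_Rintegral => x _.
    rewrite patchE /ker /h1 indicE !mem_setE !in_itv /=.
    case: (ltP 0 x) => x0 /=; last by rewrite !mul0r.
    case: (leP x (t - d)) => xtd /=; last by rewrite !(mul0r, mulr0).
    have xt : x < t by lra.
    by rewrite xt !mul1r /h primE// !ltW.
  have F1 : Iab 0 (t - d) (fun x => P x - k x * ((z t - z x) * dz x)) =
       Phi (t - d) - Phi 0.
    apply: Iab_FTC => //.
    - move=> x; apply: cvgB; [exact: cP|exact: ckh].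
    - apply: within_continuousM; first by apply: within_continuousM.
      by apply: continuous_subspaceT => x; exact: cvg_cst.
    - move=> x /andP[x0 xtd].
      have xt : x < t by lra.
      have d1 := dk x xt.
      have d2 : is_derive x 1 z (dz x) by apply: Iab_is_derive.
      have d3 : is_derive x 1 (fun x => k x * ((z t - z x) * (z t - z x))) 
         (P x * 2 - k x * ((z t - z x) * dz x) * 2).
        by apply: is_derive_eq; rewrite /P /GRing.scale /=; field.
      rewrite (_ : Phi = fun x => 2^-1 * (k x * ((z t - z x) * (z t - z x)))); last first.
        by apply/funext => y; rewrite /Phi expr2 mulrC.
      by apply: is_derive_eq; rewrite /GRing.scale /=; field.
  have F2 : Iab 0 (t - d) (fun x => - (P x - k x * ((z t - z x) * dz x))) <=
      Iab 0 (t - d) (fun x => k x * ((z t - z x) * dz x)).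
    apply: Iab_le_continuous => //.
      by move=> x; apply: cvgN; apply: cvgB; [exact: cP|exact: ckh].
    move=> x _; rewrite opprB lerBlDr lerDl /P.
    by rewrite mulr_ge0 ?sqr_ge0// mulr_ge0 ?powR_ge0// divr_ge0// ltW.
  have F3 : Iab 0 (t - d) (fun x => - (P x - k x * ((z t - z x) * dz x))) = Phi 0 - Phi (t - d).
    transitivity (-1 * Iab 0 (t - d) (fun x => P x - k x * ((z t - z x) * dz x))); last first.
      by rewrite F1 mulN1r opprB.
    rewrite !IabE -RintegralZl//; first by apply: eq_Rintegral => x _; rewrite mulN1r.
    apply: continuous_compact_integrable; first exact: segment_compact.
    by move=> x; apply: cvgB; [exact: cP|exact: ckh].
  apply: le_trans F2; rewrite F3.
  have Phi0 : 0 <= Phi 0.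
    by rewrite /Phi divr_ge0// mulr_ge0 ?sqr_ge0// invr_ge0 powR_ge0.
  apply: (@le_trans _ _ (- Phi (t - d))); last by rewrite lerDr.
  rewrite lerN2 /Phi /k subKr.
  have zz : (z t - z (t - d)) ^+ 2 <= (C * d) ^+ 2.
    have le1 : `|z t - z (t - d)| <= C * d.
      by have := zlip (t - d); rewrite subKr; apply; rewrite (ltW td0) gerBl ltW.
    rewrite -real_normK ?num_real//; apply: lerXn2r => //.
    by rewrite nnegrE mulr_ge0// ltW.
  have dd : (d `^ b)^-1 * d = d `^ (1 - b).
    rewrite powRB; last by rewrite (gt_eqF d0) implybT.
    by rewrite powRr1 ?(ltW d0)// mulrC.
  have dt1 : d `^ (1 - b) <= t `^ (1 - b).
    by apply: ge0_ler_powR; rewrite ?nnegrE ?ltW.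
  apply: (@le_trans _ _ ((d `^ b)^-1 * (C * d) ^+ 2 / 2)).
    by rewrite ler_pM2r// ler_wpM2l// invr_ge0 powR_ge0.
  rewrite (_ : (d `^ b)^-1 * (C * d) ^+ 2 / 2 = d * (C * C * (d `^ (1 - b))) / 2); last first.
    by rewrite -dd; field; rewrite gt_eqF ?powR_gt0.
  have CCt : 0 <= d * (C * C * t `^ (1 - b)).
    by rewrite mulr_ge0 ?(ltW d0)// !mulr_ge0// powR_ge0.
  rewrite ler_pdivrMr//; apply: (@le_trans _ _ (d * (C * C * t `^ (1 - b)))).
    by rewrite ler_pM2l// ler_wpM2l// mulr_ge0.
  by rewrite ler_peMr// ler1n.
rewrite /K mulrDr opprD addrC; exact: lerD.
Qed.

(** With [z] the primitive of [dz], [alikhanov] gives [k * (z z') <= z (k * z')] at each time.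
    Integrating and commuting by [conv_comm], the lower bound becomes [k * (z^2 / 2)], which is
    nonnegative since [z] vanishes at 0. *)
Lemma conv_pos (dz : R -> R) (C s : R) : continuous dz -> (forall x, `|dz x| <= C) ->
  0 < s ->
  0 <= J (\1_`]0, s[) (fun t => prim s dz t * (\1_`]0, s[ t * J (ker b t) dz)).
Proof.
move=> cdz hC s0.
have mdz : @mbd R _ RT dz by split; [exact: continuous_mfun|exists C].
have mp : @mbd R _ RT (fun x => prim s dz x * dz x).
  by apply: mbdM => //; exact: mbd_prim1.
pose g x := \1_`]0, s[ x * (prim s dz x * dz x).
have wg : weight g by exact: weight_mbd (weight_oo 0 s) mp.
have mI : @mbd R _ RT (\1_`]0, s[) by apply: mbd_indic; exact: measurable_itv.
have mg : @mbd R _ RT g by apply: mbdM.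
apply: (@le_trans _ _ (J (\1_`]0, s[) (fun t => \1_`]0, s[ t * J (ker b t) g))); last first.
  apply: J_le => //.
  - exact: weight_oo.
  - exact: mbd_conv.
  - by apply: mbdM; [exact: mbd_prim1|exact: mbd_conv].
  move=> t /indic_neq0; rewrite /= in_itv /= => /andP[t0 ts].
  rewrite indicE mem_setE in_itv /= t0 ts !mul1r primE; last by rewrite (ltW t0) (ltW ts).
  rewrite -subr_ge0 -JZ//; last exact: weight_ker.
  rewrite -JB//; [|exact: weight_ker|exact: mbdZ].
  have := alikhanov cdz hC t0.
  rewrite (@J_ext _ _ _ (fun x => Iab 0 t dz * dz x - g x))//.
  move=> x /ker_neq0 /andP[x0 xt]; rewrite /g indicE mem_setE in_itv /= x0 (lt_trans xt ts).
  by rewrite mul1r !primE ?mulrBl// ltW//= ltW// (lt_trans xt).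
rewrite (@J_ext _ _ _ (fun t => J (ker b t) g)); last first.
  move=> t; rewrite indicE; case: (t \in _); last by rewrite eqxx.
  by rewrite mul1r.
rewrite conv_comm//.
apply: J_ge0 => [x|t /ker_neq0 /andP[t0 ts]]; first exact: ker_ge0.
rewrite J_oo_cc//.
have -> : Iab 0 t g = Iab 0 t (fun x => dz x * prim t dz x).
  rewrite -!J_oo_cc//; last by apply: mbdM => //; exact: mbd_prim1.
  apply: J_ext => x /indic_neq0; rewrite /= in_itv /= => /andP[x0 xt].
  rewrite /g indicE mem_setE in_itv /= x0 (lt_trans xt ts) mul1r.
  by rewrite !primE ?(ltW x0) ?(ltW xt)//= ?ltW// ?(lt_trans xt ts)// mulrC.
have := Iab_mul_prim (ltW t0) cdz cdz mdz mdz.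
rewrite -mulr2n -expr2 => E.
have : 0 <= Iab 0 t (fun x => dz x * prim t dz x) *+ 2 by rewrite E sqr_ge0.
by rewrite pmulrn_lge0.
Qed.

End Conv.

(** * Extension of functions from a box to the whole space *)

Definition clamp (R : realType) (lo hi x : R) : R := Num.max lo (Num.min hi x).

(** Projecting each variable onto its interval extends [f] from the box to the whole space with the
    same values inside. Continuity on a compact box becomes global boundedness and continuity, so
    that integral lemmas need no domains. *)
Definition box (R : realType) (a1 b1 a2 b2 a3 b3 : R) (f : R -> R -> R -> R) x y t :=
  f (clamp a1 b1 x) (clamp a2 b2 y) (clamp a3 b3 t).

(* Separate continuity suffices for joint measurability. *)
Record cb3 (R : realType) (f : R -> R -> R -> R) : Prop := Cb3 {
  cb3_bound : exists C, forall x y t, `|f x y t| <= C ;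
  cb3_x : forall y t, continuous (fun x => f x y t) ;
  cb3_y : forall x t, continuous (fun y => f x y t) ;
  cb3_t : forall x y, continuous (f x y) }.

Section Clamp.
Context (R : realType).
Local Notation RT := (measurableTypeR R).
Local Notation mu := (@lebesgue_measure R).

Lemma clamp_in (lo hi x : R) : lo <= hi -> lo <= clamp lo hi x <= hi.
Proof.
by move=> lh; rewrite /clamp le_max lexx /= ge_max lh ge_min lexx.
Qed.

Lemma clamp_id (lo hi x : R) : lo <= x <= hi -> clamp lo hi x = x.
Proof. by move=> /andP[lx xh]; rewrite /clamp (min_idPr xh) (max_idPr lx). Qed.

Lemma clamp_continuous (lo hi : R) : continuous (clamp lo hi).
Proof.
move=> x; apply: (@continuous_max _ _ (fun=> lo) (fun x => Num.min hi x)).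
  exact: cvg_cst.
by apply: (@continuous_min _ _ (fun=> hi) (fun x => x)); [exact: cvg_cst|exact: cvg_id].
Qed.

Lemma cb3_mbd (f : R -> R -> R -> R) : cb3 f ->
  mbd (fun p : RT * RT * RT => f p.1.1 p.1.2 p.2).
Proof.
move=> [[C hC] cx cy ct]; split; last by exists C => p.
apply: (@measurable_caratheodory R _ (RT * RT)%type (fun p => f p.1.1 p.1.2 p.2)).
  move=> t; apply: (@measurable_caratheodory R _ RT (fun p => f p.1 p.2 t)).
    by move=> y; exact: continuous_mfun (cx y t).
  by move=> x; exact: cy.
by move=> p; exact: ct.
Qed.

Lemma within_comp_continuous (U V W : topologicalType) (A : set V) (f : V -> W) (h : U -> V) :
  {within A, continuous f} -> continuous h -> (forall u, A (h u)) -> continuous (f \o h).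
Proof.
move=> /subspace_continuousP cf ch Ah u.
apply: (cvg_trans _ (cf (h u) (Ah u))) => P.
rewrite /= => wP; have := ch u _ wP.
by rewrite /nbhs /=; apply: filterS => v /= /(_ (Ah v)).
Qed.

Lemma pair_continuous (U V W : topologicalType) (f : U -> V) (g : U -> W) :
  continuous f -> continuous g -> continuous (fun u => (f u, g u)).
Proof. by move=> cf cg u; apply: cvg_pair; [exact: cf|exact: cg]. Qed.

Lemma cst_continuous' (U V : topologicalType) (v : V) : continuous (fun _ : U => v).
Proof. by move=> u; exact: cvg_cst. Qed.

Lemma box_cb3 (A : set (R * R * R)) (f : R -> R -> R -> R) (a1 b1 a2 b2 a3 b3 : R) :
  a1 <= b1 -> a2 <= b2 -> a3 <= b3 ->
  (forall x y t, a1 <= x <= b1 -> a2 <= y <= b2 -> a3 <= t <= b3 -> A (x, y, t)) ->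
  continuous_on A f -> cb3 (box a1 b1 a2 b2 a3 b3 f).
Proof.
move=> ab1 ab2 ab3 bA cf.
pose B : set (R * R * R) := `[a1, b1] `*` `[a2, b2] `*` `[a3, b3].
have cB : compact B.
  by apply: compact_setX; [apply: compact_setX|]; exact: segment_compact.
have BA : B `<=` A.
  by move=> [[x y] t] [[/=]]; rewrite !in_itv /= => h1 h2 h3; exact: bA.
have cfB : {within B, continuous (fun p : R * R * R => f p.1.1 p.1.2 p.2)}.
  exact: continuous_subspaceW cf.
have inA x y t : A (clamp a1 b1 x, clamp a2 b2 y, clamp a3 b3 t).
  by apply: bA; exact: clamp_in.
split.
- have /compact_bounded[M [_ hM]] := continuous_compact cfB cB.
  exists (M + 1) => x y t; apply: (hM (M + 1)); first by rewrite ltrDl.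
  exists (clamp a1 b1 x, clamp a2 b2 y, clamp a3 b3 t) => //.
  by split; [split|]; rewrite /= in_itv /=; exact: clamp_in.
- move=> y t; apply: (within_comp_continuous cf (h := fun x => (clamp a1 b1 x, clamp a2 b2 y, clamp a3 b3 t))) => //.
  apply: pair_continuous; last exact: cst_continuous'.
  by apply: pair_continuous; [exact: clamp_continuous|exact: cst_continuous'].
- move=> x t; apply: (within_comp_continuous cf (h := fun y => (clamp a1 b1 x, clamp a2 b2 y, clamp a3 b3 t))) => //.
  apply: pair_continuous; last exact: cst_continuous'.
  by apply: pair_continuous; [exact: cst_continuous'|exact: clamp_continuous].
- move=> x y; apply: (within_comp_continuous cf (h := fun t => (clamp a1 b1 x, clamp a2 b2 y, clamp a3 b3 t))) => //.
  by apply: pair_continuous; [exact: cst_continuous'|exact: clamp_continuous].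
Qed.

Lemma box_id (a1 b1 a2 b2 a3 b3 : R) f x y t :
  a1 <= x <= b1 -> a2 <= y <= b2 -> a3 <= t <= b3 ->
  box a1 b1 a2 b2 a3 b3 f x y t = f x y t.
Proof. by move=> h1 h2 h3; rewrite /box !clamp_id. Qed.

End Clamp.

(** * Integration of the equation in time at a fixed point of space *)

Section Time.
Context (R : realType).
Local Notation RT := (measurableTypeR R).
Local Notation mu := (@lebesgue_measure R).
Variable b : R.
Hypothesis b01 : 0 < b < 1.
Let b0 : 0 < b. Proof. by case/andP: b01. Qed.

Variables (T c : R) (wt g F : R -> R).
Hypothesis wt0 : wt t @[t --> 0^'+] --> (0 : R).
Hypothesis dwt : forall t, 0 < t < T -> is_derive t 1 wt (g t).
Hypothesis ig : forall t, 0 < t < T ->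
  mu.-integrable `]0, t[ (fun z => (g z / (t - z) `^ b)%:E).
Hypothesis hF : forall t, 0 < t < T -> F t = c * J (ker b t) g.

(** On []0, s[] the Abel kernel is at least [s^(- b)], so [|g|] is at most [s^b] times the modulus
    of the Caputo integrand, which is integrable. *)
Let weight_g s : 0 < s < T -> weight (fun z => \1_`]0, s[ z * g z).
Proof.
move=> sT; have /andP[s0 _] := sT.
have mD : measurable (`]0, s[ : set RT) by exact: measurable_itv.
have i1 := ig sT.
have i2 : mu.-integrable `]0, s[ (fun z => (s `^ b)%:E * (g z / (s - z) `^ b)%:E)%E.
  exact: integrableZl.
have mg : measurable_fun `]0, s[ g.
  apply: (@eq_measurable_fun _ _ _ _ _ (fun z => (g z / (s - z) `^ b) * (s - z) `^ b)).
    move=> z /set_mem; rewrite /= in_itv /= => /andP[_ zs].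
    by rewrite divfK// gt_eqF// powR_gt0// subr_gt0.
  apply: measurable_funM.
    by have /integrableP[/measurable_EFinP] := i1.
  apply: measurable_funTS; apply: (measurableT_comp (measurable_powR b)).
  by apply: measurable_funB => //; exact: measurable_cst.
have i3 : mu.-integrable `]0, s[ (EFin \o g).
  apply: (le_integrable mD _ _ i2); first exact/measurable_EFinP.
  move=> z; rewrite /= in_itv /= => /andP[z0 zs].
  rewrite lee_fin normrM ger0_norm ?powR_ge0// normrM normfV.
  rewrite [`|(s - z) `^ b|]ger0_norm ?powR_ge0// mulrCA ler_peMr//.
  rewrite ler_pdivlMr ?powR_gt0 ?subr_gt0// mul1r.
  apply: ge0_ler_powR; rewrite ?nnegrE ?subr_ge0 ?(ltW zs) ?(ltW s0) ?(ltW b0)//.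
  by rewrite gerBl ltW.
move/integrable_mkcond: i3 => /(_ mD).
apply: eq_integrable => // z _; rewrite /= patchE indicE.
by case: (z \in _); rewrite ?mul1r ?mul0r.
Qed.

Let int_g t : 0 < t < T -> J (\1_`]0, t[) g = wt t.
Proof.
move=> tT; have /andP[t0 tT'] := tT.
(* An endpoint beyond [t], so that [q] agrees with the derivative of [wt] at [t] as well. *)
pose t' := (t + T) / 2.
have tt' : t < t' by rewrite /t' midf_lt.
have t'T : 0 < t' < T by rewrite (lt_trans t0 tt') /t' midf_lt.
pose q z := \1_`]0, t'[ z * g z.
have wq : weight q := weight_g t'T.
pose d n : R := t / n.+2%:R.
have d0 n : 0 < d n by rewrite divr_gt0.
have dt n : d n < t by rewrite ltr_pdivrMr// ltr_pMr// ltr1n.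
have dlim : d n @[n --> \oo] --> (0 : R).
  apply/cvgrPdist_le => e e0; near=> n.
  rewrite sub0r normrN gtr0_norm// ler_pdivrMr// mulrC -ler_pdivrMr//.
  apply: (@le_trans _ _ n%:R); first by near: n; exact: nbhs_infty_ger.
  by rewrite ler_nat -addn2 leq_addr.
have qE n z : d n <= z <= t -> q z = derive1 wt z.
  move=> /andP[dz zt]; have z0 : 0 < z by rewrite (lt_le_trans (d0 n) dz).
  have zT : 0 < z < T by rewrite z0 (le_lt_trans zt).
  rewrite /q indicE mem_setE in_itv /= z0 (le_lt_trans zt tt') mul1r.
  by have [_ <-] := dwt zT; rewrite derive1E.
have step n : J q (\1_`[d n, t]) = wt t - wt (d n).
  rewrite -(@integral_derive1 R wt (d n) t (dt n)).
  - rewrite /J [RHS]Rintegral_mkcond; apply: eq_Rintegral => z _.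
    rewrite patchE indicE mem_setE in_itv /=.
    by case: ifPn => [/qE ->|_]; rewrite ?mulr1 ?mulr0.
  - move=> z /andP[dz zt].
    have zT : 0 < z < T by rewrite (lt_le_trans (d0 n) dz) (le_lt_trans zt).
    by have [] := dwt zT.
  - have mD : measurable (`[d n, t] : set RT) by exact: measurable_itv.
    have := integrableS measurableT mD (@subsetT _ _) wq.
    apply: eq_integrable => // z /set_mem; rewrite /= in_itv /= => zt.
    by rewrite (qE n).
have cv : J q (\1_`[d n, t]) @[n --> \oo] --> J q (\1_`]0, t]).
  apply: (@J_dct R q (fun n => \1_`[d n, t]) (\1_`]0, t]) 1 wq).
  - by move=> n; apply: measurable_indic; exact: measurable_itv.
  - by move=> n z _; rewrite indicE; case: (_ \in _); rewrite ?normr1 ?normr0.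
  - move=> z; rewrite /q mulf_eq0 negb_or => /andP[/indic_neq0 + _].
    rewrite /= in_itv /= => /andP[z0 _].
    apply: cvg_near_cst; move/cvgrPdist_lt: dlim => /(_ z z0).
    apply: filterS => n; rewrite sub0r normrN gtr0_norm// => dz.
    by rewrite !indicE !mem_setE !in_itv /= z0 (ltW dz).
have cv2 : J q (\1_`[d n, t]) @[n --> \oo] --> wt t.
  rewrite (_ : (fun n => _) = (fun n => wt t - wt (d n))); last by apply/funext.
  rewrite -[X in _ --> X]subr0; apply: cvgB; first exact: cvg_cst.
  by apply: (cvg_at_rightP _ _ _).1 wt0 _ _; split => // n.
rewrite -(cvg_unique _ cv cv2)//.
rewrite J_indicE Rintegral_itv_bndo_bndc; last first.
  have mD : measurable (`]0, t[ : set RT) by exact: measurable_itv.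
  apply/integrable_mkcond => //; have := weight_g tT.
  apply: eq_integrable => // z _; rewrite /= patchE indicE.
  by case: (z \in _); rewrite ?mul1r ?mul0r.
rewrite /J [LHS]Rintegral_mkcond; apply: eq_Rintegral => z _.
rewrite patchE /q !indicE !mem_setE !in_itv /=.
case: (ltP 0 z) => z0 /=; last by rewrite mulr0.
case: (leP z t) => zt /=; last by rewrite mulr0.
by rewrite (le_lt_trans zt tt') mul1r mulr1.
Unshelve. all: by end_near. Qed.

(** [wt] is the primitive of [g], and the primitive passes through the convolution. The
    integrability of [F] down to time 0 also comes from the Caputo side: the space derivatives are
    not controlled there. *)
Lemma time_identity s : 0 < s < T ->
  weight (fun t => \1_`]0, s[ t * F t) /\
  c * J (ker b s) wt = J (\1_`]0, s[) F.
Proof.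
move=> sT; have /andP[s0 sT'] := sT.
pose g0 z := \1_`]0, s[ z * g z.
have wg0 : weight g0 := weight_g sT.
have [w1 e1] := conv_comm_weight b01 s0 wg0.
have kg0 t : t < s -> J (ker b t) g0 = J (ker b t) g.
  move=> ts; apply: J_ext => z /ker_neq0 /andP[z0 zt].
  by rewrite /g0 indicE mem_setE in_itv /= z0 (lt_trans zt ts) mul1r.
have EF t : \1_`]0, s[ t * F t = c * (\1_`]0, s[ t * J (ker b t) g0).
  rewrite indicE mem_setE in_itv /=.
  have [/andP[t0 ts]|] := boolP (0 < t < s); last by rewrite !mul0r mulr0.
  by rewrite !mul1r kg0// hF// t0 (lt_trans ts sT').
split.
  have := @integrableZl _ _ _ mu setT measurableT c _ w1.
  by apply: eq_integrable => // t _; rewrite /= EF.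
transitivity (c * J (\1_`]0, s[) (fun t => J (ker b t) g0)).
  rewrite e1; congr (_ * _); apply: J_ext => t /ker_neq0 /andP[t0 ts].
  rewrite -int_g; last by rewrite t0 (lt_trans ts sT').
  apply: J_ext => z /indic_neq0; rewrite /= in_itv /= => /andP[z0 zt].
  by rewrite /g0 indicE mem_setE in_itv /= z0 (lt_trans zt ts) mul1r.
rewrite /J -RintegralZl//.
by apply: eq_Rintegral => t _; rewrite EF.
Qed.

End Time.

(** * Green functions *)

Section Green.
Context (R : realType).
Local Notation RT := (measurableTypeR R).
Local Notation mu := (@lebesgue_measure R).

Definition theta (P : R -> R) (a b x y : R) : R :=
  (P (Num.min x y) - P a) * (P b - P (Num.max x y)) / (P b - P a).

Lemma theta_continuous (P : R -> R) (a b x : R) : a < x -> x < b ->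
  (forall y, a <= y <= b -> {for y, continuous P}) ->
  {within `[a, b], continuous (theta P a b x)}.
Proof.
move=> ax xb cP; apply: within_continuousM; last first.
  by apply: continuous_subspaceT => y; exact: cvg_cst.
have cmin : continuous (fun y : R => Num.min x y).
  by move=> y; apply: (@continuous_min _ _ (fun=> x) (fun y => y)); [exact: cvg_cst|exact: cvg_id].
have cmax : continuous (fun y : R => Num.max x y).
  by move=> y; apply: (@continuous_max _ _ (fun=> x) (fun y => y)); [exact: cvg_cst|exact: cvg_id].
apply: continuous_in_subspaceT => y; rewrite inE /= in_itv /= => /andP[ay yb].
apply: cvgM; (apply: cvgB; last by exact: cvg_cst) || (apply: cvgB; first by exact: cvg_cst).
  apply: (cvg_comp _ P (cmin y)); apply: cP.
  by rewrite le_min (ltW ax) ay ge_min (ltW xb).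
apply: (cvg_comp _ P (cmax y)); apply: cP.
by rewrite le_max (ltW ax) ge_max yb (ltW xb).
Qed.

(* [theta] is the Green function of [h |-> - (h' / P')'] on [[a, b]] with Dirichlet
   conditions; [j] stands for the flux [h' / P']. *)
Lemma green (P pd h j dj : R -> R) (a b x : R) : a < x -> x < b ->
  P a < P b ->
  (forall y, a <= y <= b -> is_derive y 1 P (pd y)) ->
  (forall y, a <= y <= b -> is_derive y 1 h (pd y * j y)) ->
  (forall y, a <= y <= b -> is_derive y 1 j (dj y)) ->
  {within `[a, b], continuous dj} ->
  Iab a b (fun y => theta P a b x y * dj y) =
  ((P b - P x) * h a + (P x - P a) * h b) / (P b - P a) - h x.
Proof.
move=> ax xb Pab dP dh ddj cdj.
have Pn0 : P b - P a != 0 by rewrite gt_eqF// subr_gt0.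
have cP : {within `[a, b], continuous P}.
  apply: continuous_in_subspaceT => y; rewrite inE /= in_itv /= => /dP.
  exact: is_derive_continuous.
have sub1 : `[a, x] `<=` (`[a, b] : set R).
  by move=> y /=; rewrite !in_itv /= => /andP[-> yx]; rewrite (le_trans yx (ltW xb)).
have sub2 : `[x, b] `<=` (`[a, b] : set R).
  by move=> y /=; rewrite !in_itv /= => /andP[xy ->]; rewrite (le_trans (ltW ax) xy).
(* Since [h' = P' j], the function [(P - P a) j - h] is a primitive of [(P - P a) dj], and similarly
   on [[x, b]]. Weighted by the two outer factors of [theta], the flux terms at [x] cancel. *)
have E1 : Iab a x (fun y => (P y - P a) * dj y) = (P x - P a) * j x - h x + h a.
  transitivity (((P x - P a) * j x - h x) - ((P a - P a) * j a - h a)); last by ring.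
  apply: (Iab_FTC_cc (F := fun y => (P y - P a) * j y - h y)) => //.
    apply: within_continuousM; last exact: continuous_subspaceW cdj.
    move=> y; apply: cvgB; last exact: cvg_cst.
    exact: (continuous_subspaceW sub1 cP).
  move=> y yax; have yab : a <= y <= b.
    by move: (sub1 y); rewrite /= !in_itv /=; apply.
  have d1 := dP y yab; have d2 := dh y yab; have d3 := ddj y yab.
  by apply: is_derive_eq; rewrite /GRing.scale /=; ring.
have E2 : Iab x b (fun y => (P b - P y) * dj y) = h b - (P b - P x) * j x - h x.
  transitivity (((P b - P b) * j b + h b) - ((P b - P x) * j x + h x)); last by ring.
  apply: (Iab_FTC_cc (F := fun y => (P b - P y) * j y + h y)) => //.
    apply: within_continuousM; last exact: continuous_subspaceW cdj.
    move=> y; apply: cvgB; first exact: cvg_cst.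
    exact: (continuous_subspaceW sub2 cP).
  move=> y yxb; have yab : a <= y <= b.
    by move: (sub2 y); rewrite /= !in_itv /=; apply.
  have d1 := dP y yab; have d2 := dh y yab; have d3 := ddj y yab.
  by apply: is_derive_eq; rewrite /GRing.scale /=; ring.
have cth : {within `[a, b], continuous (fun y => theta P a b x y * dj y)}.
  apply: within_continuousM => //; apply: theta_continuous => // y /dP.
  exact: is_derive_continuous.
have ith : mu.-integrable `[a, b] (EFin \o (fun y => theta P a b x y * dj y)).
  by apply: continuous_compact_integrable => //; exact: segment_compact.
have split_ : Iab a b (fun y => theta P a b x y * dj y) =
  Iab a x (fun y => theta P a b x y * dj y) + Iab x b (fun y => theta P a b x y * dj y).
  rewrite !IabE.
  have := @Rintegral_itvB R (fun y => theta P a b x y * dj y) (BLeft a) (BRight b) x ith.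
  rewrite !bnd_simp => /(_ (ltW ax) (ltW xb)).
  rewrite Rintegral_itv_obnd_cbnd => [<-|].
    by rewrite addrC subrK.
  by apply: integrableS ith => //; apply: subset_itvr; rewrite bnd_simp ltW.
rewrite split_.
rewrite (@Iab_ext _ a x _ (fun y => (P b - P x) / (P b - P a) * ((P y - P a) * dj y))); last first.
  move=> y /andP[ay yx]; rewrite /theta (min_idPr yx) (max_idPl yx); field; exact: Pn0.
rewrite (@Iab_ext _ x b _ (fun y => (P x - P a) / (P b - P a) * ((P b - P y) * dj y))); last first.
  move=> y /andP[xy yb]; rewrite /theta (min_idPl xy) (max_idPr xy); field; exact: Pn0.
have Z1 : Iab a x (fun y => (P b - P x) / (P b - P a) * ((P y - P a) * dj y)) =
   (P b - P x) / (P b - P a) * Iab a x (fun y => (P y - P a) * dj y).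
  rewrite !IabE RintegralZl//; apply: continuous_compact_integrable.
    exact: segment_compact.
  apply: within_continuousM; last exact: continuous_subspaceW cdj.
  move=> y; apply: cvgB; last exact: cvg_cst.
  exact: (continuous_subspaceW sub1 cP).
have Z2 : Iab x b (fun y => (P x - P a) / (P b - P a) * ((P b - P y) * dj y)) =
   (P x - P a) / (P b - P a) * Iab x b (fun y => (P b - P y) * dj y).
  rewrite !IabE RintegralZl//; apply: continuous_compact_integrable.
    exact: segment_compact.
  apply: within_continuousM; last exact: continuous_subspaceW cdj.
  move=> y; apply: cvgB; first exact: cvg_cst.
  exact: (continuous_subspaceW sub2 cP).
rewrite Z1 Z2 E1 E2; field; exact: Pn0.
Qed.

End Green.

(** * Iterated integrals in three variables *)

Section J3.
Context (R : realType).
Local Notation RT := (measurableTypeR R).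
Local Notation mu := (@lebesgue_measure R).

Lemma weight_continuous (a b : R) (k : R -> R) : {within `[a, b], continuous k} ->
  weight (fun x => \1_`[a, b] x * k x).
Proof.
move=> ck; have mD : measurable (`[a, b] : set RT) by exact: measurable_itv.
have ik : mu.-integrable `[a, b] (EFin \o k).
  by apply: continuous_compact_integrable => //; exact: segment_compact.
move/integrable_mkcond: ik => /(_ mD).
apply: eq_integrable => // z _; rewrite /= patchE indicE.
by case: (z \in _); rewrite ?mul1r ?mul0r.
Qed.

Lemma measurable_perm : measurable_fun [set: RT * RT * RT]
  (fun p : RT * RT * RT => (p.1.1, p.2, p.1.2)).
Proof.
apply: measurable_fun_pair; last first.
  by apply: (measurableT_comp measurable_snd); exact: measurable_fst.
apply: measurable_fun_pair; last exact: measurable_snd.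
by apply: (measurableT_comp measurable_fst); exact: measurable_fst.
Qed.

Definition mbd3 (h : R -> R -> R -> R) := mbd (fun p : RT * RT * RT => h p.1.1 p.1.2 p.2).

Lemma mbd3_J2 h q : mbd3 h -> weight q ->
  mbd (fun p : RT * RT => J q (fun y => h p.1 y p.2)).
Proof.
move=> mh wq; apply: (@mbd_J _ _ (RT * RT)%type (fun p : RT * RT * RT => h p.1.1 p.2 p.1.2)) => //.
exact: (mbd_comp mh measurable_perm).
Qed.

Lemma mbd3_J3 h q : mbd3 h -> weight q ->
  mbd (fun p : RT * RT => J q (fun t => h p.1 p.2 t)).
Proof. by move=> mh wq; apply: (@mbd_J _ _ (RT * RT)%type (fun p => h p.1.1 p.1.2 p.2)). Qed.

Lemma mbd3_x h x : mbd3 h -> mbd (fun p : RT * RT => h x p.1 p.2).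
Proof.
move=> mh; apply: (mbd_comp mh (h := fun p : RT * RT => (x, p.1, p.2))).
apply: measurable_fun_pair; last exact: measurable_snd.
by apply: measurable_fun_pair => //; exact: measurable_cst.
Qed.

Lemma mbd3_y h y : mbd3 h -> mbd (fun p : RT * RT => h p.1 y p.2).
Proof.
move=> mh; apply: (mbd_comp mh (h := fun p : RT * RT => (p.1, y, p.2))).
apply: measurable_fun_pair; last exact: measurable_snd.
by apply: measurable_fun_pair => //; exact: measurable_cst.
Qed.

Lemma mbd3_t h t : mbd3 h -> mbd (fun p : RT * RT => h p.1 p.2 t).
Proof. by move=> mh; exact: (@mbd_sec2 _ _ _ _ RT _ t mh). Qed.

Lemma J_rot (q1 q2 q3 : R -> R) (h : R -> R -> R -> R) : weight q1 -> weight q2 -> weight q3 -> mbd3 h ->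
  J q1 (fun x => J q2 (fun y => J q3 (fun t => h x y t))) =
  J q3 (fun t => J q1 (fun x => J q2 (fun y => h x y t))).
Proof.
move=> w1 w2 w3 mh.
rewrite (@J_ext _ q1 _ (fun x => J q3 (fun t => J q2 (fun y => h x y t)))); last first.
  move=> x _; exact: (@J_swap _ q2 q3 (fun p => h x p.1 p.2) w2 w3 (mbd3_x x mh)).
exact: (@J_swap _ q1 q3 (fun p => J q2 (fun y => h p.1 y p.2)) w1 w3 (mbd3_J2 mh w2)).
Qed.

Lemma cb3_J2 (h : R -> R -> R -> R) (q : R -> R) : cb3 h -> weight q ->
  [/\ exists C, forall x t, `|J q (fun y => h x y t)| <= C,
      forall t, continuous (fun x => J q (fun y => h x y t)) &
      forall x, continuous (fun t => J q (fun y => h x y t))].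
Proof.
move=> [[C hC] cx cy ct] wq.
have mh x t : measurable_fun [set: RT] (fun y => h x y t) by exact: continuous_mfun (cy x t).
split.
- exists (C * @J R (fun x => `|q x|) (cst 1)) => x t.
  by apply: J_norm => //; split => //; exists C.
- by move=> t; apply: (@J_continuous _ q (fun x y => h x y t) C) => // y; exact: cx.
- by move=> x; apply: (@J_continuous _ q (fun t y => h x y t) C) => // y; exact: ct.
Qed.

Lemma cb2_J (h : R -> R -> R) (q : R -> R) C : (forall x t, `|h x t| <= C) ->
  (forall t, continuous (fun x => h x t)) -> (forall x, continuous (h x)) -> weight q ->
  (exists C, forall t, `|J q (fun x => h x t)| <= C) /\ continuous (fun t => J q (fun x => h x t)).
Proof.
move=> hC cx ct wq.
have mh t : measurable_fun [set: RT] (fun x => h x t) by exact: continuous_mfun (cx t).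
split; last by apply: (@J_continuous _ q (fun t x => h x t) C) => // x; exact: ct.
exists (C * @J R (fun x => `|q x|) (cst 1)) => t.
by apply: J_norm => //; split => //; exists C.
Qed.

Lemma cb3_JJ (h : R -> R -> R -> R) (q1 q2 : R -> R) : cb3 h -> weight q1 -> weight q2 ->
  (exists C, forall t, `|J q1 (fun x => J q2 (fun y => h x y t))| <= C) /\
  continuous (fun t => J q1 (fun x => J q2 (fun y => h x y t))).
Proof.
move=> ch w1 w2; have [[C hC] cx ct] := cb3_J2 ch w2.
exact: (@cb2_J (fun x t => J q2 (fun y => h x y t)) q1 C).
Qed.

Lemma bcont_mbd (h : R -> R) : (exists C, forall t, `|h t| <= C) -> continuous h -> @mbd R _ RT h.
Proof. by move=> hC ch; split => //; exact: continuous_mfun. Qed.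

End J3.

Lemma subr_exchange (R : realType) (A B C D : R) : A - B = C - D -> A - C = B - D.
Proof. by move=> E; lra. Qed.

(* [p1], [p2], [q1], [q2], [wt] and [g] stand for [w_x], [w_xx], [w_y], [w_yy], [w_t]
   and [w_tt]. *)
Record hom_solution (R : realType) (b c T : R) (w p1 p2 q1 q2 wt g : R -> R -> R -> R) : Prop :=
  HomSolution {
  hs_cont : continuous_on (Omega T) w ;
  hs_x1 : forall y t, 0 <= y <= 1 -> 0 <= t <= T -> w 1 y t = 0 ;
  hs_y0 : forall x t, 0 <= x <= 1 -> 0 <= t <= T -> w x 0 t = 0 ;
  hs_y1 : forall x t, 0 <= x <= 1 -> 0 <= t <= T -> w x 1 t = 0 ;
  hs_init : forall x y, 0 <= x <= 1 -> 0 <= y <= 1 -> w x y 0 = 0 ;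
  hs_p1 : forall x y t, Omega_int T (x, y, t) ->
    is_derive x 1 (fun s => w s y t) (p1 x y t) ;
  hs_p2 : forall x y t, Omega_int T (x, y, t) ->
    is_derive x 1 (fun s => p1 s y t) (p2 x y t) ;
  hs_q1 : forall x y t, Omega_int T (x, y, t) ->
    is_derive y 1 (fun s => w x s t) (q1 x y t) ;
  hs_q2 : forall x y t, Omega_int T (x, y, t) ->
    is_derive y 1 (fun s => q1 x s t) (q2 x y t) ;
  hs_p1c : continuous_on (Omega_int T) p1 ;
  hs_p2c : continuous_on (Omega_int T) p2 ;
  hs_q2c : continuous_on (Omega_int T) q2 ;
  hs_wtc : continuous_on (Omega_init T) wt ;
  hs_wt0 : forall x y, 0 < x < 1 -> 0 < y < 1 -> wt x y 0 = 0 ;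
  hs_wt : forall x y t, Omega_int T (x, y, t) -> is_derive t 1 (w x y) (wt x y t) ;
  hs_wtt : forall x y t, Omega_int T (x, y, t) -> is_derive t 1 (wt x y) (g x y t) ;
  hs_ig : forall x y t, Omega_int T (x, y, t) ->
    (@lebesgue_measure R).-integrable `]0, t[ (fun z => (g x y z / (t - z) `^ b)%:E) ;
  hs_eq : forall x y t, Omega_int T (x, y, t) ->
    c * J (ker b t) (g x y) = (p2 x y t + x^-1 * p1 x y t) + q2 x y t }.

(** * The inequality on an interior rectangle *)

Section Eps.
Context (R : realType).
Local Notation RT := (measurableTypeR R).
Local Notation mu := (@lebesgue_measure R).
Variables (b c T : R) (w p1 p2 q1 q2 wt g : R -> R -> R -> R).
Hypothesis b01 : 0 < b < 1.
Hypothesis c0 : 0 <= c.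
Hypothesis T0 : 0 < T.
Hypothesis H : hom_solution b c T w p1 p2 q1 q2 wt g.
Let b1 : 0 < 1 - b. Proof. by rewrite subr_gt0; case/andP: b01. Qed.

Definition ext := box 0 1 0 1 0 T w.
Local Notation W := ext.

Lemma ext_cb3 : cb3 W.
Proof.
by apply: (box_cb3 (A := Omega T)) (hs_cont H) => //; exact: ltW.
Qed.

Lemma ext_id x y t : 0 <= x <= 1 -> 0 <= y <= 1 -> 0 <= t <= T -> W x y t = w x y t.
Proof. exact: box_id. Qed.

Lemma Omega_intP x y t : 0 < x < 1 -> 0 < y < 1 -> 0 < t < T -> Omega_int T (x, y, t).
Proof. by move=> h1 h2 h3; split; [split|]; rewrite /= in_itv. Qed.

Variables (a x0 y0 s : R).
Hypothesis a0 : 0 < a.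
Local Notation e := (1 - a).
Hypothesis ax0 : a < x0 < e.
Hypothesis ay0 : a < y0 < e.
Hypothesis sT : 0 < s < T.

Let ae : a < e. Proof. by case/andP: ax0 => h1 h2; exact: lt_trans h2. Qed.
Let e1 : e < 1. Proof. by rewrite gtrBl. Qed.
Let s0 : 0 < s. Proof. by case/andP: sT. Qed.
Let in01 x : a <= x <= e -> 0 < x < 1.
Proof. by move=> /andP[ax xe]; rewrite (lt_le_trans a0 ax) (le_lt_trans xe e1). Qed.
Let in01W x : a <= x <= e -> 0 <= x <= 1.
Proof. by move=> /in01 /andP[h1 h2]; rewrite !ltW. Qed.

(** The factor [xi] turns [p2 + p1 / xi] into the derivative of the flux [xi * p1]. So [green]
    applies with [P = ln], for which [h' / P'] is that flux; [qy] uses the identity for [P]. *)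
Definition qx (xi : R) : R := \1_`[a, e] xi * (theta (@ln R) a e x0 xi * xi).
Definition qy (eta : R) : R := \1_`[a, e] eta * theta (fun z => z) a e y0 eta.

Lemma weight_qx : weight qx.
Proof.
case/andP: ax0 => h1 h2; apply: weight_continuous; apply: within_continuousM.
  apply: theta_continuous => // y /andP[ay _]; apply: continuous_ln.
  exact: lt_le_trans ay.
by apply: continuous_subspaceT => y; exact: cvg_id.
Qed.

Lemma weight_qy : weight qy.
Proof.
case/andP: ay0 => h1 h2; apply: weight_continuous.
by apply: theta_continuous => // y _; exact: cvg_id.
Qed.

Let qx_in x : qx x != 0 -> a <= x <= e.
Proof. by rewrite /qx mulf_eq0 negb_or => /andP[/indic_cc_neq0]. Qed.
Let qy_in x : qy x != 0 -> a <= x <= e.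
Proof. by rewrite /qy mulf_eq0 negb_or => /andP[/indic_cc_neq0]. Qed.

Local Notation L h := (J qx (fun x => J qy (fun y => h x y))).

(** The boundary part of the Green identity: the value at [x0] of the solution of the homogeneous
    radial equation, affine in [ln], with the values of [W] at [a] and [1 - a]. [bdy] is the
    analogue in [y], with affine functions. *)
Definition bdx (eta t : R) : R :=
  ((ln e - ln x0) * W a eta t + (ln x0 - ln a) * W e eta t) / (ln e - ln a).
Definition bdy (xi t : R) : R :=
  ((e - y0) * W xi a t + (y0 - a) * W xi e t) / (e - a).

Definition zeps (t : R) : R := L (fun x y => W x y t).
(** In each summand the operator has consumed the Green function of its own variable, leaving a
    boundary term minus a point value, and the Green function of the other variable remains. *)
Definition eeps (t : R) : R :=
  J qy (fun y => bdx y t - W x0 y t) + J qx (fun x => bdy x t - W x y0 t).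

(** [wt] is continuous down to time 0, while the space derivatives are continuous only for positive
    times; hence the lower time [r] in [G1] and [G2]. *)
Let Wt := box a e a e 0 s wt.
Let G1 r := box a e a e r s (fun x y t => p2 x y t + x^-1 * p1 x y t).
Let G2 r := box a e a e r s q2.
Let dz t := L (fun x y => Wt x y t).

Let cWt : cb3 Wt.
Proof.
apply: (box_cb3 (A := Omega_init T)) (hs_wtc H); rewrite ?(ltW ae) ?(ltW s0)//.
move=> x y t /in01 h1 /in01 h2 /andP[t0 ts]; split; [split|]; rewrite /= in_itv//=.
by rewrite t0 (le_lt_trans ts)//; case/andP: sT.
Qed.

Let cG1 r : 0 < r -> r <= s -> cb3 (G1 r).
Proof.
move=> r0 rs.
apply: (box_cb3 (A := Omega_int T)); rewrite ?(ltW ae)//.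
  move=> x y t /in01 h1 /in01 h2 /andP[rt ts]; apply: Omega_intP => //.
  by rewrite (lt_le_trans r0 rt) (le_lt_trans ts)//; case/andP: sT.
have c1 := hs_p1c H; have c2 := hs_p2c H.
apply/subspace_continuousP => -[[x y] t] [[/= hx hy] ht].
apply: cvgD; first by move/subspace_continuousP: c2 => /(_ (x, y, t)); apply; split; [split|].
apply: cvgM; last by move/subspace_continuousP: c1 => /(_ (x, y, t)); apply; split; [split|].
move: hx; rewrite in_itv /= => /andP[x00 _].
apply: cvgV; first by rewrite gt_eqF.
apply: cvg_within_filter.
have cfst (U V : topologicalType) : continuous (@fst U V) by move=> [u v]; exact: cvg_fst.
exact: (@continuous_comp _ _ _ (@fst (R * R)%type R) (@fst R R) (x, y, t) (cfst _ _ _) (cfst _ _ _)).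
Qed.

Let cG2 r : 0 < r -> r <= s -> cb3 (G2 r).
Proof.
move=> r0 rs.
apply: (box_cb3 (A := Omega_int T)) (hs_q2c H); rewrite ?(ltW ae)//.
move=> x y t /in01 h1 /in01 h2 /andP[rt ts]; apply: Omega_intP => //.
by rewrite (lt_le_trans r0 rt) (le_lt_trans ts)//; case/andP: sT.
Qed.

Let ext_int x y t : a <= x <= e -> a <= y <= e -> 0 <= t <= s -> W x y t = Iab 0 t (Wt x y).
Proof.
move=> hx hy /andP[t0 ts]; have [_ _ _ cW] := ext_cb3; have [_ _ _ cwt] := cWt.
case/andP: sT => _ sT'.
have W0 : W x y 0 = 0.
  rewrite ext_id; [apply: (hs_init H); exact: in01W|exact: in01W|exact: in01W|].
  by rewrite lexx ltW.
move: t0; rewrite le_eqVlt => /predU1P[<-|t0]; first by rewrite Iab_pt.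
rewrite (_ : W x y t = W x y t - W x y 0); last by rewrite W0 subr0.
symmetry; apply: Iab_FTC => //; try exact: continuous_subspaceT.
move=> u /andP[u0 ut]; have us : u < s := lt_le_trans ut ts.
have uT : u < T := lt_trans us sT'.
rewrite /Wt box_id//; last by rewrite !ltW.
apply: (near_eq_is_derive _ (hs_wt H (Omega_intP (in01 hx) (in01 hy) _))); last by rewrite u0.
near=> v; rewrite ext_id; [by []|exact: in01W|exact: in01W|].
by apply/andP; split; apply: ltW; near: v; [exact: lt_nbhsr|exact: lt_nbhsl].
Unshelve. all: by end_near. Qed.

(** The zero initial value makes [W] the primitive of [Wt]. Thus [zeps] vanishes at 0 and has the
    bounded continuous derivative [dz], as [conv_pos] requires. *)
Let zeps_int t : 0 <= t <= s -> zeps t = Iab 0 t dz.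
Proof.
move=> ts; rewrite /zeps (@J_ext _ qx _ (fun x => J qy (fun y => J \1_`[0, t] (Wt x y)))).
  exact: (J_rot weight_qx weight_qy (weight_cc 0 t) (cb3_mbd cWt)).
move=> x /qx_in hx; apply: J_ext => y /qy_in hy; exact: ext_int.
Qed.

Let Y t := c * J (ker b t) dz.

Let YE t : Y t = L (fun x y => c * J (ker b t) (Wt x y)).
Proof.
have wk := weight_ker b01 t.
have mW := cb3_mbd cWt.
have mA : mbd (fun p : RT * RT => J (ker b t) (fun t => Wt p.1 p.2 t)) := mbd3_J3 mW wk.
rewrite /Y /dz -(J_rot weight_qx weight_qy wk mW).
rewrite -JZ; [|exact: weight_qx|].
  apply: J_ext => x _; rewrite -JZ//; first exact: weight_qy.
  exact: (@mbd_sec1 _ _ RT _ RT _ x mA).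
exact: (@mbd_J _ _ RT (fun p => J (ker b t) (fun t => Wt p.1 p.2 t)) qy mA weight_qy).
Qed.

Let Fl (x y t : R) := (p2 x y t + x^-1 * p1 x y t) + q2 x y t.

Let time_xy x y t : a <= x <= e -> a <= y <= e -> 0 < t < T ->
  weight (fun z => \1_`]0, t[ z * Fl x y z) /\
  c * J (ker b t) (wt x y) = J (\1_`]0, t[) (Fl x y).
Proof.
move=> hx' hy' tT; have hx := in01 hx'; have hy := in01 hy'.
apply: (@time_identity R b b01 T c (wt x y) (g x y) (Fl x y)) => //.
- have [_ _ _ cw] := cWt.
  have W0 : Wt x y 0 = 0.
    rewrite /Wt box_id//; last by rewrite lexx ltW.
    exact: (hs_wt0 H).
  have E : {near 0^'+, Wt x y =1 wt x y}.
    near=> u; rewrite /Wt box_id//.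
    by apply/andP; split; near: u; [exact: nbhs_right_ge|exact: nbhs_right_le].
  rewrite -[X in _ --> X]W0; apply: (cvg_trans (near_eq_cvg E)).
  by apply: cvg_at_right_filter; exact: cw.
- by move=> u uT; apply: (hs_wtt H); exact: Omega_intP.
- by move=> u uT; apply: (hs_ig H); exact: Omega_intP.
- by move=> u uT; rewrite (hs_eq H)//; exact: Omega_intP.
Unshelve. all: by end_near. Qed.

(** Increments over [[r, t]] with [0 < r] keep to times where the right-hand side is bounded
    uniformly in [x] and [y]; the exchange of time and space integrals in [Y_incr] rests on that
    bound. *)
Let incr_xy x y r t : a <= x <= e -> a <= y <= e -> 0 < r -> r < t -> t < s ->
  c * J (ker b t) (Wt x y) - c * J (ker b r) (Wt x y) =
  Iab r t (fun u => G1 r x y u + G2 r x y u).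
Proof.
move=> hx hy r0 rt ts; case/andP: sT => _ sT'.
have t0 := lt_trans r0 rt; have tT := lt_trans ts sT'; have rT := lt_trans rt tT.
have rs := lt_trans rt ts.
have kW u : u < s -> J (ker b u) (Wt x y) = J (ker b u) (wt x y).
  move=> us; apply: J_ext => z /ker_neq0 /andP[z0 zu].
  by rewrite /Wt box_id// !ltW// (lt_trans zu).
have [] := @time_xy x y t hx hy; first by rewrite t0.
have [] := @time_xy x y r hx hy; first by rewrite r0.
rewrite (kW t ts) (kW r rs) => _ -> wt_ ->.
have mD : measurable (`]0, t[ : set RT) by exact: measurable_itv.
have iF : mu.-integrable `]0, t[ (EFin \o Fl x y).
  apply/integrable_mkcond => //; apply: eq_integrable wt_ => // z _; rewrite /= patchE indicE.
  by case: (z \in _); rewrite ?mul1r ?mul0r.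
rewrite !J_indicE [X in _ - X]Rintegral_itv_bndo_bndc; last first.
  apply: (integrableS mD (measurable_itv _) _ iF).
  by apply: subset_itvl; rewrite bnd_simp ltW.
rewrite Rintegral_itvB//; [|by rewrite bnd_simp ltW..].
rewrite -J_indicE.
have [[C1 hC1] _ _ ct1] := cG1 r0 (ltW rs).
have [[C2 hC2] _ _ ct2] := cG2 r0 (ltW rs).
rewrite -J_oo_cc; last first.
  by apply: mbdD; apply: bcont_mbd => //; [exists C1|exists C2].
apply: J_ext => u /indic_neq0; rewrite /= in_itv /= => /andP[ru ut].
have ru' : r <= u <= s by rewrite (ltW ru) (ltW (lt_trans ut ts)).
by rewrite /G1 /G2 !box_id.
Qed.

Let JqxE f : J qx f = Iab a e (fun y => theta (@ln R) a e x0 y * (y * f y)).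
Proof. by apply: eq_Rintegral => y _; rewrite /qx !mulrA. Qed.

Let JqyE f : J qy f = Iab a e (fun y => theta (fun z => z) a e y0 y * f y).
Proof. by apply: eq_Rintegral => y _; rewrite /qy !mulrA. Qed.

Let near_ext_x x y u : a <= x <= e -> a <= y <= e -> 0 < u < T ->
  \forall v \near x, w v y u = W v y u.
Proof.
move=> /in01 /andP[x00 x1] hy /andP[u0 uT]; near=> v.
rewrite ext_id; [by []| |exact: in01W|by rewrite (ltW u0) (ltW uT)].
by apply/andP; split; apply: ltW; near: v; [exact: lt_nbhsr|exact: lt_nbhsl].
Unshelve. all: by end_near. Qed.

Let near_ext_y x y u : a <= x <= e -> a <= y <= e -> 0 < u < T ->
  \forall v \near y, w x v u = W x v u.
Proof.
move=> hx /in01 /andP[x00 x1] /andP[u0 uT]; near=> v.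
rewrite ext_id; [by []|exact: in01W| |by rewrite (ltW u0) (ltW uT)].
by apply/andP; split; apply: ltW; near: v; [exact: lt_nbhsr|exact: lt_nbhsl].
Unshelve. all: by end_near. Qed.

Let green_x r y u : 0 < r -> r <= u <= s -> a <= y <= e ->
  J qx (fun x => G1 r x y u) = bdx y u - W x0 y u.
Proof.
move=> r0 rus hy; case/andP: (rus) => ru us; case/andP: sT => _ sT'.
have uT : 0 < u < T by rewrite (lt_le_trans r0 ru) (le_lt_trans us).
case/andP: ax0 => ax xe.
have [_ cx _ _] := cG1 r0 (le_trans ru us).
rewrite JqxE.
apply: (@green R (@ln R) (fun y => y^-1) (fun x => W x y u) (fun x => x * p1 x y u)) => //.
- by rewrite ltr_ln ?posrE// (lt_trans a0 ae).
- by move=> x /in01 /andP[x00 _]; exact: is_derive1_ln.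
- move=> x hx; have /andP[x00 _] := in01 hx.
  rewrite mulrA mulVf ?gt_eqF// mul1r.
  apply: near_eq_is_derive (near_ext_x hx hy uT) (hs_p1 H _).
  by apply: Omega_intP => //; exact: in01.
- move=> x hx; have /andP[x00 _] := in01 hx.
  rewrite /G1 box_id//.
  have d1 : is_derive x 1 (fun s => p1 s y u) (p2 x y u).
    by apply: (hs_p2 H); apply: Omega_intP => //; exact: in01.
  by apply: is_derive_eq; rewrite /GRing.scale /= mulrDr mulrA mulfV ?gt_eqF//; ring.
- apply: continuous_subspaceT => x; apply: cvgM; first exact: cvg_id.
  exact: cx.
Qed.

Let green_y r x u : 0 < r -> r <= u <= s -> a <= x <= e ->
  J qy (fun y => G2 r x y u) = bdy x u - W x y0 u.
Proof.
move=> r0 rus hx; case/andP: (rus) => ru us; case/andP: sT => _ sT'.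
have uT : 0 < u < T by rewrite (lt_le_trans r0 ru) (le_lt_trans us).
case/andP: ay0 => ay ye.
have [_ _ cy _] := cG2 r0 (le_trans ru us).
rewrite JqyE.
apply: (@green R (fun z => z) (fun=> 1) (fun y => W x y u) (fun y => q1 x y u)) => //.
- move=> y hy; rewrite mul1r.
  apply: near_eq_is_derive (near_ext_y hx hy uT) (hs_q1 H _).
  by apply: Omega_intP => //; exact: in01.
- move=> y hy; rewrite /G2 box_id//.
  by apply: (hs_q2 H); apply: Omega_intP => //; exact: in01.
- by apply: continuous_subspaceT; exact: cy.
Qed.

Let L_G r u : 0 < r -> r <= u <= s ->
  L (fun x y => G1 r x y u + G2 r x y u) = eeps u.
Proof.
move=> r0 rus; have rs : r <= s by case/andP: rus; exact: le_trans.
have m1 := mbd3_t u (cb3_mbd (cG1 r0 rs)).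
have m2 := mbd3_t u (cb3_mbd (cG2 r0 rs)).
have mJ1 := @mbd_J _ _ RT _ qy m1 weight_qy.
have mJ2 := @mbd_J _ _ RT _ qy m2 weight_qy.
rewrite (@J_ext _ qx _ (fun x => J qy (fun y => G1 r x y u) + J qy (fun y => G2 r x y u))); last first.
  move=> x _; apply: JD; first exact: weight_qy.
    exact: (@mbd_sec1 _ _ RT _ RT _ x m1).
  exact: (@mbd_sec1 _ _ RT _ RT _ x m2).
rewrite JD//; last exact: weight_qx.
rewrite /eeps; congr (_ + _).
  have := @J_swap _ qx qy (fun p => G1 r p.1 p.2 u) weight_qx weight_qy m1.
  rewrite /= => ->; apply: J_ext => y /qy_in hy; exact: green_x.
by apply: J_ext => x /qx_in hx; exact: green_y.
Qed.

Let Y_incr r t : 0 < r -> r < t -> t < s -> Y t - Y r = Iab r t eeps.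
Proof.
move=> r0 rt ts.
have rs : r <= s by rewrite ltW// (lt_trans rt).
have mW := cb3_mbd cWt.
have mA u : mbd (fun p : RT * RT => c * J (ker b u) (fun t => Wt p.1 p.2 t)).
  by apply: mbdZ; exact: (mbd3_J3 mW (weight_ker b01 u)).
have mLA u := @mbd_J _ _ RT _ qy (mA u) weight_qy.
have mG : mbd3 (fun x y u => G1 r x y u + G2 r x y u).
  by apply: mbdD; apply: cb3_mbd; [exact: cG1|exact: cG2].
rewrite !YE -JB//; last exact: weight_qx.
rewrite (@J_ext _ qx _ (fun x => J qy (fun y => J \1_`[r, t] (fun u => G1 r x y u + G2 r x y u)))).
  rewrite (J_rot weight_qx weight_qy (weight_cc r t) mG).
  apply: Iab_ext => u /andP[ru ut]; apply: L_G => //.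
  by rewrite ru (le_trans ut (ltW ts)).
move=> x /qx_in hx; rewrite -JB; [|exact: weight_qy| |].
- by apply: J_ext => y /qy_in hy; exact: incr_xy.
- exact: (@mbd_sec1 _ _ RT _ RT _ x (mA t)).
- exact: (@mbd_sec1 _ _ RT _ RT _ x (mA r)).
Qed.

Lemma eeps_bcont : (exists C, forall t, `|eeps t| <= C) /\ continuous eeps.
Proof.
have [[C hC] cx cy ct] := ext_cb3.
have C0 : 0 <= C by apply: le_trans (hC 0 0 0).
pose K (k1 k2 k3 : R) := (`|k1| * C + `|k2| * C) * `|k3| + C.
have bnd (k1 k2 k3 x1 y1 t1 x2 y2 t2 x3 y3 t3 : R) :
    `|(k1 * W x1 y1 t1 + k2 * W x2 y2 t2) / k3 - W x3 y3 t3| <= K k1 k2 k3^-1.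
  apply: (le_trans (ler_normB _ _)); apply: lerD => //.
  rewrite normrM ler_wpM2r//; apply: (le_trans (ler_normD _ _)).
  by rewrite !normrM; apply: lerD; rewrite ler_wpM2l.
have cx1 t : continuous (fun y => bdx y t - W x0 y t).
  move=> y; apply: cvgB; last exact: cy.
  apply: cvgM; last exact: cvg_cst.
  by apply: cvgD; apply: cvgM; (try exact: cvg_cst); exact: cy.
have ct1 y : continuous (fun t => bdx y t - W x0 y t).
  move=> t; apply: cvgB; last exact: ct.
  apply: cvgM; last exact: cvg_cst.
  by apply: cvgD; apply: cvgM; (try exact: cvg_cst); exact: ct.
have cx2 t : continuous (fun x => bdy x t - W x y0 t).
  move=> x; apply: cvgB; last exact: cx.
  apply: cvgM; last exact: cvg_cst.
  by apply: cvgD; apply: cvgM; (try exact: cvg_cst); exact: cx.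
have ct2 x : continuous (fun t => bdy x t - W x y0 t).
  move=> t; apply: cvgB; last exact: ct.
  apply: cvgM; last exact: cvg_cst.
  by apply: cvgD; apply: cvgM; (try exact: cvg_cst); exact: ct.
have [[C1 h1] c1] := @cb2_J R (fun y t => bdx y t - W x0 y t) qy _
  (fun y t => bnd _ _ _ _ _ _ _ _ _ _ _ _) cx1 ct1 weight_qy.
have [[C2 h2] c2] := @cb2_J R (fun x t => bdy x t - W x y0 t) qx _
  (fun y t => bnd _ _ _ _ _ _ _ _ _ _ _ _) cx2 ct2 weight_qx.
split; last by move=> t; apply: cvgD; [exact: c1|exact: c2].
by exists (C1 + C2) => t; rewrite (le_trans (ler_normD _ _))// lerD.
Qed.

(** By [Y_incr] the difference between [Y] and the primitive of [eeps] is constant. At time [r] it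
    is at most [Psi r], since [dz] and [eeps] are bounded and the kernel has mass
    [r^(1 - b) / (1 - b)]; letting [r] tend to 0 gives 0. *)
Let Y_int t : 0 < t < s -> Y t = Iab 0 t eeps.
Proof.
move=> /andP[t0 ts].
have [[C hC] ce] := eeps_bcont.
have [[D hD] cdz] := cb3_JJ cWt weight_qx weight_qy.
have mdz : @mbd R _ RT dz by apply: bcont_mbd => //; exists D.
have me : @mbd R _ RT eeps by apply: bcont_mbd => //; exists C.
have D0 : 0 <= D by apply: le_trans (hD 0).
have C0 : 0 <= C by apply: le_trans (hC 0).
pose Psi r := c * (D * ((Num.max r 0) `^ (1 - b) / (1 - b))) + C * r.
have cPsi : continuous Psi.
  move=> r; apply: cvgD; last by apply: cvgM; [exact: cvg_cst|exact: cvg_id].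
  apply: cvgM; first exact: cvg_cst.
  apply: cvgM; first exact: cvg_cst.
  apply: cvgM; last exact: cvg_cst.
  exact: max_powR_continuous.
have Psi0 : Psi 0 = 0.
  by rewrite /Psi maxxx powR0 ?gt_eqF// mul0r !mulr0 addr0.
have bnd r : 0 < r -> r < t -> `|Y t - Iab 0 t eeps| <= Psi r.
  move=> r0 rt.
  have -> : Y t - Iab 0 t eeps = Y r - Iab 0 r eeps.
    have := Y_incr r0 rt ts; rewrite -(Iab_sub (ltW r0) (ltW rt) ce) => E.
    exact: subr_exchange E.
  apply: (le_trans (ler_normB _ _)); apply: lerD; last first.
    have := @Iab_norm_le _ 0 r C eeps (ltW r0) me (fun x _ => hC x).
    by rewrite subr0.
  rewrite /Y normrM (ger0_norm c0) ler_wpM2l//.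
  apply: (le_trans (J_norm (weight_ker b01 r) mdz (fun x _ => hD x))).
  rewrite (_ : (fun x => `|ker b r x|) = ker b r); last first.
    by apply/funext => x; rewrite ger0_norm// ker_ge0.
  by rewrite (J_ker_cst b01 1 r0) mul1r (max_idPl (ltW r0)).
apply/eqP; rewrite -subr_eq0 -normr_le0 leNgt; apply/negP => pos.
have /cvgrPdist_lt/(_ _ pos) := cPsi 0; rewrite Psi0 => /nbhs_ballP[d /= d0 dP].
pose r := Num.min (d / 2) (t / 2).
have r0 : 0 < r by rewrite /r lt_min !divr_gt0.
have rt : r < t.
  by rewrite /r gt_min [X in _ || X]ltr_pdivrMr// ltr_pMr// ltr1n orbT.
have rd : r < d.
  by rewrite /r gt_min ltr_pdivrMr// ltr_pMr// ltr1n.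
have : `|0 - Psi r| < `|Y t - Iab 0 t eeps|.
  by apply: dP; rewrite /ball /= sub0r normrN gtr0_norm.
rewrite sub0r normrN => Pl.
have := le_lt_trans (ler_norm _) Pl.
by rewrite ltNge bnd.
Qed.

(** [conv_pos] multiplied by [c], with [c (k * dz)] replaced by the primitive of [eeps]. *)
Lemma eps_ineq : 0 <= J (\1_`]0, s[) (fun t => zeps t * prim s eeps t).
Proof.
have [[D hD] cdz] := cb3_JJ cWt weight_qx weight_qy.
have mdz : @mbd R _ RT dz by apply: bcont_mbd => //; exists D.
have := @conv_pos R b b01 dz D s cdz hD s0.
move=> /(mulr_ge0 c0); rewrite -JZ; [|exact: weight_oo|].
  congr (0 <= _); apply: J_ext => t /indic_neq0; rewrite /= in_itv /= => /andP[t0 ts].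
  have tt : 0 <= t <= s by rewrite (ltW t0) (ltW ts).
  rewrite indicE mem_setE in_itv /= t0 ts mul1r mulrCA.
  transitivity (zeps t * Y t); first by rewrite (zeps_int tt) (primE dz tt).
  by rewrite Y_int ?t0// (primE eeps tt).
by apply: mbdM; [exact: mbd_prim1|exact: mbd_conv].
Qed.

End Eps.

(* The limits as [a --> 0] of [theta ln a (1 - a) x xi * xi] and
   [theta id a (1 - a) y eta]. *)
Definition kx (R : realType) (x xi : R) : R :=
  - ln (Num.max (clamp 0 1 x) (clamp 0 1 xi)) * clamp 0 1 xi.

Definition ky (R : realType) (y eta : R) : R :=
  Num.min (clamp 0 1 y) (clamp 0 1 eta) * (1 - Num.max (clamp 0 1 y) (clamp 0 1 eta)).

(** * Bounds and measurability of the limit kernels *)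

Section Kernels.
Context (R : realType).
Local Notation RT := (measurableTypeR R).
Local Notation mu := (@lebesgue_measure R).
Local Notation J1 := (J (\1_`[0, 1] : R -> R)).

Lemma clamp01 (x : R) : 0 <= clamp 0 1 x <= 1.
Proof. exact: clamp_in. Qed.

Lemma measurable_clamp (lo hi : R) : measurable_fun [set: RT] (clamp lo hi).
Proof. apply: continuous_mfun; exact: clamp_continuous. Qed.

Lemma mln_le_inv (m : R) : 0 < m -> - ln m <= m^-1.
Proof. by move=> m0; rewrite -lnV ?posrE// ltW// ln_sublinear// invr_gt0. Qed.

(** The factor [xi] is at most the maximum [m] inside the logarithm, and [- m * ln m <= 1]
    compensates the singularity at 0. At [xi = 0] the product is 0 whatever the default value of
    [ln]. *)
Lemma kx_ge0_le1 (x xi : R) : 0 <= kx x xi <= 1.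
Proof.
rewrite /kx; have /andP[x0 x1] := clamp01 x; have /andP[xi0 xi1] := clamp01 xi.
set m := Num.max _ _.
have m1 : m <= 1 by rewrite /m ge_max x1.
have xim : clamp 0 1 xi <= m by rewrite /m le_max lexx orbT.
move: xi0; rewrite le_eqVlt => /predU1P[<-|xi0]; first by rewrite mulr0 lexx ler01.
have m0 : 0 < m by exact: lt_le_trans xim.
have lm : 0 <= - ln m by rewrite oppr_ge0 ln_le0.
rewrite mulr_ge0 ?(ltW xi0)//=.
apply: (@le_trans _ _ (m^-1 * m)); last by rewrite mulVf ?gt_eqF.
by apply: ler_pM => //; [exact: ltW|exact: mln_le_inv].
Qed.

Lemma ky_ge0_le1 (y eta : R) : 0 <= ky y eta <= 1.
Proof.
rewrite /ky; have /andP[x0 x1] := clamp01 y; have /andP[xi0 xi1] := clamp01 eta.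
have m0 : 0 <= Num.min (clamp 0 1 y) (clamp 0 1 eta) by rewrite le_min x0.
have m1 : Num.min (clamp 0 1 y) (clamp 0 1 eta) <= 1 by rewrite ge_min x1.
have M0 : 0 <= Num.max (clamp 0 1 y) (clamp 0 1 eta) by rewrite le_max x0.
have M1 : Num.max (clamp 0 1 y) (clamp 0 1 eta) <= 1 by rewrite ge_max x1.
rewrite mulr_ge0 ?subr_ge0//= -[leRHS]mulr1; apply: ler_pM; rewrite ?subr_ge0//.
by rewrite gerBl.
Qed.

Lemma measurable_clamp1 : measurable_fun [set: RT * RT] (fun p : RT * RT => clamp 0 1 p.1 : R).
Proof. by apply: (measurableT_comp (measurable_clamp 0 1)). Qed.

Lemma measurable_clamp2 : measurable_fun [set: RT * RT] (fun p : RT * RT => clamp 0 1 p.2 : R).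
Proof. by apply: (measurableT_comp (measurable_clamp 0 1)). Qed.

Lemma mbd_kx : mbd (fun p : RT * RT => kx p.1 p.2).
Proof.
split; last first.
  by exists 1 => p; have /andP[? ?] := kx_ge0_le1 p.1 p.2; rewrite ger0_norm.
apply: measurable_funM; last exact: measurable_clamp2.
apply: measurableT_comp => //.
apply: (measurableT_comp (@measurable_ln R)).
by apply: measurable_maxr; [exact: measurable_clamp1|exact: measurable_clamp2].
Qed.

Lemma mbd_ky : mbd (fun p : RT * RT => ky p.1 p.2).
Proof.
split; last first.
  by exists 1 => p; have /andP[? ?] := ky_ge0_le1 p.1 p.2; rewrite ger0_norm.
apply: measurable_funM.
  by apply: measurable_minr; [exact: measurable_clamp1|exact: measurable_clamp2].
apply: measurable_funB; first exact: measurable_cst.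
by apply: measurable_maxr; [exact: measurable_clamp1|exact: measurable_clamp2].
Qed.

Lemma ky_continuous (eta : R) : continuous (fun y => ky y eta).
Proof.
move=> y; apply: cvgM.
  by apply: (@continuous_min _ _ (clamp 0 1) (fun=> clamp 0 1 eta));
    [exact: clamp_continuous|exact: cvg_cst].
apply: cvgB; first exact: cvg_cst.
by apply: (@continuous_max _ _ (clamp 0 1) (fun=> clamp 0 1 eta));
  [exact: clamp_continuous|exact: cvg_cst].
Qed.

Lemma J1_norm (f : R -> R) C : @mbd R _ RT f -> (forall x, 0 <= x <= 1 -> `|f x| <= C) ->
  `|J1 f| <= C.
Proof.
move=> mf hC; have := @Iab_norm_le R 0 1 C f ler01 mf hC.
by rewrite subr0 mulr1.
Qed.

End Kernels.

(** * Exhausting the square *)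

Section Limit.
Context (R : realType).
Local Notation RT := (measurableTypeR R).
Local Notation mu := (@lebesgue_measure R).
Local Notation J1 := (J (\1_`[0, 1] : R -> R)).
Variables (b c T : R) (w p1 p2 q1 q2 wt g : R -> R -> R -> R).
Hypothesis b01 : 0 < b < 1.
Hypothesis c0 : 0 <= c.
Hypothesis T0 : 0 < T.
Hypothesis H : hom_solution b c T w p1 p2 q1 q2 wt g.
Local Notation W := (ext T w).

Lemma ext_x1 y t : W 1 y t = 0.
Proof.
rewrite /ext /box [clamp 0 1 1]clamp_id ?ler01 ?lexx//.
by apply: (hs_x1 H); apply: clamp_in => //; exact: ltW.
Qed.

Lemma ext_y0 x t : W x 0 t = 0.
Proof.
rewrite /ext /box [clamp 0 1 0]clamp_id ?ler01 ?lexx//.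
by apply: (hs_y0 H); apply: clamp_in => //; exact: ltW.
Qed.

Lemma ext_y1 x t : W x 1 t = 0.
Proof.
rewrite /ext /box [clamp 0 1 1]clamp_id ?ler01 ?lexx//.
by apply: (hs_y1 H); apply: clamp_in => //; exact: ltW.
Qed.

Definition Nx (f : R -> R) (x : R) : R := J1 (fun xi => kx x xi * f xi).
Definition Ny (f : R -> R) (y : R) : R := J1 (fun eta => ky y eta * f eta).
Definition zLim (x y t : R) : R := Nx (fun xi => Ny (fun eta => W xi eta t) y) x.
Definition eLim (x y t : R) : R :=
  - (Ny (fun eta => W x eta t) y + Nx (fun xi => W xi y t) x).

Variables (x0 y0 s : R).
Hypothesis hx : 0 < x0 < 1.
Hypothesis hy : 0 < y0 < 1.
Hypothesis sT : 0 < s < T.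
Let s0 : 0 < s. Proof. by case/andP: sT. Qed.

Let d := Num.min (Num.min x0 (1 - x0)) (Num.min y0 (1 - y0)).
Let d0 : 0 < d.
Proof.
by case/andP: hx => h1 h2; case/andP: hy => h3 h4; rewrite /d !lt_min h1 h3 !subr_gt0 h2.
Qed.
(** [d] is the distance from [x0] and [y0] to the ends of [[0, 1]]; the denominator starts at 2 so
    that both points lie strictly inside []a n, 1 - a n[] for every [n]. *)
Let a (n : nat) : R := d / n.+2%:R.
Let e (n : nat) : R := 1 - a n.
Let a0 n : 0 < a n. Proof. by rewrite /a divr_gt0. Qed.
Let ad n : a n <= d / 2.
Proof. by rewrite /a ler_pM2l// lef_pV2 ?posrE// ler_nat. Qed.
Let d12 : d <= 1 / 2.
Proof.
rewrite ler_pdivlMr// mulr_natr mulr2n.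
have h1 : d <= x0 by rewrite /d !ge_min lexx.
have h2 : d <= 1 - x0 by rewrite /d !ge_min lexx !orbT.
by lra.
Qed.
Let alt n : a n < d.
Proof. by rewrite (le_lt_trans (ad n))// ltr_pdivrMr// ltr_pMr// ltr1n. Qed.
Let ax n : a n < x0 < e n.
Proof.
have h1 : d <= x0 by rewrite /d !ge_min lexx.
have h2 : d <= 1 - x0 by rewrite /d !ge_min lexx !orbT.
have h3 := alt n; rewrite /e (lt_le_trans h3 h1) /=.
by rewrite ltrBrDl -ltrBrDr (lt_le_trans h3 h2).
Qed.
Let ay n : a n < y0 < e n.
Proof.
have h1 : d <= y0 by rewrite /d !ge_min lexx !orbT.
have h2 : d <= 1 - y0 by rewrite /d !ge_min lexx !orbT.
have h3 := alt n; rewrite /e (lt_le_trans h3 h1) /=.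
by rewrite ltrBrDl -ltrBrDr (lt_le_trans h3 h2).
Qed.
Let e12 n : 1 / 2 <= e n.
Proof. by have := ltW (alt n); have := d12; rewrite /e; lra. Qed.
Let e0 n : 0 < e n. Proof. by apply: lt_le_trans (e12 n). Qed.
Let e1 n : e n < 1. Proof. by rewrite /e gtrBl. Qed.
Let ae n : a n < e n. Proof. by have /andP[h1 h2] := ax n; exact: lt_trans h2. Qed.

Let acvg : a n @[n --> \oo] --> (0 : R).
Proof.
apply/cvgrPdist_le => r r0; near=> n.
rewrite sub0r normrN gtr0_norm// ler_pdivrMr// mulrC -ler_pdivrMr//.
apply: (@le_trans _ _ n%:R); first by near: n; exact: nbhs_infty_ger.
by rewrite ler_nat -addn2 leq_addr.
Unshelve. all: by end_near. Qed.

Let ecvg : e n @[n --> \oo] --> (1 : R).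
Proof. by rewrite -[X in _ --> X]subr0; apply: cvgB => //; exact: cvg_cst. Qed.

Let lecvg : ln (e n) @[n --> \oo] --> (0 : R).
Proof.
rewrite -[X in _ --> X](@ln1 R); apply: (cvg_comp e (@ln R) ecvg).
exact: continuous_ln.
Qed.

Let Dn n := (ln (e n) - ln (a n))^-1.
Let lae n : ln (a n) < ln (e n).
Proof. by rewrite ltr_ln ?posrE. Qed.
Let Dn0 n : 0 < Dn n. Proof. by rewrite /Dn invr_gt0 subr_gt0. Qed.

(** This divergence of [- ln (a n)] is what removes the endpoint [x = 0]: the boundary value at
    [a n] carries a weight proportional to [Dn n]. *)
Let Dcvg : Dn n @[n --> \oo] --> (0 : R).
Proof.
apply/cvgrPdist_le => r r0.
(* As [e n >= 1 / 2], a value [a n] below this threshold satisfies [ln (a n) + r^-1 < ln (e n)]. *)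
have p0 : 0 < 1 / 2 * expR (- r^-1) by rewrite mulr_gt0// expR_gt0.
move/cvgrPdist_lt: acvg => /(_ _ p0); apply: filterS => n.
rewrite !sub0r !normrN (gtr0_norm (a0 n)) (gtr0_norm (Dn0 n)) => an.
rewrite /Dn -[leRHS]invrK lef_pV2 ?posrE ?invr_gt0 ?subr_gt0//.
rewrite lerBrDl -lerBrDr.
apply: ltW; rewrite -ltr_expR lnK ?posrE//; apply: (lt_le_trans an).
by rewrite expRD lnK ?posrE// ler_wpM2r// expR_ge0.
Qed.

Let kxn n xi := \1_`[a n, e n] xi * (theta (@ln R) (a n) (e n) x0 xi * xi).
Let kyn n eta := \1_`[a n, e n] eta * theta (fun z => z) (a n) (e n) y0 eta.

Let min_measurable (u : R) : measurable_fun [set: RT] (fun z : RT => Num.min u z).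
Proof. by apply: measurable_minr => //; exact: measurable_cst. Qed.
Let max_measurable (u : R) : measurable_fun [set: RT] (fun z : RT => Num.max u z).
Proof. by apply: measurable_maxr => //; exact: measurable_cst. Qed.

Let theta_measurable (P : R -> R) u v z : measurable_fun [set: RT] P ->
  measurable_fun [set: RT] (theta P u v z).
Proof.
move=> mP; apply: measurable_funM; last exact: measurable_cst.
apply: measurable_funM; apply: measurable_funB; try exact: measurable_cst.
  exact: (measurableT_comp mP (min_measurable z)).
exact: (measurableT_comp mP (max_measurable z)).
Qed.

Let m_kxn n : measurable_fun [set: RT] (kxn n).
Proof.
apply: measurable_funM; first by apply: measurable_indic; exact: measurable_itv.
by apply: measurable_funM => //; apply: theta_measurable; exact: measurable_ln.
Qed.

Let m_kyn n : measurable_fun [set: RT] (kyn n).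
Proof.
apply: measurable_funM; first by apply: measurable_indic; exact: measurable_itv.
exact: theta_measurable.
Qed.

(** Writing [(ln min - ln a) * Dn] as [1 + (ln min - ln e) * Dn] eliminates the divergent
    [ln (a n)], so that the limit can be taken factor by factor. *)
Let thE n xi : a n <= xi <= e n -> theta (@ln R) (a n) (e n) x0 xi =
  (1 + (ln (Num.min x0 xi) - ln (e n)) * Dn n) * (ln (e n) - ln (Num.max x0 xi)).
Proof.
move=> _; rewrite /theta /Dn; field.
by rewrite gt_eqF// subr_gt0.
Qed.

Let Mx := - ln x0.
Let Mx0 : 0 <= Mx.
Proof. by case/andP: hx => h1 h2; rewrite /Mx oppr_ge0 ln_le0// ltW. Qed.

(** The dominating constant: the first factor of [theta] divided by [ln (e n) - ln (a n)] is at most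
    1, the second is at most [- ln x0], and [xi <= 1]. *)
Let kxn_bound n xi : `|kxn n xi| <= Mx.
Proof.
rewrite /kxn indicE mem_setE in_itv /=.
have [/andP[h1 h2]|_] := boolP (a n <= xi <= e n); last by rewrite mul0r normr0.
rewrite mul1r; case/andP: (ax n) => h3 h4.
have xi0 : 0 < xi := lt_le_trans (a0 n) h1.
have xi1 : xi <= 1 := le_trans h2 (ltW (e1 n)).
have x00 : 0 < x0 by case/andP: hx.
have mn0 : 0 < Num.min x0 xi by rewrite lt_min x00.
have mx0 : 0 < Num.max x0 xi by rewrite lt_max x00.
have u0 : 0 <= ln (Num.min x0 xi) - ln (a n).
  by rewrite subr_ge0 ler_ln ?posrE// le_min (ltW h3).
have u1 : ln (Num.min x0 xi) - ln (a n) <= ln (e n) - ln (a n).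
  by rewrite lerD2r ler_ln ?posrE// ge_min h2 orbT.
have v0 : 0 <= ln (e n) - ln (Num.max x0 xi).
  by rewrite subr_ge0 ler_ln ?posrE// ge_max h2 (ltW h4).
have v1 : ln (e n) - ln (Num.max x0 xi) <= Mx.
  rewrite /Mx -[leRHS]add0r; apply: lerD; first by rewrite ln_le0// ltW.
  by rewrite lerN2 ler_ln ?posrE// le_max lexx.
have th0 : 0 <= theta (@ln R) (a n) (e n) x0 xi.
  by rewrite /theta mulr_ge0 ?mulr_ge0// (ltW (Dn0 n)).
have th1 : theta (@ln R) (a n) (e n) x0 xi <= Mx.
  rewrite /theta mulrAC -[leRHS]mul1r; apply: ler_pM => //.
    by rewrite mulr_ge0// (ltW (Dn0 n)).
  by rewrite ler_pdivrMr ?subr_gt0// mul1r.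
rewrite ger0_norm; last by rewrite mulr_ge0// ltW.
by rewrite -[leRHS]mulr1; apply: ler_pM => //; exact: ltW.
Qed.

Let kyn_bound n eta : `|kyn n eta| <= 1.
Proof.
rewrite /kyn indicE mem_setE in_itv /=.
have [/andP[h1 h2]|_] := boolP (a n <= eta <= e n); last by rewrite mul0r normr0.
rewrite mul1r; case/andP: (ay n) => h3 h4.
have u0 : 0 <= Num.min y0 eta - a n by rewrite subr_ge0 le_min (ltW h3).
have u1 : Num.min y0 eta - a n <= e n - a n.
  by rewrite lerD2r ge_min h2 orbT.
have v0 : 0 <= e n - Num.max y0 eta by rewrite subr_ge0 ge_max h2 (ltW h4).
have y00 : 0 <= y0 by case/andP: hy => /ltW.
have v1 : e n - Num.max y0 eta <= 1.
  by rewrite lerBlDr (le_trans (ltW (e1 n)))// lerDl le_max y00.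
have ea : 0 < e n - a n by rewrite subr_gt0.
rewrite ger0_norm; last by rewrite /theta mulr_ge0 ?mulr_ge0// invr_ge0 ltW.
rewrite /theta mulrAC -[leRHS]mul1r; apply: ler_pM => //.
  by rewrite mulr_ge0// invr_ge0 ltW.
by rewrite ler_pdivrMr// mul1r.
Qed.

Let near_in xi : 0 < xi < 1 -> \forall n \near \oo, a n <= xi <= e n.
Proof.
move=> /andP[xi0 xi1].
have h : 0 < Num.min xi (1 - xi) by rewrite lt_min xi0 subr_gt0.
move/cvgrPdist_lt: acvg => /(_ _ h); apply: filterS => n.
rewrite sub0r normrN (gtr0_norm (a0 n)) lt_min => /andP[h1 h2].
by rewrite (ltW h1) /e lerBrDr -lerBrDl (ltW h2).
Qed.

Let ends xi n : 0 <= xi <= 1 -> ~~ (0 < xi < 1) -> (a n <= xi <= e n) = false.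
Proof.
move=> /andP[h1 h2]; rewrite negb_and -!leNgt => /orP[h|h]; apply/negP => /andP[h3 h4].
  by have := lt_le_trans (a0 n) (le_trans h3 h); rewrite ltxx.
by have := lt_le_trans (le_lt_trans h4 (e1 n)) h; rewrite ltxx.
Qed.

Let kxn_cvg xi : 0 <= xi <= 1 -> kxn n xi @[n --> \oo] --> kx x0 xi.
Proof.
move=> h01; have x00 : 0 < x0 by case/andP: hx.
have cx0 : clamp 0 1 x0 = x0 by rewrite clamp_id//; case/andP: hx => ? ?; rewrite !ltW.
have [h|h] := boolP (0 < xi < 1); last first.
  (* At 0 and 1 every [kxn n] vanishes, as neither point lies in [[a n, e n]]; the limit kernel has
     to vanish there too. *)
  have -> : kx x0 xi = 0.
    rewrite /kx cx0 (clamp_id h01); move: h; rewrite negb_and -!leNgt => /orP[h|h].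
      have -> : xi = 0 by apply/eqP; rewrite eq_le h; case/andP: h01.
      by rewrite mulr0.
    have -> : xi = 1 by apply/eqP; rewrite eq_le h; case/andP: h01 => _ ->.
    by rewrite (max_idPr _) ?ln1 ?oppr0 ?mul0r//; case/andP: hx => _ /ltW.
  apply: cvg_near_cst; near=> n.
  by rewrite /kxn indicE mem_setE in_itv /= (ends n h01 h) mul0r.
rewrite /kx cx0 (clamp_id h01).
apply: (@cvg_trans _ ((fun n => (1 + (ln (Num.min x0 xi) - ln (e n)) * Dn n) *
    (ln (e n) - ln (Num.max x0 xi)) * xi) @ \oo)).
  apply: near_eq_cvg; move: (near_in h); apply: filterS => n hn.
  by rewrite /kxn indicE mem_setE in_itv /= hn mul1r thE.
apply: cvgM; last exact: cvg_cst.
rewrite [X in _ --> X](_ : _ = (1 + (ln (Num.min x0 xi) - 0) * 0) * (0 - ln (Num.max x0 xi))); last first.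
  by rewrite mulr0 addr0 mul1r sub0r.
apply: cvgM.
  apply: cvgD; first exact: cvg_cst.
  by apply: cvgM; [apply: cvgB; [exact: cvg_cst|exact: lecvg]|exact: Dcvg].
by apply: cvgB; [exact: lecvg|exact: cvg_cst].
Unshelve. all: by end_near. Qed.

Let kyn_cvg eta : 0 <= eta <= 1 -> kyn n eta @[n --> \oo] --> ky y0 eta.
Proof.
move=> h01.
have cy0 : clamp 0 1 y0 = y0 by rewrite clamp_id//; case/andP: hy => ? ?; rewrite !ltW.
have [h|h] := boolP (0 < eta < 1); last first.
  have -> : ky y0 eta = 0.
    rewrite /ky cy0 (clamp_id h01); move: h; rewrite negb_and -!leNgt => /orP[h|h].
      have -> : eta = 0 by apply/eqP; rewrite eq_le h; case/andP: h01.
      by rewrite (min_idPr _) ?mul0r//; case/andP: hy => /ltW.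
    have -> : eta = 1 by apply/eqP; rewrite eq_le h; case/andP: h01 => _ ->.
    by rewrite (max_idPr _) ?subrr ?mulr0//; case/andP: hy => _ /ltW.
  apply: cvg_near_cst; near=> n.
  by rewrite /kyn indicE mem_setE in_itv /= (ends n h01 h) mul0r.
rewrite /ky cy0 (clamp_id h01).
apply: (@cvg_trans _ ((fun n => (Num.min y0 eta - a n) * (e n - Num.max y0 eta) *
    (e n - a n)^-1) @ \oo)).
  apply: near_eq_cvg; move: (near_in h); apply: filterS => n hn.
  by rewrite /kyn indicE mem_setE in_itv /= hn mul1r.
have -> : Num.min y0 eta * (1 - Num.max y0 eta) =
    (Num.min y0 eta - 0) * (1 - Num.max y0 eta) * (1 - 0)^-1.
  by rewrite !subr0 invr1 mulr1.
apply: cvgM; first by apply: cvgM; apply: cvgB => //; exact: cvg_cst.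
by apply: cvgV; [rewrite subr0 oner_eq0|apply: cvgB].
Unshelve. all: by end_near. Qed.

Let sub01 n xi : a n <= xi <= e n -> 0 <= xi <= 1.
Proof.
by move=> /andP[h1 h2]; rewrite (le_trans (ltW (a0 n)) h1) (le_trans h2 (ltW (e1 n))).
Qed.

Let JqxE n f : J (qx (a n) x0) f = J1 (fun xi => kxn n xi * f xi).
Proof.
apply: eq_Rintegral => xi _; rewrite /qx /kxn !indicE !mem_setE !in_itv /= -/(e n).
have [h|h] := boolP (a n <= xi <= e n); last by rewrite !(mul0r, mulr0).
by rewrite (sub01 h) !mul1r.
Qed.

Let JqyE n f : J (qy (a n) y0) f = J1 (fun eta => kyn n eta * f eta).
Proof.
apply: eq_Rintegral => xi _; rewrite /qy /kyn !indicE !mem_setE !in_itv /= -/(e n).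
have [h|h] := boolP (a n <= xi <= e n); last by rewrite !(mul0r, mulr0).
by rewrite (sub01 h) !mul1r.
Qed.

Let cW : cb3 W. Proof. exact: (ext_cb3 T0 H). Qed.
Let mW : mbd3 W. Proof. exact: cb3_mbd. Qed.

Let mbd_kxn n : @mbd R _ RT (kxn n). Proof. by split => //; exists Mx. Qed.
Let mbd_kyn n : @mbd R _ RT (kyn n). Proof. by split => //; exists 1. Qed.

Let J1_dct (f : nat -> R -> R) (h : R -> R) C : (forall n, measurable_fun [set: RT] (f n)) ->
  (forall n x, `|f n x| <= C) -> (forall x, 0 <= x <= 1 -> f n x @[n --> \oo] --> h x) ->
  J1 (f n) @[n --> \oo] --> J1 h.
Proof.
move=> mf fC fh; apply: (@J_dct R _ f h C (weight_cc 0 1)) => //.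
by move=> x /indic_cc_neq0; exact: fh.
Qed.

Let zn n t := zeps T w (a n) x0 y0 t.
Let en n t := eeps T w (a n) x0 y0 t.

Let znE n t : zn n t = J1 (fun xi => kxn n xi * J1 (fun eta => kyn n eta * W xi eta t)).
Proof. by rewrite /zn /zeps JqxE; apply: J_ext => xi _; rewrite JqyE. Qed.

Let inner_mbd n t : @mbd R _ RT (fun xi => J1 (fun eta => kyn n eta * W xi eta t)).
Proof.
apply: (@mbd_J R _ RT (fun p : RT * RT => kyn n p.2 * W p.1 p.2 t)); last exact: weight_cc.
apply: mbdM; last exact: (mbd3_t t mW).
exact: (mbd_comp (mbd_kyn n) measurable_snd).
Qed.

Let kW_mbd n xi t : @mbd R _ RT (fun eta => kyn n eta * W xi eta t).
Proof.
by apply: mbdM => //; exact: (@mbd_sec1 _ _ RT _ RT (fun p => W p.1 p.2 t) xi (mbd3_t t mW)).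
Qed.

Let W_bound : exists2 C, 0 <= C & forall x y t, `|W x y t| <= C.
Proof.
by have [[C hC] _ _ _] := cW; exists C => //; apply: le_trans (hC 0 0 0).
Qed.

Let zn_bound C : 0 <= C -> (forall x y t, `|W x y t| <= C) -> forall n t, `|zn n t| <= Mx * C.
Proof.
move=> C0 hC n t; rewrite znE; apply: J1_norm; first by apply: mbdM.
move=> xi _; rewrite normrM; apply: ler_pM => //.
apply: J1_norm => // eta _; rewrite normrM -[leRHS]mul1r.
by apply: ler_pM.
Qed.

Let zn_cvg t : zn n t @[n --> \oo] --> zLim x0 y0 t.
Proof.
have [C C0 hC] := W_bound.
rewrite (_ : (fun n => _) = (fun n => J1 (fun xi => kxn n xi * J1 (fun eta => kyn n eta * W xi eta t)))); last first.
  by apply/funext => n; rewrite znE.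
apply: (@J1_dct _ _ (Mx * C)).
- by move=> n; apply: measurable_funM => //; have [] := inner_mbd n t.
- move=> n xi; rewrite normrM; apply: ler_pM => //.
  apply: J1_norm => // eta _; rewrite normrM -[leRHS]mul1r.
  by apply: ler_pM.
move=> xi h; apply: cvgM; first exact: kxn_cvg.
apply: (@J1_dct _ _ C).
- by move=> n; have [] := kW_mbd n xi t.
- by move=> n eta; rewrite normrM -[leRHS]mul1r; apply: ler_pM.
- by move=> eta h'; apply: cvgM; [exact: kyn_cvg|exact: cvg_cst].
Qed.

Let bdxE n eta t : bdx T w (a n) x0 eta t =
  (ln (e n) - ln x0) * Dn n * W (a n) eta t + (1 + (ln x0 - ln (e n)) * Dn n) * W (e n) eta t.
Proof. by rewrite /bdx -/(e n) /Dn; field; rewrite gt_eqF// subr_gt0. Qed.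

Let bdx_bound C : (forall x y t, `|W x y t| <= C) -> 0 <= C ->
  forall n eta t, `|bdx T w (a n) x0 eta t| <= C + C.
Proof.
move=> hC C0 n eta t; case/andP: (ax n) => h3 h4.
have x00 : 0 < x0 by case/andP: hx.
have D1 : (ln (e n) - ln (a n)) * Dn n = 1 by rewrite /Dn mulfV// gt_eqF// subr_gt0.
have k1 : 0 <= (ln (e n) - ln x0) * Dn n.
  by rewrite mulr_ge0 ?subr_ge0 ?(ltW (Dn0 n))// ler_ln ?posrE// ltW.
have k2 : (ln (e n) - ln x0) * Dn n <= 1.
  by rewrite -D1 ler_pM2r// lerD2l lerN2 ler_ln ?posrE// ltW.
have E : 1 + (ln x0 - ln (e n)) * Dn n = 1 - (ln (e n) - ln x0) * Dn n.
  by rewrite -[ln x0 - _]opprB mulNr.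
rewrite bdxE E; apply: (le_trans (ler_normD _ _)).
rewrite !normrM; apply: lerD; rewrite -[leRHS]mul1r; apply: ler_pM => //.
  by rewrite -normrM ger0_norm.
by rewrite ger0_norm ?subr_ge0// gerBl.
Qed.

(** At the right end [W 1 = 0] by the Dirichlet condition. At the left end [W] stays bounded while
    its coefficient tends to 0 by [Dcvg], whatever the value at [x = 0]. In [bdy_cvg] both ends are
    Dirichlet. *)
Let bdx_cvg eta t : bdx T w (a n) x0 eta t @[n --> \oo] --> (0 : R).
Proof.
have [_ cx _ _] := cW.
rewrite (_ : (fun n => _) = (fun n => (ln (e n) - ln x0) * Dn n * W (a n) eta t +
  (1 + (ln x0 - ln (e n)) * Dn n) * W (e n) eta t)); last by apply/funext => n; rewrite bdxE.
rewrite [X in _ --> X](_ : _ = (0 - ln x0) * 0 * W 0 eta t + (1 + (ln x0 - 0) * 0) * W 1 eta t); last first.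
  by rewrite ext_x1 !mulr0 mul0r addr0.
apply: cvgD; apply: cvgM.
- by apply: cvgM; [apply: cvgB; [exact: lecvg|exact: cvg_cst]|exact: Dcvg].
- exact: (cvg_comp a (fun x => W x eta t) acvg (cx _ _ _)).
- apply: cvgD; first exact: cvg_cst.
  by apply: cvgM; [apply: cvgB; [exact: cvg_cst|exact: lecvg]|exact: Dcvg].
- exact: (cvg_comp e (fun x => W x eta t) ecvg (cx _ _ _)).
Qed.

Let bdy_bound C : (forall x y t, `|W x y t| <= C) -> 0 <= C ->
  forall n xi t, `|bdy T w (a n) y0 xi t| <= C + C.
Proof.
move=> hC C0 n xi t; case/andP: (ay n) => h3 h4.
have ea : 0 < e n - a n by rewrite subr_gt0.
rewrite /bdy -/(e n) normrM normfV (gtr0_norm ea) ler_pdivrMr//.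
apply: (le_trans (ler_normD _ _)); rewrite !normrM mulrDl; apply: lerD.
  rewrite mulrC; apply: ler_pM => //.
  by rewrite ger0_norm ?subr_ge0 ?(ltW h4)// lerD2l lerN2 ltW.
rewrite mulrC; apply: ler_pM => //.
by rewrite ger0_norm ?subr_ge0 ?(ltW h3)// lerD2r ltW.
Qed.

Let bdy_cvg xi t : bdy T w (a n) y0 xi t @[n --> \oo] --> (0 : R).
Proof.
have [_ _ cy _] := cW.
rewrite [X in _ --> X](_ : _ = ((1 - y0) * W xi 0 t + (y0 - 0) * W xi 1 t) * (1 - 0)^-1); last first.
  by rewrite ext_y1 ext_y0 !mulr0 addr0 mul0r.
rewrite /bdy; apply: cvgM; last first.
  by apply: cvgV; [rewrite subr0 oner_eq0|apply: cvgB].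
apply: cvgD; apply: cvgM.
- by apply: cvgB => //; exact: cvg_cst.
- exact: (cvg_comp a (fun y => W xi y t) acvg (cy _ _ _)).
- by apply: cvgB => //; exact: cvg_cst.
- exact: (cvg_comp e (fun y => W xi y t) ecvg (cy _ _ _)).
Qed.

Let bx_mbd n t : @mbd R _ RT (fun eta => bdx T w (a n) x0 eta t - W x0 eta t).
Proof.
have mw x : @mbd R _ RT (fun eta => W x eta t).
  exact: (@mbd_sec1 _ _ RT _ RT (fun p => W p.1 p.2 t) x (mbd3_t t mW)).
apply: mbdB => //; apply: mbdM; last exact: mbd_cst.
by apply: mbdD; exact: mbdZ.
Qed.

Let by_mbd n t : @mbd R _ RT (fun xi => bdy T w (a n) y0 xi t - W xi y0 t).
Proof.
have mw y : @mbd R _ RT (fun xi => W xi y t).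
  exact: (@mbd_sec2 _ _ RT _ RT (fun p => W p.1 p.2 t) y (mbd3_t t mW)).
apply: mbdB => //; apply: mbdM; last exact: mbd_cst.
by apply: mbdD; exact: mbdZ.
Qed.

Let enE n t : en n t = J1 (fun eta => kyn n eta * (bdx T w (a n) x0 eta t - W x0 eta t)) +
  J1 (fun xi => kxn n xi * (bdy T w (a n) y0 xi t - W xi y0 t)).
Proof. by rewrite /en /eeps JqxE JqyE. Qed.

Let b3 C : (forall x y t, `|W x y t| <= C) -> 0 <= C -> forall n eta t,
  `|kyn n eta * (bdx T w (a n) x0 eta t - W x0 eta t)| <= C + C + C.
Proof.
move=> hC C0 n eta t; rewrite normrM -[leRHS]mul1r; apply: ler_pM => //.
by apply: (le_trans (ler_normB _ _)); apply: lerD => //; exact: bdx_bound.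
Qed.

Let b4 C : (forall x y t, `|W x y t| <= C) -> 0 <= C -> forall n xi t,
  `|kxn n xi * (bdy T w (a n) y0 xi t - W xi y0 t)| <= Mx * (C + C + C).
Proof.
move=> hC C0 n xi t; rewrite normrM; apply: ler_pM => //.
by apply: (le_trans (ler_normB _ _)); apply: lerD => //; exact: bdy_bound.
Qed.

Let en_bound C : 0 <= C -> (forall x y t, `|W x y t| <= C) ->
  forall n t, `|en n t| <= (C + C + C) + Mx * (C + C + C).
Proof.
move=> C0 hC n t; rewrite enE; apply: (le_trans (ler_normD _ _)); apply: lerD.
  by apply: J1_norm; [exact: mbdM|move=> eta _; exact: b3].
by apply: J1_norm; [exact: mbdM|move=> eta _; exact: b4].
Qed.

Let en_cvg t : en n t @[n --> \oo] --> eLim x0 y0 t.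
Proof.
have [C C0 hC] := W_bound.
rewrite (_ : (fun n => _) = (fun n => J1 (fun eta => kyn n eta * (bdx T w (a n) x0 eta t - W x0 eta t)) +
  J1 (fun xi => kxn n xi * (bdy T w (a n) y0 xi t - W xi y0 t)))); last first.
  by apply/funext => n; rewrite enE.
have mw1 : @mbd R _ RT (fun eta => ky y0 eta * W x0 eta t).
  apply: mbdM; first exact: (@mbd_sec1 _ _ RT _ RT (fun p => ky p.1 p.2) y0 (@mbd_ky R)).
  exact: (@mbd_sec1 _ _ RT _ RT (fun p => W p.1 p.2 t) x0 (mbd3_t t mW)).
have mw2 : @mbd R _ RT (fun xi => kx x0 xi * W xi y0 t).
  apply: mbdM; first exact: (@mbd_sec1 _ _ RT _ RT (fun p => kx p.1 p.2) x0 (@mbd_kx R)).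
  exact: (@mbd_sec2 _ _ RT _ RT (fun p => W p.1 p.2 t) y0 (mbd3_t t mW)).
rewrite [X in _ --> X](_ : _ = J1 (fun eta => ky y0 eta * (0 - W x0 eta t)) +
   J1 (fun xi => kx x0 xi * (0 - W xi y0 t))); last first.
  rewrite /eLim opprD /Nx /Ny -!JN//; try exact: weight_cc.
  by congr (_ + _); apply: J_ext => z _; rewrite sub0r mulrN.
apply: cvgD.
- apply: (@J1_dct _ _ (C + C + C)).
  + by move=> n; apply: measurable_funM => //; have [] := bx_mbd n t.
  + by move=> n eta; exact: b3.
  + move=> eta h; apply: cvgM; first exact: kyn_cvg.
    by apply: cvgB; [exact: bdx_cvg|exact: cvg_cst].
- apply: (@J1_dct _ _ (Mx * (C + C + C))).
  + by move=> n; apply: measurable_funM => //; have [] := by_mbd n t.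
  + by move=> n eta; exact: b4.
  + move=> xi h; apply: cvgM; first exact: kxn_cvg.
    by apply: cvgB; [exact: bdy_cvg|exact: cvg_cst].
Qed.

(** Dominated convergence is used twice, inside [prim] and in the outer time integral, with bounds
    uniform in [n] that come from the kernels and from [W]. *)
Theorem limit_ineq : 0 <= J (\1_`]0, s[) (fun t => zLim x0 y0 t * prim s (eLim x0 y0) t).
Proof.
have [C C0 hC] := W_bound.
pose K := (C + C + C) + Mx * (C + C + C).
have K0 : 0 <= K by rewrite addr_ge0 ?mulr_ge0 ?addr_ge0.
have men n : @mbd R _ RT (en n).
  have [bd cn] := eeps_bcont T0 H (a0 n) (ax n) (ay n).
  exact: bcont_mbd.
have mzn n : @mbd R _ RT (zn n).
  have [bd cn] := cb3_JJ cW (weight_qx (a0 n) (ax n)) (weight_qy (ay n)).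
  exact: bcont_mbd.
have mle t : @mbd R _ RT (fun z : R => (z <= t)%R%:R : R).
  exact: (@mbd_sec1 R _ RT _ RT (fun p => (p.2 <= p.1)%R%:R : R) t (@mbd_le R)).
have pcvg t : prim s (en n) t @[n --> \oo] --> prim s (eLim x0 y0) t.
  apply: (@J_dct R _ (fun n z => (z <= t)%R%:R * en n z) _ K (weight_cc 0 s)).
  - by move=> n; have [] := mbdM (mle t) (men n).
  - move=> n z _; rewrite normrM -[leRHS]mul1r; apply: ler_pM => //.
      by rewrite normr_nat lern1 leq_b1.
    exact: en_bound.
  - by move=> z _; apply: cvgM; [exact: cvg_cst|exact: en_cvg].
have cv : J (\1_`]0, s[) (fun t => zn n t * prim s (en n) t) @[n --> \oo] -->
    J (\1_`]0, s[) (fun t => zLim x0 y0 t * prim s (eLim x0 y0) t).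
  apply: (@J_dct R _ (fun n t => zn n t * prim s (en n) t) _ (Mx * C * (K * s)) (weight_oo 0 s)).
  - by move=> n; have [] := mbdM (mzn n) (mbd_prim1 s (men n)).
  - move=> n t _; rewrite normrM; apply: ler_pM => //; first exact: zn_bound.
    rewrite -[s in leRHS]subr0; apply: Iab_norm_le; first exact: ltW.
      exact: mbdM.
    move=> z _; rewrite normrM -[leRHS]mul1r; apply: ler_pM => //.
      by rewrite normr_nat lern1 leq_b1.
    exact: en_bound.
  - by move=> t _; apply: cvgM; [exact: zn_cvg|exact: pcvg].
rewrite -(cvg_lim _ cv)//; apply: limr_ge; first exact: cvgP cv.
by apply: nearW => n; exact: (eps_ineq b01 c0 T0 H (a0 n) (ax n) (ay n) sT).
Qed.

End Limit.

(** * Energy forms *)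

Section Forms.
Context (R : realType).
Local Notation RT := (measurableTypeR R).
Local Notation mu := (@lebesgue_measure R).
Local Notation J1 := (J (\1_`[0, 1] : R -> R)).
Let w1 : weight (\1_`[0, 1] : R -> R) := weight_cc 0 1.

Definition qform (k : R -> R -> R) (f : R -> R) : R :=
  J1 (fun x => J1 (fun xi => k x xi * (f x * f xi))).

Lemma mbd_fst (f : R -> R) : @mbd R _ RT f -> mbd (fun p : RT * RT => f p.1).
Proof. by move=> mf; exact: (mbd_comp mf measurable_fst). Qed.

Lemma mbd_snd (f : R -> R) : @mbd R _ RT f -> mbd (fun p : RT * RT => f p.2).
Proof. by move=> mf; exact: (mbd_comp mf measurable_snd). Qed.

Let dbl (u v z : R) : u = v -> v = z -> u *+ 2 = v + z.
Proof. by move=> -> <-; rewrite mulr2n. Qed.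

(* By symmetry of [k], both sides are the integral over [x, xi] of [k] times
   [\int_0^s (h x * prim (h xi) + h xi * prim (h x))]. *)
Lemma form_energy (k : R -> R -> R) (h : R -> R -> R) (s : R) : 0 <= s ->
  mbd (fun p : RT * RT => k p.1 p.2) -> (forall x xi, k x xi = k xi x) ->
  mbd (fun p : RT * RT => h p.1 p.2) -> (forall x, continuous (h x)) ->
  J1 (fun x => J (\1_`]0, s[) (fun t => J1 (fun xi => k x xi * h xi t) * prim s (h x) t)) *+ 2 =
  qform k (fun x => Iab 0 s (h x)).
Proof.
move=> s0 mk ksym mh ch.
have wI : weight (\1_`]0, s[ : R -> R) := weight_oo 0 s.
have mhx x : @mbd R _ RT (h x) by exact: (@mbd_sec1 _ _ RT _ RT _ x mh).
have mht t : @mbd R _ RT (fun x => h x t) by exact: (@mbd_sec2 _ _ RT _ RT (fun p => h p.1 p.2) t mh).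
have mp : mbd (fun p : RT * RT => prim s (h p.1) p.2).
  exact: (@mbd_prim R _ RT (fun p => h p.1 p.2) s mh).
have mpx x : @mbd R _ RT (prim s (h x)) by exact: mbd_prim1.
pose m := fun p : RT * RT * RT => k p.1.1 p.1.2 * (h p.1.2 p.2 * prim s (h p.1.1) p.2).
have p1 : measurable_fun [set: RT * RT * RT] (fun p : RT * RT * RT => (p.1.1, p.2)).
  apply: measurable_fun_pair; last exact: measurable_snd.
  by apply: (measurableT_comp measurable_fst); exact: measurable_fst.
have p2 : measurable_fun [set: RT * RT * RT] (fun p : RT * RT * RT => (p.1.2, p.2)).
  apply: measurable_fun_pair; last exact: measurable_snd.
  by apply: (measurableT_comp measurable_snd); exact: measurable_fst.
have mm : mbd m.
  apply: mbdM; first exact: (mbd_comp mk measurable_fst).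
  by apply: mbdM; [exact: (mbd_comp mh p2)|exact: (mbd_comp mp p1)].
pose A x xi := J (\1_`]0, s[) (fun t => h xi t * prim s (h x) t).
have mA : mbd (fun p : RT * RT => k p.1 p.2 * A p.1 p.2).
  apply: mbdM => //; apply: (@mbd_J _ _ (RT * RT)%type
    (fun p : RT * RT * RT => h p.1.2 p.2 * prim s (h p.1.1) p.2)) => //.
  by apply: mbdM; [exact: (mbd_comp mh p2)|exact: (mbd_comp mp p1)].
have mA' : mbd (fun p : RT * RT => k p.1 p.2 * A p.2 p.1).
  apply: mbdM => //; apply: (@mbd_J _ _ (RT * RT)%type
    (fun p : RT * RT * RT => h p.1.1 p.2 * prim s (h p.1.2) p.2)) => //.
  by apply: mbdM; [exact: (mbd_comp mh p1)|exact: (mbd_comp mp p2)].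
have E1 : J1 (fun x => J (\1_`]0, s[) (fun t => J1 (fun xi => k x xi * h xi t) * prim s (h x) t)) =
    J1 (fun x => J1 (fun xi => k x xi * A x xi)).
  apply: J_ext => x _.
  transitivity (J (\1_`]0, s[) (fun t => J1 (fun xi => k x xi * (h xi t * prim s (h x) t)))).
    apply: J_ext => t _; rewrite mulrC -JZ//; last first.
      by apply: mbdM => //; exact: (@mbd_sec1 _ _ RT _ RT (fun p => k p.1 p.2) x mk).
    by apply: J_ext => xi _; rewrite mulrC mulrA.
  have := @J_swap R (\1_`[0, 1]) (\1_`]0, s[) (fun p => m (x, p.1, p.2)) w1 wI.
  rewrite /m /= => <-; last exact: (@mbd3_x R (fun x xi t => m (x, xi, t)) x mm).
  apply: J_ext => xi _; rewrite JZ//.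
  by apply: mbdM.
have E2 : J1 (fun x => J1 (fun xi => k x xi * A x xi)) =
    J1 (fun x => J1 (fun xi => k x xi * A xi x)).
  transitivity (J1 (fun xi => J1 (fun x => k x xi * A x xi))).
    exact: (J_swap w1 w1 mA).
  by apply: J_ext => x _; apply: J_ext => xi _; congr (_ * _); exact: ksym.
have mJ : @mbd R _ RT (fun x => J1 (fun xi => k x xi * A x xi)).
  exact: (@mbd_J _ _ RT (fun p => k p.1 p.2 * A p.1 p.2) _ mA w1).
have mJ' : @mbd R _ RT (fun x => J1 (fun xi => k x xi * A xi x)).
  exact: (@mbd_J _ _ RT (fun p => k p.1 p.2 * A p.2 p.1) _ mA' w1).
transitivity (J1 (fun x => J1 (fun xi => k x xi * A x xi)) +
              J1 (fun x => J1 (fun xi => k x xi * A xi x))).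
  exact: (dbl E1 E2).
rewrite -(JD w1 mJ mJ').
apply: J_ext => x _.
have s1 := @mbd_sec1 _ _ RT _ RT (fun p => k p.1 p.2 * A p.1 p.2) x mA.
have s2 := @mbd_sec1 _ _ RT _ RT (fun p => k p.1 p.2 * A p.2 p.1) x mA'.
rewrite -(JD w1 s1 s2).
apply: J_ext => xi _; rewrite -mulrDr; congr (_ * _).
rewrite /A !J_oo_cc; try by apply: mbdM.
by rewrite addrC Iab_mul_prim.
Qed.

(** A factorisation of the kernel through an auxiliary variable [r] turns the double integral into a
    single one in [r]. Allowing [phi] and [psi] to differ lets one factor absorb a weight in [r]
    without square roots. *)
Lemma form_features (phi psi k : R -> R -> R) (f : R -> R) :
  mbd (fun p : RT * RT => phi p.1 p.2) -> mbd (fun p : RT * RT => psi p.1 p.2) ->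
  (forall x xi, 0 <= x <= 1 -> 0 <= xi <= 1 -> k x xi = J1 (fun r => phi r x * psi r xi)) ->
  @mbd R _ RT f ->
  qform k f = J1 (fun r => J1 (fun x => phi r x * f x) * J1 (fun xi => psi r xi * f xi)).
Proof.
move=> mphi mpsi hk mf.
pose m x xi r := phi r x * f x * (psi r xi * f xi).
have p1 : measurable_fun [set: RT * RT * RT] (fun p : RT * RT * RT => (p.2, p.1.1)).
  apply: measurable_fun_pair; first exact: measurable_snd.
  by apply: (measurableT_comp measurable_fst); exact: measurable_fst.
have p2 : measurable_fun [set: RT * RT * RT] (fun p : RT * RT * RT => (p.2, p.1.2)).
  apply: measurable_fun_pair; first exact: measurable_snd.
  by apply: (measurableT_comp measurable_snd); exact: measurable_fst.
have m1 : mbd (fun p : RT * RT => phi p.1 p.2 * f p.2) by apply: mbdM => //; exact: mbd_snd.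
have m2 : mbd (fun p : RT * RT => psi p.1 p.2 * f p.2) by apply: mbdM => //; exact: mbd_snd.
have mm : mbd3 m.
  by apply: mbdM; [exact: (mbd_comp m1 p1)|exact: (mbd_comp m2 p2)].
have mx (q : RT * RT -> R) r : mbd q -> @mbd R _ RT (fun x => q (r, x)).
  by move=> mq; exact: (@mbd_sec1 _ _ RT _ RT q r mq).
have mr (q : RT * RT -> R) x : mbd q -> @mbd R _ RT (fun r => q (r, x)).
  by move=> mq; exact: (@mbd_sec2 _ _ RT _ RT q x mq).
transitivity (J1 (fun x => J1 (fun xi => J1 (fun r => m x xi r)))).
  apply: J_ext => x /indic_cc_neq0 hx; apply: J_ext => xi /indic_cc_neq0 hxi.
  rewrite hk// mulrC -JZ//; first by apply: J_ext => r _; rewrite /m; ring.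
  by apply: mbdM; [exact: (mr _ x mphi)|exact: (mr _ xi mpsi)].
rewrite J_rot//; apply: J_ext => r _.
transitivity (J1 (fun x => J1 (fun xi => psi r xi * f xi) * (phi r x * f x))).
  apply: J_ext => x _; rewrite mulrC -JZ//; exact: (mx _ r m2).
by rewrite JZ 1?mulrC//; exact: (mx _ r m1).
Qed.

(** The primitive from [a] is nonnegative and at most its value 0 at [b], hence constant; its
    derivative is [f]. *)
Lemma nneg_Iab0 (a b : R) (f : R -> R) : a < b -> continuous f -> 
  (forall x, a <= x <= b -> 0 <= f x) -> Iab a b f = 0 -> forall x, a < x < b -> f x = 0.
Proof.
move=> ab cf f0 I0.
have cw (u v : R) : {within `[u, v], continuous f} by exact: continuous_subspaceT.
have if_ (u v : R) : mu.-integrable `[u, v] (EFin \o f).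
  by apply: continuous_compact_integrable => //; exact: segment_compact.
have Z x : a <= x <= b -> Iab a x f = 0.
  move=> /andP[ax xb]; apply/eqP; rewrite eq_le; apply/andP; split; last first.
    rewrite IabE; apply: Rintegral_ge0 => z; rewrite /= in_itv /= => /andP[az zx].
    by apply: f0; rewrite az (le_trans zx xb).
  rewrite -I0 !IabE -subr_ge0 Rintegral_itvB//; [|by rewrite bnd_simp..].
  apply: Rintegral_ge0 => z; rewrite /= in_itv /= => /andP[xz zb].
  by apply: f0; rewrite (le_trans ax (ltW xz)) zb.
move=> x /andP[ax xb].
have d1 := Iab_is_derive cf ax.
have d2 : is_derive x 1 (Iab a ^~ f) 0.
  apply: (near_eq_is_derive _ (is_derive_cst (0 : R) x 1)).
  near=> z; rewrite Z//.
  by apply/andP; split; apply: ltW; near: z; [exact: lt_nbhsr|exact: lt_nbhsl].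
by case: d1 => _ <-; case: d2.
Unshelve. all: by end_near. Qed.

Lemma nneg_J1_0 (f : R -> R) : continuous f -> 
  (forall x, 0 <= x <= 1 -> 0 <= f x) -> J1 f = 0 -> forall x, 0 < x < 1 -> f x = 0.
Proof. by move=> cf f0 I0; apply: (nneg_Iab0 ltr01 cf f0). Qed.

Let mle1 : mbd (fun p : RT * RT => (p.1 <= p.2)%R%:R : R).
Proof.
apply: (mbd_comp (@mbd_le R) (h := fun p : RT * RT => (p.2, p.1))).
by apply: measurable_fun_pair; [exact: measurable_snd|exact: measurable_fst].
Qed.

Let mclamp : @mbd R _ RT (clamp 0 1).
Proof.
split; first exact: measurable_clamp.
by exists 1 => x; have /andP[h1 h2] := clamp01 x; rewrite ger0_norm.
Qed.

Lemma Iab_cst (a b c : R) : a <= b -> Iab a b (fun=> c) = c * (b - a).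
Proof.
rewrite le_eqVlt => /predU1P[<-|ab]; first by rewrite Iab_pt subrr mulr0.
transitivity (c * b - c * a); last by rewrite mulrBr.
apply: (Iab_FTC_cc (F := fun x => c * x)) => //.
  by apply: continuous_subspaceT => x; exact: cvg_cst.
by move=> x _; apply: is_derive_eq; rewrite /GRing.scale /= mulr1.
Qed.

Lemma J1_cut_ge (x : R) (f : R -> R) : 0 <= x <= 1 ->
  J1 (fun r => (r <= x)%R%:R * f r) = Iab 0 x f.
Proof.
move=> /andP[x0 x1]; apply: eq_Rintegral => r _; rewrite !indicE !mem_setE !in_itv /=.
case: (leP 0 r) => r0 /=; last by rewrite !mul0r.
case: (leP r x) => rx; last by rewrite /= !(mul0r, mulr0).
by rewrite (le_trans rx x1) !mul1r.
Qed.

Lemma J1_cut_le (x : R) (f : R -> R) : 0 <= x <= 1 ->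
  J1 (fun r => (x <= r)%R%:R * f r) = Iab x 1 f.
Proof.
move=> /andP[x0 x1]; apply: eq_Rintegral => r _; rewrite !indicE !mem_setE !in_itv /=.
case: (leP x r) => xr; last by rewrite /= !(mul0r, mulr0).
by rewrite (le_trans x0 xr) /= mul1r.
Qed.

(** For [r] other than [y] in []0, 1[], this is the derivative in [r] of the Green function
    [ky r y]. So [ky_features] is the energy identity of that function, and [qform ky f] is the
    Dirichlet energy of [Ny f]. *)
Definition psiy (r y : R) : R := (r <= clamp 0 1 y)%R%:R - clamp 0 1 y.

Lemma mbd_psiy : mbd (fun p : RT * RT => psiy p.1 p.2).
Proof.
apply: mbdB; last exact: mbd_snd.
apply: (mbd_comp mle1 (h := fun p : RT * RT => (p.1, clamp 0 1 p.2))).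
by apply: measurable_fun_pair; [exact: measurable_fst|exact: measurable_clamp2].
Qed.

Lemma ky_features y eta : 0 <= y <= 1 -> 0 <= eta <= 1 ->
  ky y eta = J1 (fun r => psiy r y * psiy r eta).
Proof.
move=> hy heta; rewrite /ky /psiy !clamp_id//.
have mc u : @mbd R _ RT (fun r : R => (r <= u)%R%:R).
  exact: (@mbd_sec2 _ _ RT _ RT (fun p => (p.1 <= p.2)%R%:R : R) u mle1).
have mc1 (c : R) : @mbd R _ RT (fun=> c) by exact: mbd_cst.
have Ec u : 0 <= u <= 1 -> J1 (fun r : R => (r <= u)%R%:R) = u.
  move=> hu; have := J1_cut_ge (fun=> 1) hu.
  rewrite Iab_cst; last by case/andP: hu.
  rewrite mul1r subr0 => {2}<-; apply: J_ext => r _; by rewrite mulr1.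
have mn : 0 <= Num.min y eta <= 1.
  by case/andP: hy => h1 h2; case/andP: heta => h3 h4; rewrite le_min h1 h3 ge_min h2.
transitivity (J1 (fun r : R => (r <= Num.min y eta)%R%:R) - eta * J1 (fun r : R => (r <= y)%R%:R)
   - y * J1 (fun r : R => (r <= eta)%R%:R) + J1 (fun=> y * eta)).
  have -> : J1 (fun=> y * eta) = y * eta.
    by have := Iab_cst (y * eta) (@ler01 R); rewrite subr0 mulr1.
  rewrite !Ec//.
  by case: (leP y eta) => h; ring.
have mB := mbdZ eta (mc y); have mC := mbdZ y (mc eta).
have mA := mc (Num.min y eta).
rewrite -(JZ eta w1 (mc y)) -(JZ y w1 (mc eta)) -(JB w1 mA mB).
rewrite -(JB w1 (mbdB mA mB) mC) -(JD w1 (mbdB (mbdB mA mB) mC) (mc1 _)).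
apply: J_ext => r _; rewrite le_min.
by case: (r <= y); case: (r <= eta); rewrite /= ?mulr0n ?mulr1n; ring.
Qed.

Lemma form_ky_ge0 f : @mbd R _ RT f -> 0 <= qform (@ky R) f.
Proof.
move=> mf; rewrite (form_features mbd_psiy mbd_psiy ky_features mf).
by apply: J_ge0 => [x|r _]; [exact: indic_ge0|rewrite -expr2 sqr_ge0].
Qed.

Lemma J1_split (x : R) (f : R -> R) : 0 <= x <= 1 -> continuous f ->
  Iab x 1 f = J1 f - Iab 0 x f.
Proof. by move=> /andP[x0 x1] cf; rewrite -(Iab_sub x0 x1 cf). Qed.

(** The form is [\int Psi^2], with [Psi] equal to minus the primitive of [f] up to a constant. [Psi]
    is continuous, so it vanishes on []0, 1[], and differentiating gives [f = 0]. *)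
Lemma form_ky_eq0 f : @mbd R _ RT f -> continuous f -> qform (@ky R) f = 0 ->
  forall y, 0 < y < 1 -> f y = 0.
Proof.
move=> mf cf; rewrite (form_features mbd_psiy mbd_psiy ky_features mf) => J0.
pose c := J1 (fun y => clamp 0 1 y * f y).
pose Psi r := J1 f - Iab 0 (clamp 0 1 r) f - c.
have E r : 0 <= r <= 1 -> J1 (fun x => psiy r x * f x) = Psi r.
  move=> hr; rewrite /Psi clamp_id// -J1_split//.
  rewrite -(J1_cut_le f hr) -JB//.
  - apply: J_ext => x /indic_cc_neq0 hx.
    by rewrite /psiy clamp_id// mulrBl.
  - apply: mbdM => //.
    exact: (@mbd_sec1 _ _ RT _ RT (fun p => (p.1 <= p.2)%R%:R : R) r mle1).
  - exact: mbdM.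
have cPsi : continuous Psi.
  move=> r; apply: cvgB; last exact: cvg_cst.
  apply: cvgB; first exact: cvg_cst.
  apply: (within_comp_continuous (Iab_continuous ler01 cf) (@clamp_continuous R 0 1)).
  by move=> u; rewrite /= in_itv /=; exact: clamp01.
have P0 r : 0 < r < 1 -> Psi r = 0.
  move=> hr; suff /eqP : Psi r ^+ 2 = 0 by rewrite sqrf_eq0 => /eqP.
  apply: (@nneg_J1_0 (fun r => Psi r ^+ 2)) => //.
  - by move=> u; apply: cvgM; exact: cPsi.
  - by move=> u _; exact: sqr_ge0.
  - rewrite -[RHS]J0; apply: J_ext => u /indic_cc_neq0 hu.
    by rewrite E// expr2.
move=> y hy; have /andP[y0 y1] := hy.
have d1 := Iab_is_derive cf y0.
have d2 : is_derive y 1 (Iab 0 ^~ f) 0.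
  apply: (near_eq_is_derive _ (is_derive_cst (J1 f - c) y 1)).
  near=> z.
  have hz : 0 < z < 1 by apply/andP; split; near: z; [exact: lt_nbhsr|exact: lt_nbhsl].
  have := P0 z hz; rewrite /Psi clamp_id; last by case/andP: hz => ? ?; rewrite !ltW.
  move=> /eqP; rewrite subr_eq0 => /eqP <-.
  by rewrite subKr.
by case: d1 => _ <-; case: d2.
Unshelve. all: by end_near. Qed.

(** [kx] is symmetric only with respect to the measure [x dx]; the extra factor restores plain
    symmetry, as [form_energy] requires. *)
Definition kxx (x xi : R) : R := clamp 0 1 x * kx x xi.

Lemma kxx_sym x xi : kxx x xi = kxx xi x.
Proof. by rewrite /kxx /kx maxC; ring. Qed.

Lemma mbd_kxx : mbd (fun p : RT * RT => kxx p.1 p.2).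
Proof. by apply: mbdM; [exact: mbd_fst|exact: mbd_kx]. Qed.

(** On the unit square, [x * xi * (- ln (max x xi))] is the integral of [x * xi / r] over [r] from
    the maximum to 1, that is, of [psix r x * psix r xi / r]. The form is thus the radial Dirichlet
    energy [\int r ((Nx f)' r)^2 dr]. *)
Definition psix (r x : R) : R := (clamp 0 1 x <= r)%R%:R * clamp 0 1 x.
(** The weight [1 / r] sits in this factor alone, written with [powR] to inherit its measurability.
    It stays bounded because [psix r x] vanishes unless [clamp 0 1 x <= r]. *)
Definition phix (r x : R) : R := psix r x * r `^ (-1).

Let phixE (r x : R) : 0 <= r -> phix r x = psix r x / r.
Proof. by move=> r0; rewrite /phix powR_inv1. Qed.

Let mpsix0 : measurable_fun [set: RT * RT] (fun p : RT * RT => psix p.1 p.2).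
Proof.
apply: measurable_funM; last exact: measurable_clamp2.
have [m _] := mle1.
apply: (measurableT_comp m (g := fun p : RT * RT => (clamp 0 1 p.2, p.1))).
by apply: measurable_fun_pair; [exact: measurable_clamp2|exact: measurable_fst].
Qed.

Lemma mbd_psix : mbd (fun p : RT * RT => psix p.1 p.2).
Proof.
split=> //; exists 1 => p; rewrite normrM -[leRHS]mul1r; apply: ler_pM => //.
  by rewrite normr_nat lern1 leq_b1.
by have /andP[h1 h2] := clamp01 p.2; rewrite ger0_norm.
Qed.

Lemma mbd_phix : mbd (fun p : RT * RT => phix p.1 p.2).
Proof.
split.
  apply: measurable_funM => //.
  exact: (measurableT_comp (measurable_powR (-1)) measurable_fst).
exists 1 => -[r x] /=; rewrite /phix /psix; have /andP[h1 h2] := clamp01 x.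
case: (leP (clamp 0 1 x) r) => h; last by rewrite /= !mul0r normr0.
rewrite mul1r; have r0 : 0 <= r := le_trans h1 h.
rewrite powR_inv1// ger0_norm ?divr_ge0//.
move: r0; rewrite le_eqVlt => /predU1P[<-|r0]; first by rewrite invr0 mulr0.
by rewrite ler_pdivrMr// mul1r.
Qed.

Lemma kxx_features x xi : 0 <= x <= 1 -> 0 <= xi <= 1 ->
  kxx x xi = J1 (fun r => phix r x * psix r xi).
Proof.
move=> hx hxi; rewrite /kxx /kx !clamp_id//; case/andP: (hx) => x0 x1; case/andP: (hxi) => xi0 xi1.
have [x00|xn0] := eqVneq x 0.
  rewrite x00 mul0r; symmetry; rewrite (@J_ext _ _ _ (fun=> 0)); last first.
    by move=> r _; rewrite /phix /psix [clamp 0 1 0]clamp_id ?lexx ?ler01// mulr0 !mul0r.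
  by have := Iab_cst 0 (@ler01 R); rewrite mul0r.
have {xn0} xp : 0 < x by rewrite lt_neqAle eq_sym xn0.
set m := Num.max x xi.
have m0 : 0 < m by rewrite /m lt_max xp.
have m1 : m <= 1 by rewrite /m ge_max x1.
transitivity (Iab m 1 (fun r => x * xi * r^-1)).
  transitivity (x * xi * ln 1 - x * xi * ln m); first by rewrite ln1 /m; ring.
  move: m1; rewrite le_eqVlt => /predU1P[->|m1]; first by rewrite subrr Iab_pt.
  symmetry; apply: (Iab_FTC_cc (F := fun r => x * xi * ln r)) => //.
    apply: continuous_in_subspaceT => r; rewrite inE /= in_itv /= => /andP[mr _].
    apply: cvgM; first exact: cvg_cst.
    by apply: cvgV; [rewrite gt_eqF// (lt_le_trans m0)|exact: cvg_id].
  move=> r /andP[mr _]; have r0 := lt_le_trans m0 mr.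
  have d1 := is_derive1_ln r0.
  by apply: is_derive_eq; rewrite /GRing.scale.
rewrite -J1_cut_le; last by rewrite (ltW m0).
apply: J_ext => r /indic_cc_neq0 /andP[r0 _].
rewrite phixE// /psix !clamp_id// /m ge_max.
by case: (x <= r); case: (xi <= r); rewrite /= ?mulr0n ?mulr1n; ring.
Qed.

Let Phi (f : R -> R) (r : R) := Iab 0 (clamp 0 1 r) (fun x => clamp 0 1 x * f x).

Let PhiE f r : 0 <= r <= 1 -> J1 (fun x => psix r x * f x) = Phi f r.
Proof.
move=> hr; rewrite /Phi clamp_id// -J1_cut_ge//.
by apply: J_ext => x /indic_cc_neq0 hx; rewrite /psix clamp_id// mulrA.
Qed.

Let form_kxxE f : @mbd R _ RT f -> qform kxx f = J1 (fun r => Phi f r ^+ 2 / r).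
Proof.
move=> mf; rewrite (form_features mbd_phix mbd_psix kxx_features mf).
apply: J_ext => r /indic_cc_neq0 hr; rewrite PhiE//.
rewrite (@J_ext _ _ _ (fun x => r^-1 * (psix r x * f x))).
  rewrite JZ// ?PhiE//; first by rewrite expr2; ring.
  apply: mbdM => //; exact: (@mbd_sec1 _ _ RT _ RT (fun p => psix p.1 p.2) r mbd_psix).
by move=> x _; rewrite phixE; [ring|by case/andP: hr].
Qed.

Lemma form_kxx_ge0 f : @mbd R _ RT f -> 0 <= qform kxx f.
Proof.
move=> mf; rewrite form_kxxE//.
apply: J_ge0 => [x|r /indic_cc_neq0 /andP[r0 _]]; first exact: indic_ge0.
by rewrite divr_ge0// sqr_ge0.
Qed.

(** [Phi^2 / r] is not known to be continuous at 0, so it is compared on [[0, 1]] with the smaller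
    continuous function [Phi^2]. Then [Phi = 0], and differentiating gives [x * f x = 0]. *)
Lemma form_kxx_eq0 f : @mbd R _ RT f -> continuous f -> qform kxx f = 0 ->
  forall x, 0 < x < 1 -> f x = 0.
Proof.
move=> mf cf J0.
have ccf : continuous (fun x => clamp 0 1 x * f x).
  by move=> x; apply: cvgM; [exact: clamp_continuous|exact: cf].
have mcf : @mbd R _ RT (fun x => clamp 0 1 x * f x) by exact: mbdM.
have cPhi : continuous (Phi f).
  apply: (within_comp_continuous (Iab_continuous ler01 ccf) (@clamp_continuous R 0 1)).
  by move=> u; rewrite /= in_itv /=; exact: clamp01.
have [D hD] : exists D, forall r, `|Phi f r| <= D.
  have [_ [D hD]] := mcf; exists D => r; have /andP[r0 r1] := clamp01 r.
  apply: (@le_trans _ _ (D * (clamp 0 1 r - 0))).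
    by apply: Iab_norm_le => // x _; exact: hD.
  by rewrite subr0 ler_piMr// (le_trans _ (hD 0)).
have mPhi2 : @mbd R _ RT (fun r => Phi f r ^+ 2).
  by apply: mbdM; apply: bcont_mbd => //; exists D.
have mPhir : @mbd R _ RT (fun r => J1 (fun x => phix r x * f x) * J1 (fun xi => psix r xi * f xi)).
  apply: mbdM.
    apply: (@mbd_J _ _ RT (fun p => phix p.1 p.2 * f p.2)) => //.
    by apply: mbdM; [exact: mbd_phix|exact: mbd_snd].
  apply: (@mbd_J _ _ RT (fun p => psix p.1 p.2 * f p.2)) => //.
  by apply: mbdM; [exact: mbd_psix|exact: mbd_snd].
have Jsq : J1 (fun r => Phi f r ^+ 2) = 0.
  apply/eqP; rewrite eq_le; apply/andP; split; last first.
    by apply: J_ge0 => [x|r _]; [exact: indic_ge0|rewrite sqr_ge0].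
  rewrite -[leRHS]J0 (form_features mbd_phix mbd_psix kxx_features mf).
  apply: (J_le w1 mPhi2 mPhir (@indic_ge0 R _)) => r /indic_cc_neq0 hr.
  rewrite (PhiE f hr).
  rewrite (@J_ext _ _ _ (fun x => r^-1 * (psix r x * f x))); last first.
    by move=> x _; rewrite phixE; [ring|by case/andP: hr].
  have mr : @mbd R _ RT (fun x => psix r x * f x).
    apply: mbdM => //; exact: (@mbd_sec1 _ _ RT _ RT (fun p => psix p.1 p.2) r mbd_psix).
  rewrite (JZ r^-1 w1 mr) (PhiE f hr) -mulrA -expr2; case/andP: hr => r0 r1.
  (* At [r = 0], where the inverse is 0 by convention, the comparison holds because [Phi] vanishes
     there. *)
  move: r0; rewrite le_eqVlt => /predU1P[<-|r0].
    by rewrite /Phi clamp_id ?lexx ?ler01// Iab_pt expr0n /= mulr0.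
  by rewrite ler_peMl ?sqr_ge0// invf_ge1.
have P0 r : 0 < r < 1 -> Phi f r = 0.
  move=> hr; suff /eqP : Phi f r ^+ 2 = 0 by rewrite sqrf_eq0 => /eqP.
  apply: (@nneg_J1_0 (fun r => Phi f r ^+ 2)) => //.
  - by move=> u; apply: cvgM; exact: cPhi.
  - by move=> u _; exact: sqr_ge0.
move=> x hx; have /andP[x0 x1] := hx.
have d1 := Iab_is_derive ccf x0.
have d2 : is_derive x 1 (Iab 0 ^~ (fun x => clamp 0 1 x * f x)) 0.
  apply: (near_eq_is_derive _ (is_derive_cst (0 : R) x 1)).
  near=> z.
  have hz : 0 < z < 1 by apply/andP; split; near: z; [exact: lt_nbhsr|exact: lt_nbhsl].
  have := P0 z hz; rewrite /Phi clamp_id => [E|]; first by rewrite [RHS]E.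
  by case/andP: hz => ? ?; rewrite !ltW.
have : clamp 0 1 x * f x = 0 by case: d1 => _ <-; case: d2.
rewrite clamp_id; last by rewrite !ltW.
by move=> /eqP; rewrite mulf_eq0 gt_eqF//= => /eqP.
Unshelve. all: by end_near. Qed.

End Forms.

(** * Vanishing of the difference of two solutions *)

Section Vanishing.
Context (R : realType).
Local Notation RT := (measurableTypeR R).
Local Notation mu := (@lebesgue_measure R).
Local Notation J1 := (J (\1_`[0, 1] : R -> R)).
Let w1 : weight (\1_`[0, 1] : R -> R) := weight_cc 0 1.

Lemma continuous0_cc (f : R -> R) (a b : R) : a < b -> continuous f ->
  (forall x, a < x < b -> f x = 0) -> forall x, a <= x <= b -> f x = 0.
Proof.
move=> ab cf f0 x /andP[]; rewrite le_eqVlt => /predU1P[<- _|ax].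
  have h : f z @[z --> a^'+] --> f a by apply: cvg_at_right_filter; exact: cf.
  have h0 : f z @[z --> a^'+] --> (0 : R).
    apply: cvg_near_cst; near=> z; apply: f0; apply/andP; split; near: z.
      exact: nbhs_right_gt.
    exact: nbhs_right_lt.
  exact: (cvg_unique _ h h0).
rewrite le_eqVlt => /predU1P[->|xb]; last by apply: f0; rewrite ax xb.
have h : f z @[z --> b^'-] --> f b by apply: cvg_at_left_filter; exact: cf.
have h0 : f z @[z --> b^'-] --> (0 : R).
  apply: cvg_near_cst; near=> z; apply: f0; apply/andP; split; near: z.
    exact: nbhs_left_gt.
  exact: nbhs_left_lt.
exact: (cvg_unique _ h h0).
Unshelve. all: by end_near. Qed.

Lemma J_eq0 q (f : R -> R) : weight q -> (forall x, q x != 0 -> f x = 0) -> J q f = 0.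
Proof.
move=> wq f0; transitivity (J q (fun=> 0 * 0)); last by rewrite JZ ?mul0r//; exact: mbd_cst.
by apply: J_ext => x /f0 ->; rewrite mul0r.
Qed.

(** The sign of [F] is known only in the open square; its boundary is null. *)
Lemma J1J1_ge0 (F : R -> R -> R) : mbd (fun p : RT * RT => F p.1 p.2) ->
  (forall x y, 0 < x < 1 -> 0 < y < 1 -> 0 <= F x y) ->
  0 <= J1 (fun y => J1 (fun x => F x y)).
Proof.
move=> mF F0.
have mFy y : @mbd R _ RT (fun x => F x y).
  exact: (@mbd_sec2 _ _ RT _ RT (fun p => F p.1 p.2) y mF).
have mJ : @mbd R _ RT (fun y => J1 (fun x => F x y)).
  apply: (@mbd_J _ _ RT (fun p => F p.2 p.1)) => //.
  apply: (mbd_comp mF (h := fun p : RT * RT => (p.2, p.1))).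
  by apply: measurable_fun_pair; [exact: measurable_snd|exact: measurable_fst].
rewrite -[J1 _](J_oo_cc 0 1 mJ).
apply: J_ge0 => [y|y /indic_neq0]; first exact: indic_ge0.
rewrite /= in_itv /= => hy.
rewrite -[J1 _](J_oo_cc 0 1 (mFy y)).
apply: J_ge0 => [x|x /indic_neq0]; first exact: indic_ge0.
by rewrite /= in_itv /= => hx; exact: F0.
Qed.

Lemma primD s (f g : R -> R) t : @mbd R _ RT f -> @mbd R _ RT g ->
  prim s (fun z => f z + g z) t = prim s f t + prim s g t.
Proof.
move=> mf mg.
have ml : @mbd R _ RT (fun z : R => (z <= t)%R%:R : R).
  exact: (@mbd_sec1 R _ RT _ RT (fun p => (p.2 <= p.1)%R%:R : R) t (@mbd_le R)).
rewrite /prim /Iab -(JD (weight_cc 0 s) (mbdM ml mf) (mbdM ml mg)).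
by apply: J_ext => z _; rewrite mulrDr.
Qed.

Lemma primN s (f : R -> R) t : @mbd R _ RT f ->
  prim s (fun z => - f z) t = - prim s f t.
Proof.
move=> mf.
have ml : @mbd R _ RT (fun z : R => (z <= t)%R%:R : R).
  exact: (@mbd_sec1 R _ RT _ RT (fun p => (p.2 <= p.1)%R%:R : R) t (@mbd_le R)).
rewrite /prim /Iab -(JN (weight_cc 0 s) (mbdM ml mf)).
by apply: J_ext => z _; rewrite mulrN.
Qed.

Let m11 : measurable_fun [set: RT * RT * RT * RT] (fun p => p.1.1.1 : RT).
Proof.
apply: (measurableT_comp measurable_fst); apply: (measurableT_comp measurable_fst).
exact: measurable_fst.
Qed.
Let m12 : measurable_fun [set: RT * RT * RT * RT] (fun p => p.1.1.2 : RT).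
Proof.
apply: (measurableT_comp measurable_snd); apply: (measurableT_comp measurable_fst).
exact: measurable_fst.
Qed.
Let m13 : measurable_fun [set: RT * RT * RT * RT] (fun p => p.1.2 : RT).
Proof. by apply: (measurableT_comp measurable_snd); exact: measurable_fst. Qed.

Lemma mbd3_Ny (W : R -> R -> R -> R) : mbd3 W ->
  mbd3 (fun x y t => Ny (fun eta => W x eta t) y).
Proof.
move=> mW; apply: (@mbd_J _ _ (RT * RT * RT)%type
  (fun p => ky p.1.1.2 p.2 * W p.1.1.1 p.2 p.1.2)) => //.
apply: mbdM.
  apply: (mbd_comp (@mbd_ky R) (h := fun p : RT * RT * RT * RT => (p.1.1.2, p.2))).
  by apply: measurable_fun_pair => //; exact: measurable_snd.
apply: (mbd_comp mW (h := fun p : RT * RT * RT * RT => (p.1.1.1, p.2, p.1.2))).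
by apply: measurable_fun_pair => //; apply: measurable_fun_pair => //; exact: measurable_snd.
Qed.

Lemma mbd3_Nx (W : R -> R -> R -> R) : mbd3 W ->
  mbd3 (fun x y t => Nx (fun xi => W xi y t) x).
Proof.
move=> mW; apply: (@mbd_J _ _ (RT * RT * RT)%type
  (fun p => kx p.1.1.1 p.2 * W p.2 p.1.1.2 p.1.2)) => //.
apply: mbdM.
  apply: (mbd_comp (@mbd_kx R) (h := fun p : RT * RT * RT * RT => (p.1.1.1, p.2))).
  by apply: measurable_fun_pair => //; exact: measurable_snd.
apply: (mbd_comp mW (h := fun p : RT * RT * RT * RT => (p.2, p.1.1.2, p.1.2))).
by apply: measurable_fun_pair => //; apply: measurable_fun_pair => //; exact: measurable_snd.
Qed.

Variable W : R -> R -> R -> R.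
Hypothesis cW : cb3 W.
Let mW : mbd3 W. Proof. exact: cb3_mbd. Qed.

(** [Hy] is [Ky w] and [Gx] is [Kx w] in the notation of the overview; below, [Hs] is the time
    integral of [Hy] over [[0, s]], and [zl] is [Kx Ky w]. *)
Let Hy x y t := Ny (fun eta => W x eta t) y.
Let Gx x y t := Nx (fun xi => W xi y t) x.
Let mHy : mbd3 Hy. Proof. exact: mbd3_Ny. Qed.
Let mGx : mbd3 Gx. Proof. exact: mbd3_Nx. Qed.

Let mkx x : @mbd R _ RT (kx x).
Proof. exact: (@mbd_sec1 _ _ RT _ RT (fun p => kx p.1 p.2) x (@mbd_kx R)). Qed.
Let mky y : @mbd R _ RT (ky y).
Proof. exact: (@mbd_sec1 _ _ RT _ RT (fun p => ky p.1 p.2) y (@mbd_ky R)). Qed.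
Let mWx y t : @mbd R _ RT (fun x => W x y t).
Proof. exact: (@mbd_sec2 _ _ RT _ RT (fun p => W p.1 p.2 t) y (mbd3_t t mW)). Qed.
Let mWy x t : @mbd R _ RT (fun y => W x y t).
Proof. exact: (@mbd_sec1 _ _ RT _ RT (fun p => W p.1 p.2 t) x (mbd3_t t mW)). Qed.
Let mWt x y : @mbd R _ RT (W x y).
Proof. exact: (@mbd_sec1 _ _ RT _ RT (fun p => W x p.1 p.2) y (mbd3_x x mW)). Qed.

Let C := projT1 (cid (cb3_bound cW)).
Let hC x y t : `|W x y t| <= C.
Proof. by rewrite /C; case: cid => D hD /=. Qed.
Let C0 : 0 <= C. Proof. exact: (le_trans _ (hC 0 0 0)). Qed.

Let kxW x xi y t : `|kx x xi * W xi y t| <= C.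
Proof.
rewrite normrM -[leRHS]mul1r; apply: ler_pM => //.
by have /andP[? ?] := kx_ge0_le1 x xi; rewrite ger0_norm.
Qed.
Let kyW y eta x t : `|ky y eta * W x eta t| <= C.
Proof.
rewrite normrM -[leRHS]mul1r; apply: ler_pM => //.
by have /andP[? ?] := ky_ge0_le1 y eta; rewrite ger0_norm.
Qed.

Let cHt x y : continuous (Hy x y).
Proof.
apply: (@J_continuous _ _ (fun t eta => ky y eta * W x eta t) C w1) => //.
  by move=> t; have [] := mbdM (mky y) (mWy x t).
by move=> eta t; apply: cvgM; [exact: cvg_cst|exact: (cb3_t cW)].
Qed.

Let cHy x t : continuous (fun y => Hy x y t).
Proof.
apply: (@J_continuous _ _ (fun y eta => ky y eta * W x eta t) C w1) => //.
  by move=> y; have [] := mbdM (mky y) (mWy x t).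
by move=> eta y; apply: cvgM; [exact: ky_continuous|exact: cvg_cst].
Qed.

Let cHx y t : continuous (fun x => Hy x y t).
Proof.
apply: (@J_continuous _ _ (fun x eta => ky y eta * W x eta t) C w1) => //.
  by move=> x; have [] := mbdM (mky y) (mWy x t).
by move=> eta x; apply: cvgM; [exact: cvg_cst|exact: (cb3_x cW)].
Qed.

Let cGt x y : continuous (Gx x y).
Proof.
apply: (@J_continuous _ _ (fun t xi => kx x xi * W xi y t) C w1) => //.
  by move=> t; have [] := mbdM (mkx x) (mWx y t).
by move=> xi t; apply: cvgM; [exact: cvg_cst|exact: (cb3_t cW)].
Qed.

Let Hbound x y t : `|Hy x y t| <= C.
Proof. by apply: J1_norm => //; exact: (mbdM (mky y) (mWy x t)). Qed.

Variable s : R.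
Hypothesis s0 : 0 < s.
Hypothesis lim_ineq : forall x y, 0 < x < 1 -> 0 < y < 1 ->
  0 <= J (\1_`]0, s[) (fun t => Nx (fun xi => Hy xi y t) x *
    prim s (fun t => - (Hy x y t + Gx x y t)) t).

Let wI : weight (\1_`]0, s[ : R -> R) := weight_oo 0 s.
Let wsI : weight (\1_`[0, s] : R -> R) := weight_cc 0 s.

Let Hs x y := Iab 0 s (Hy x y).

Let mHyt x y : @mbd R _ RT (Hy x y).
Proof. exact: (@mbd_sec1 _ _ RT _ RT (fun p => Hy x p.1 p.2) y (mbd3_x x mHy)). Qed.
Let mGxt x y : @mbd R _ RT (Gx x y).
Proof. exact: (@mbd_sec1 _ _ RT _ RT (fun p => Gx x p.1 p.2) y (mbd3_x x mGx)). Qed.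
Let mHyx y t : @mbd R _ RT (fun x => Hy x y t).
Proof. exact: (@mbd_sec2 _ _ RT _ RT (fun p => Hy p.1 p.2 t) y (mbd3_t t mHy)). Qed.

Let Hs_bound x y : `|Hs x y| <= C * (s - 0).
Proof. by apply: Iab_norm_le => //; exact: ltW. Qed.

Let cHsx y : continuous (fun x => Hs x y).
Proof.
apply: (@J_continuous _ _ (fun x t => Hy x y t) C wsI) => //.
by move=> x; have [] := mHyt x y.
Qed.

Let cHsy x : continuous (Hs x).
Proof.
apply: (@J_continuous _ _ (fun y t => Hy x y t) C wsI) => //.
by move=> y; have [] := mHyt x y.
Qed.

Let mHsx y : @mbd R _ RT (fun x => Hs x y).
Proof. by apply: bcont_mbd => //; exists (C * (s - 0)). Qed.

Let zl x y t := Nx (fun xi => Hy xi y t) x.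
Let mzl : mbd3 zl. Proof. exact: mbd3_Nx. Qed.
Let mzlt x y : @mbd R _ RT (zl x y).
Proof. exact: (@mbd_sec1 _ _ RT _ RT (fun p => zl x p.1 p.2) y (mbd3_x x mzl)). Qed.

(** The two inverses commute. Reading [zl] as [Kx (Ky w)] produces the form in [Ky w], and reading
    it as [Ky (Kx w)] produces the form in [Kx w]. *)
Let zlE x y t : zl x y t = J1 (fun eta => ky y eta * Gx x eta t).
Proof.
transitivity (J1 (fun xi => J1 (fun eta => kx x xi * (ky y eta * W xi eta t)))).
  apply: J_ext => xi _; rewrite (JZ (kx x xi) w1)//.
  exact: (mbdM (mky y) (mWy xi t)).
have m : mbd (fun p : RT * RT => kx x p.1 * (ky y p.2 * W p.1 p.2 t)).
  exact: (mbdM (mbd_fst (mkx x)) (mbdM (mbd_snd (mky y)) (mbd3_t t mW))).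
rewrite (J_swap w1 w1 m); apply: J_ext => eta _.
rewrite -(JZ (ky y eta) w1 (mbdM (mkx x) (mWx eta t))).
by apply: J_ext => xi _; rewrite /= mulrCA.
Qed.

(** The two parts of the limit inequality. Weighted by [x] and integrated in [x], [A] is half a
    [kxx]-form for each [y]; integrated in [y], [B] is half a [ky]-form for each [x]. *)
Let A x y := J (\1_`]0, s[) (fun t => zl x y t * prim s (Hy x y) t).
Let B x y := J (\1_`]0, s[) (fun t => zl x y t * prim s (Gx x y) t).

Let mA : mbd (fun p : RT * RT => A p.1 p.2).
Proof.
apply: (@mbd_J _ _ (RT * RT)%type (fun p => zl p.1.1 p.1.2 p.2 * prim s (Hy p.1.1 p.1.2) p.2) _ _ wI).
exact: (mbdM mzl (@mbd_prim R _ (RT * RT)%type (fun p => Hy p.1.1 p.1.2 p.2) s mHy)).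
Qed.

Let mB : mbd (fun p : RT * RT => B p.1 p.2).
Proof.
apply: (@mbd_J _ _ (RT * RT)%type (fun p => zl p.1.1 p.1.2 p.2 * prim s (Gx p.1.1 p.1.2) p.2) _ _ wI).
exact: (mbdM mzl (@mbd_prim R _ (RT * RT)%type (fun p => Gx p.1.1 p.1.2 p.2) s mGx)).
Qed.

Let AB_le0 x y : 0 < x < 1 -> 0 < y < 1 -> A x y + B x y <= 0.
Proof.
move=> hx hy; rewrite -oppr_ge0; have := lim_ineq hx hy.
have m1 := mbdM (mzlt x y) (mbd_prim1 s (mHyt x y)).
have m2 := mbdM (mzlt x y) (mbd_prim1 s (mGxt x y)).
rewrite /A /B -(JD wI m1 m2) -(JN wI (mbdD m1 m2)).
rewrite (@J_ext _ _ _ (fun t => - (zl x y t * prim s (Hy x y) t + zl x y t * prim s (Gx x y) t)))//.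
move=> t _; rewrite (primN _ _ (mbdD (mHyt x y) (mGxt x y))) (primD _ _ (mHyt x y) (mGxt x y)).
by rewrite mulrN mulrDr.
Qed.

Let mcl1 : mbd (fun p : RT * RT => clamp 0 1 p.1 : R).
Proof.
split; first exact: measurable_clamp1.
by exists 1 => p; have /andP[h1 h2] := clamp01 p.1; rewrite ger0_norm.
Qed.

Let mcA : mbd (fun p : RT * RT => clamp 0 1 p.1 * A p.1 p.2).
Proof. exact: (mbdM mcl1 mA). Qed.
Let mcB : mbd (fun p : RT * RT => clamp 0 1 p.1 * B p.1 p.2).
Proof. exact: (mbdM mcl1 mB). Qed.

Let Q (y : R) : R := qform (@kxx R) (fun x => Hs x y).

Let Q_ge0 y : 0 <= Q y.
Proof. exact: form_kxx_ge0. Qed.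

Let QE y : J1 (fun x => clamp 0 1 x * A x y) *+ 2 = Q y.
Proof.
apply: (etrans _ (@form_energy R (@kxx R) (fun x t => Hy x y t) s (ltW s0) (@mbd_kxx R)
  (@kxx_sym R) (mbd3_y y mHy) (fun x => @cHt x y))).
congr (_ *+ 2); apply: J_ext => x _.
rewrite /A -(JZ (clamp 0 1 x) wI (mbdM (mzlt x y) (mbd_prim1 s (mHyt x y)))).
apply: J_ext => t _; rewrite mulrA; congr (_ * _).
rewrite /zl /Nx -(JZ (clamp 0 1 x) w1 (mbdM (mkx x) (mHyx y t))).
by apply: J_ext => xi _; rewrite /kxx mulrA.
Qed.

Let ky_sym (y eta : R) : ky y eta = ky eta y.
Proof. by rewrite /ky minC maxC. Qed.

Let JB_ge0 x : 0 <= J1 (fun y => B x y).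
Proof.
have E : J1 (fun y => B x y) *+ 2 = qform (@ky R) (fun y => Iab 0 s (Gx x y)).
  have E0 : J1 (fun y => B x y) = J1 (fun y => J (\1_`]0, s[)
      (fun t => J1 (fun eta => ky y eta * Gx x eta t) * prim s (Gx x y) t)).
    have Ez y t : zl x y t * prim s (Gx x y) t =
        J1 (fun eta => ky y eta * Gx x eta t) * prim s (Gx x y) t.
      by rewrite zlE.
    exact: (J_ext (fun y _ => J_ext (fun t _ => Ez y t))).
  rewrite E0.
  exact: (@form_energy R (@ky R) (Gx x) s (ltW s0) (@mbd_ky R) ky_sym (mbd3_x x mGx) (@cGt x)).
have mG : @mbd R _ RT (fun y => Iab 0 s (Gx x y)).
  exact: (@mbd_J _ _ RT (fun p => Gx x p.1 p.2) _ (mbd3_x x mGx) wsI).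
by have := form_ky_ge0 mG; rewrite -E pmulrn_lge0.
Qed.

Let mQA : @mbd R _ RT (fun y => J1 (fun x => clamp 0 1 x * A x y)).
Proof.
apply: (@mbd_J _ _ RT (fun p => clamp 0 1 p.2 * A p.2 p.1) _ _ w1).
apply: (mbd_comp mcA (h := fun p : RT * RT => (p.2, p.1))).
by apply: measurable_fun_pair; [exact: measurable_snd|exact: measurable_fst].
Qed.

Let mQB : @mbd R _ RT (fun y => J1 (fun x => clamp 0 1 x * B x y)).
Proof.
apply: (@mbd_J _ _ RT (fun p => clamp 0 1 p.2 * B p.2 p.1) _ _ w1).
apply: (mbd_comp mcB (h := fun p : RT * RT => (p.2, p.1))).
by apply: measurable_fun_pair; [exact: measurable_snd|exact: measurable_fst].
Qed.

(** The integral of [x * (A + B)] over the square is nonpositive. Its [B] part is nonnegative after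
    exchanging the integrals, and its [A] part is half of [J1 Q], so [J1 Q <= 0], while [Q >= 0]. *)
Let JQ0 : J1 Q = 0.
Proof.
have JB0 : 0 <= J1 (fun y => J1 (fun x => clamp 0 1 x * B x y)).
  rewrite -(J_swap w1 w1 mcB); apply: J_ge0 => [x|x /indic_cc_neq0 hx]; first exact: indic_ge0.
  have mBx := @mbd_sec1 _ _ RT _ RT (fun p => B p.1 p.2) x mB.
  rewrite [leRHS](_ : _ = clamp 0 1 x * J1 (fun y => B x y)).
    by rewrite mulr_ge0//; have /andP[] := clamp01 x.
  exact: (JZ (clamp 0 1 x) w1 mBx).
have F0 := @J1J1_ge0 (fun x y => - (clamp 0 1 x * A x y + clamp 0 1 x * B x y))
  (mbdN (mbdD mcA mcB)).
have {}F0 : J1 (fun y => J1 (fun x => clamp 0 1 x * A x y)) +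
    J1 (fun y => J1 (fun x => clamp 0 1 x * B x y)) <= 0.
  rewrite -(JD w1 mQA mQB) -oppr_ge0 -(JN w1 (mbdD mQA mQB)).
  rewrite (@J_ext _ _ _ (fun y => J1 (fun x => - (clamp 0 1 x * A x y + clamp 0 1 x * B x y)))).
    apply: F0 => x y hx hy; rewrite -mulrDr -mulrN mulr_ge0//.
      by have /andP[] := clamp01 x.
    by rewrite oppr_ge0; exact: AB_le0.
  move=> y _.
  have s1 := @mbd_sec2 _ _ RT _ RT (fun p => clamp 0 1 p.1 * A p.1 p.2) y mcA.
  have s2 := @mbd_sec2 _ _ RT _ RT (fun p => clamp 0 1 p.1 * B p.1 p.2) y mcB.
  by rewrite -(JD w1 s1 s2) -(JN w1 (mbdD s1 s2)).
have JQ : J1 Q = J1 (fun y => J1 (fun x => clamp 0 1 x * A x y)) *+ 2.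
  by rewrite mulr2n -(JD w1 mQA mQA); apply: J_ext => y _; rewrite -QE mulr2n.
apply/eqP; rewrite eq_le; apply/andP; split; last first.
  by apply: J_ge0 => [x|y _]; [exact: indic_ge0|exact: Q_ge0].
rewrite JQ pmulrn_lle0//; apply: le_trans F0; by rewrite lerDl.
Qed.

(** Continuity upgrades the vanishing of [Q] from almost every [y] to every [y] in []0, 1[]. *)
Let cQ : continuous Q.
Proof.
have mk x : @mbd R _ RT (kxx x).
  exact: (@mbd_sec1 _ _ RT _ RT (fun p => kxx p.1 p.2) x (@mbd_kxx R)).
have bk x xi : `|kxx x xi| <= 1.
  have /andP[h1 h2] := clamp01 x; have /andP[h3 h4] := kx_ge0_le1 x xi.
  have -> : kxx x xi = clamp 0 1 x * kx x xi by [].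
  by rewrite normrM; apply: mulr_ile1; rewrite // ger0_norm.
pose D := C * (s - 0).
have bq x xi y : `|kxx x xi * (Hs x y * Hs xi y)| <= D * D.
  rewrite normrM; apply: (@le_trans _ _ (1 * (D * D))); last by rewrite mul1r.
  apply: ler_pM; [exact: normr_ge0|exact: normr_ge0|exact: bk|].
  rewrite normrM; apply: ler_pM; [exact: normr_ge0|exact: normr_ge0|..]; exact: Hs_bound.
have mi x y : @mbd R _ RT (fun xi => kxx x xi * (Hs x y * Hs xi y)).
  exact: (mbdM (mk x) (mbdZ (Hs x y) (mHsx y))).
apply: (@J_continuous _ _ (fun y x => J1 (fun xi => kxx x xi * (Hs x y * Hs xi y))) (D * D) w1).
- move=> y.
  have [] // := @mbd_J _ _ RT (fun p => kxx p.1 p.2 * (Hs p.1 y * Hs p.2 y)) _ _ w1.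
  exact: (mbdM (@mbd_kxx R) (mbdM (mbd_fst (mHsx y)) (mbd_snd (mHsx y)))).
- by move=> y x; apply: J1_norm.
- move=> x.
  apply: (@J_continuous _ _ (fun y xi => kxx x xi * (Hs x y * Hs xi y)) (D * D) w1) => //.
    by move=> y; have [] := mi x y.
  move=> xi y; apply: cvgM; first exact: cvg_cst.
  by apply: cvgM; exact: cHsy.
Qed.

Let Hs0 x y : 0 < x < 1 -> 0 < y < 1 -> Hs x y = 0.
Proof.
move=> hx hy.
exact: (form_kxx_eq0 (mHsx y) (@cHsx y) (nneg_J1_0 cQ (fun y _ => Q_ge0 y) JQ0 hy) hx).
Qed.

(** With [S] the time integral of [W x], Fubini gives [Hs x = Ny S]. Since [Hs x] vanishes on []0,
    1[], so does the form [qform ky S = \int S * Hs x], and definiteness gives [S = 0]. *)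
Lemma energy_vanish x y : 0 < x < 1 -> 0 < y < 1 -> Iab 0 s (W x y) = 0.
Proof.
move=> hx hy; pose S y := Iab 0 s (W x y).
have cS : continuous S.
  apply: (@J_continuous _ _ (fun y t => W x y t) C wsI) => //.
    by move=> z; have [] := mWt x z.
  by move=> t; exact: (cb3_y cW).
have mS : @mbd R _ RT S.
  exact: (@mbd_J _ _ RT (fun p => W x p.1 p.2) _ (mbd3_x x mW) wsI).
have HE z : Hs x z = J1 (fun eta => ky z eta * S eta).
  have m : mbd (fun p : RT * RT => ky z p.2 * W x p.2 p.1).
    apply: mbdM; first exact: (mbd_snd (mky z)).
    apply: (mbd_comp (mbd3_x x mW) (h := fun p : RT * RT => (p.2, p.1))).
    by apply: measurable_fun_pair; [exact: measurable_snd|exact: measurable_fst].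
  transitivity (J1 (fun eta => Iab 0 s (fun t => ky z eta * W x eta t))).
    exact: (J_swap wsI w1 m).
  by apply: J_ext => eta _; rewrite [LHS](JZ (ky z eta) wsI (mWt x eta)).
apply: (form_ky_eq0 mS cS) hy.
have mf : @mbd R _ RT (fun z => J1 (fun eta => ky z eta * (S z * S eta))).
  apply: (@mbd_J _ _ RT (fun p => ky p.1 p.2 * (S p.1 * S p.2)) _ _ w1).
  exact: (mbdM (@mbd_ky R) (mbdM (mbd_fst mS) (mbd_snd mS))).
rewrite /qform -[LHS](J_oo_cc 0 1 mf).
apply: (J_eq0 (weight_oo 0 1)) => z /indic_neq0; rewrite /= in_itv /= => hz.
transitivity (S z * Hs x z); last by rewrite Hs0// mulr0.
rewrite HE -(JZ (S z) w1 (mbdM (mky z) mS)).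
by apply: J_ext => eta _; rewrite mulrCA.
Qed.

End Vanishing.

(** * Vanishing of solutions of the homogeneous problem *)

Section Hom.
Context (R : realType).
Variables (b c T : R) (w p1 p2 q1 q2 wt g : R -> R -> R -> R).
Hypothesis b01 : 0 < b < 1.
Hypothesis c0 : 0 <= c.
Hypothesis T0 : 0 < T.
Hypothesis H : hom_solution b c T w p1 p2 q1 q2 wt g.
Local Notation W := (ext T w).

Theorem hom_solution0 x y t : Omega T (x, y, t) -> w x y t = 0.
Proof.
have cW := ext_cb3 T0 H.
have I0 x0 y0 s : 0 < x0 < 1 -> 0 < y0 < 1 -> 0 < s < T -> Iab 0 s (W x0 y0) = 0.
  move=> hx hy hs; have [s0 _] := andP hs.
  apply: (energy_vanish cW s0) => // x1 y1 hx1 hy1.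
  exact: (limit_ineq b01 c0 T0 H hx1 hy1 hs).
have W0 x0 y0 s : 0 < x0 < 1 -> 0 < y0 < 1 -> 0 < s < T -> W x0 y0 s = 0.
  move=> hx hy /andP[s0 sT].
  have d1 := Iab_is_derive (@cb3_t R _ cW x0 y0) s0.
  have d2 : is_derive s 1 (Iab 0 ^~ (W x0 y0)) 0.
    apply: (near_eq_is_derive _ (is_derive_cst (0 : R) s 1)).
    near=> z; symmetry; apply: I0 => //.
    by apply/andP; split; near: z; [exact: lt_nbhsr|exact: lt_nbhsl].
  by case: d1 => _ <-; case: d2.
move=> [[]]; rewrite /= !in_itv /= => hx hy ht.
rewrite -(ext_id w hx hy ht).
(* Vanishing in the interior passes to the closed box by continuity of [W], one variable at a
   time. *)
apply: (continuous0_cc ltr01 (@cb3_x R _ cW y t)) hx => x0 hx.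
apply: (continuous0_cc ltr01 (@cb3_y R _ cW x0 t)) hy => y0 hy.
apply: (continuous0_cc T0 (@cb3_t R _ cW x0 y0)) ht => s hs.
exact: W0.
Unshelve. all: by end_near. Qed.

End Hom.

(** * The difference of two solutions *)

Section Difference.
Context (R : realType).
Local Notation mu := (@lebesgue_measure R).

Lemma continuous_onB (A : set (R * R * R)) (f g : R -> R -> R -> R) :
  continuous_on A f -> continuous_on A g ->
  continuous_on A (fun x y t => f x y t - g x y t).
Proof. by move=> cf cg p; apply: cvgB; [exact: cf|exact: cg]. Qed.

Lemma is_derive_derive1 (f : R -> R) (x : R) : derivable f x 1 -> is_derive x 1 f (derive1 f x).
Proof. by move=> df; apply: DeriveDef => //; rewrite derive1E. Qed.

Lemma pdtE (u : R -> R -> R -> R) x y t : 0 < t -> pdt u x y t = derive1 (u x y) t.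
Proof. by move=> t0; rewrite /pdt gt_eqF. Qed.

(** Near a positive time, [pdt] is the ordinary derivative, its one-sided branch being confined to
    time 0. [has_caputo] provides both derivatives at the endpoint [z = t] too. *)
Lemma is_derive_pdt (alpha : R) (u : R -> R -> R -> R) x y t : 0 < t -> has_caputo alpha (u x y) t ->
  is_derive t 1 (u x y) (pdt u x y t) /\ is_derive t 1 (pdt u x y) (derive1n 2 (u x y) t).
Proof.
move=> t0 [h _]; have /h[d1 d2] : 0 < t <= t by rewrite t0 lexx.
split; first by rewrite pdtE//; exact: is_derive_derive1.
apply: (near_eq_is_derive _ (is_derive_derive1 d2)).
near=> z; rewrite pdtE//; near: z; exact: lt_nbhsr.
Unshelve. all: by end_near. Qed.

Lemma Gamma_ge0 (a : R) : 0 <= Gamma a.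
Proof.
by apply: Rintegral_ge0 => s _; rewrite mulr_ge0 ?powR_ge0 ?expR_ge0.
Qed.

Lemma J_kerE (b t : R) (g : R -> R) :
  J (ker b t) g = \int[mu]_(z in `]0, t[) (g z / (t - z) `^ b).
Proof.
rewrite -J_indicE; apply: eq_Rintegral => z _.
by rewrite /ker mulrC; ring.
Qed.

Let equationB (a q p d n a' p' d' : R) :
  (a + q * p + d + n) - (a' + q * p' + d' + n) = (a - a') + q * (p - p') + (d - d').
Proof. by ring. Qed.

Variables (alpha T : R) (f : R -> R -> R -> R) (phi psi : R -> R -> R).
Variables (u v : R -> R -> R -> R).
Hypothesis hu : is_solution alpha T f phi psi u.
Hypothesis hv : is_solution alpha T f phi psi v.

(** Everything is linear and the data cancel. For the Caputo derivative, additivity of the integral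
    rests on the convergence of both integrands recorded in [has_caputo]. *)
Lemma hom_solutionB : hom_solution (alpha - 1) (Gamma (2 - alpha))^-1 T
  (fun x y t => u x y t - v x y t)
  (fun x y t => pdx u x y t - pdx v x y t)
  (fun x y t => pdx (pdx u) x y t - pdx (pdx v) x y t)
  (fun x y t => pdy u x y t - pdy v x y t)
  (fun x y t => pdy (pdy u) x y t - pdy (pdy v) x y t)
  (fun x y t => pdt u x y t - pdt v x y t)
  (fun x y t => derive1n 2 (u x y) t - derive1n 2 (v x y) t).
Proof.
have pos x y t : Omega_int T (x, y, t) -> 0 < t.
  by move=> [_]; rewrite /= in_itv /= => /andP[].
have cap x y t : Omega_int T (x, y, t) -> forall z,
    (derive1n 2 (u x y) z - derive1n 2 (v x y) z) / (t - z) `^ (alpha - 1) =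
    caputo_integrand alpha (u x y) t z - caputo_integrand alpha (v x y) t z.
  by move=> _ z; rewrite mulrBl.
split.
- by apply: continuous_onB; [exact: sol_continuous hu|exact: sol_continuous hv].
- by move=> y t hy ht; rewrite (sol_boundary_x1 hu)// (sol_boundary_x1 hv)// subrr.
- by move=> x t hx ht; rewrite (sol_boundary_y0 hu)// (sol_boundary_y0 hv)// subrr.
- by move=> x t hx ht; rewrite (sol_boundary_y1 hu)// (sol_boundary_y1 hv)// subrr.
- by move=> x y hx hy; rewrite (sol_initial hu)// (sol_initial hv)// subrr.
- move=> x y t h.
  exact: (is_deriveB (is_derive_derive1 (sol_has_ux hu h)) (is_derive_derive1 (sol_has_ux hv h))).
- move=> x y t h.
  exact: (is_deriveB (is_derive_derive1 (sol_has_uxx hu h)) (is_derive_derive1 (sol_has_uxx hv h))).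
- move=> x y t h.
  exact: (is_deriveB (is_derive_derive1 (sol_has_uy hu h)) (is_derive_derive1 (sol_has_uy hv h))).
- move=> x y t h.
  exact: (is_deriveB (is_derive_derive1 (sol_has_uyy hu h)) (is_derive_derive1 (sol_has_uyy hv h))).
- by apply: continuous_onB; [exact: sol_ux_continuous hu|exact: sol_ux_continuous hv].
- by apply: continuous_onB; [exact: sol_uxx_continuous hu|exact: sol_uxx_continuous hv].
- by apply: continuous_onB; [exact: sol_uyy_continuous hu|exact: sol_uyy_continuous hv].
- by apply: continuous_onB; [exact: sol_ut_continuous hu|exact: sol_ut_continuous hv].
- move=> x y hx hy.
  by rewrite (sol_initial_velocity hu hx hy) (sol_initial_velocity hv hx hy) subrr.
- move=> x y t h.
  have [du _] := is_derive_pdt (pos _ _ _ h) (sol_has_caputo hu h).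
  have [dv _] := is_derive_pdt (pos _ _ _ h) (sol_has_caputo hv h).
  exact: (is_deriveB du dv).
- move=> x y t h.
  have [_ du] := is_derive_pdt (pos _ _ _ h) (sol_has_caputo hu h).
  have [_ dv] := is_derive_pdt (pos _ _ _ h) (sol_has_caputo hv h).
  exact: (is_deriveB du dv).
- move=> x y t h; have mI : measurable (`]0, t[ : set (measurableTypeR R)) by exact: measurable_itv.
  have [_ iu] := sol_has_caputo hu h; have [_ iv] := sol_has_caputo hv h.
  have := integrableB mI iu iv.
  apply: (eq_integrable mI) => z _.
  by rewrite (cap _ _ _ h) EFinB.
- move=> x y t h; have mI : measurable (`]0, t[ : set (measurableTypeR R)) by exact: measurable_itv.
  have [_ iu] := sol_has_caputo hu h; have [_ iv] := sol_has_caputo hv h.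
  rewrite J_kerE.
  transitivity (caputo alpha (u x y) t - caputo alpha (v x y) t).
    rewrite /caputo -mulrBr -(RintegralB mI iu iv); congr (_ * _).
    by apply: eq_Rintegral => z _; exact: cap h z.
  rewrite (sol_equation hu h) (sol_equation hv h); exact: equationB.
Qed.

End Difference.

Theorem mainTheorem2 (R : realType) (alpha T : R)
    (f : R -> R -> R -> R) (phi psi : R -> R -> R) (u v : R -> R -> R -> R)
    (halpha : 1 < alpha < 2) (hT : 0 < T)
    (hu : is_solution alpha T f phi psi u)
    (hv : is_solution alpha T f phi psi v) :
  forall x y t : R, Omega T (x, y, t) -> u x y t = v x y t.
Proof.
move=> x y t h; apply/eqP; rewrite -subr_eq0; apply/eqP.
apply: (hom_solution0 _ _ hT (hom_solutionB hu hv)) h.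
  by case/andP: halpha => h1 h2; rewrite subr_gt0 h1 ltrBlDr.
by rewrite invr_ge0 Gamma_ge0.
Qed.
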